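(* Consider the $n$-dimensional compressible Euler system, $n=2$ and $n=3$, for an ideal polytropic gas with adiabatic index $\gamma>1$. This system admits non-isentropic, radial and self-similar solutions with $\lambda>1$, in which a spherical cavity collapses at the center of motion. That is, there exist constants $\lambda>1$, $\kappa\in\mathbb{R}$, $x_0<0$ and functions $R,V,C:(x_0,0)\to\mathbb{R}$ with $R>0$, $C>0$, such that, with $r_0(t):=(t/x_0)^{1/\lambda}$ for $t\le 0$, the functions $$\rho(t,r)=r^{\kappa}R(x),\qquad u(t,r)=-\frac{r^{1-\lambda}}{\lambda}\frac{V(x)}{x},\qquad c(t,r)=-\frac{r^{1-\lambda}}{\lambda}\frac{C(x)}{x},\qquad x=\frac{t}{r^{\lambda}},$$ defined for $t<0$, $r>r_0(t)$, have the following properties. (i) (Classical solution.) The functions $\rho(t,|\mathbf{x}|)$, $\mathbf{u}(t,\mathbf{x})=u(t,|\mathbf{x}|)\frac{\mathbf{x}}{|\mathbf{x}|}$, $c(t,|\mathbf{x}|)$ are $C^1$ and give a classical solution of the $n$-dimensional compressible Euler system for an ideal polytropic gas with adiabatic index $\gamma$ in the fluid region $\{(t,\mathbf{x})\in\mathbb{R}\times\mathbb{R}^n: t<0,\ |\mathbf{x}|>r_0(t)\}$; the ball $\{|\mathbf{x}|<r_0(t)\}$ is a vacuum region (cavity), which collapses to the origin as $t\uparrow0$. (ii) (Non-isentropic.) The specific entropy is not constant in the fluid region. (iii) (Blowup.) The velocity and the sound speed blow up at collapse: for every $\delta>0$, $\sup_{r_0(t)<r<\delta}|u(t,r)|\to\infty$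 and $\sup_{r_0(t)<r<\delta}c(t,r)\to\infty$ as $t\uparrow0$. (iv) (Locally bounded mass, momentum, energy.) For every $t\le 0$ (including the time of collapse $t=0$) and every $\bar r\in(r_0(t),\infty)$ the integrals $$\int_{r_0(t)}^{\bar r}\rho\, r^{n-1}\,dr,\qquad \int_{r_0(t)}^{\bar r}\rho|u|\,r^{n-1}\,dr,\qquad \int_{r_0(t)}^{\bar r}\rho\big(\varepsilon+\tfrac12u^2\big)r^{n-1}\,dr$$ are finite, where at $t=0$ (with $r_0(0)=0$) the fields are the limits as $t\uparrow0$ with $r>0$ fixed (which exist). (v) (Vanishing pressure.) The pressure vanishes along the fluid-vacuum interface: for each fixed $t<0$, $p(t,r)\to0$ as $r\downarrow r_0(t)$. (vi) (Interface.) The fluid-vacuum interface $r=r_0(t)$ is a material surface, i.e. $\dot r_0(t)=\lim_{r\downarrow r_0(t)}u(t,r)$ for all $t<0$, and it propagates with a finite and non-vanishing acceleration $\ddot r_0(t)$ for all $t<0$ (prior to collapse). Finally, flows of this type exist for $\gamma=\tfrac53,\tfrac75,3$ in both two dimensions ($n=2$) and three dimensions ($n=3$).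
   Context: The compressible (non-isentropic) Euler system in $\mathbb{R}^n$ is $$\rho_t+\mathrm{div}_{\mathbf{x}}(\rho\mathbf{u})=0,\quad (\rho\mathbf{u})_t+\mathrm{div}_{\mathbf{x}}[\rho\mathbf{u}\otimes\mathbf{u}]+\mathrm{grad}_{\mathbf{x}}\,p=0,\quad (\rho\mathcal{E})_t+\mathrm{div}_{\mathbf{x}}[(\rho\mathcal{E}+p)\mathbf{u}]=0,$$ with density $\rho$, velocity $\mathbf{u}$, specific internal energy $\varepsilon$, total energy density $\mathcal{E}=\varepsilon+\frac12|\mathbf{u}|^2$. The gas is ideal polytropic with adiabatic index $\gamma>1$: $p=(\gamma-1)\rho\varepsilon$ and $\varepsilon=c_v\theta$, where $\theta$ is the absolute temperature and $c_v>0$ is a constant. The sound speed is $c=\sqrt{\gamma p/\rho}=\sqrt{\gamma(\gamma-1)\varepsilon}$, so that $\varepsilon=\frac{c^2}{\gamma(\gamma-1)}$ and $p=\frac{\rho c^2}{\gamma}$. The specific entropy $S$ is, up to an additive constant, $S=c_v\log(\varepsilon\rho^{1-\gamma})$; thus $S$ is constant in the fluid region if and only if $\rho^{1-\gamma}c^2$ is constant there. For radial flows $\rho=\rho(t,r)$, $\mathbf{u}=u(t,r)\frac{\mathbf{x}}{r}$, $c=c(t,r)$, $r=|\mathbf{x}|$, the Euler system is, for $C^1$ solutions with $\rho,c>0$, equivalent to $$\rho_t+u\rho_r+\rho\Big(u_r+\frac{(n-1)u}{r}\Big)=0,\quad u_t+uu_r+\frac{1}{\gamma\rho}(\rho c^2)_r=0,\quad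 c_t+uc_r+\frac{\gamma-1}{2}c\Big(u_r+\frac{(n-1)u}{r}\Big)=0.$$ *)

(* Defs.v *)
From HB Require Import structures.
From mathcomp Require Export all_boot all_order all_algebra.
From mathcomp Require Export all_classical all_reals all_analysis.

Set Implicit Arguments.
Unset Strict Implicit.
Unset Printing Implicit Defensive.

Import Order.TTheory GRing.Theory Num.Theory.
Import numFieldNormedType.Exports.

Local Open Scope classical_set_scope.
Local Open Scope ring_scope.

(* The library norm on ['rV[R]_n] is the sup norm; |x| in the Euler system is
   the Euclidean norm. *)
Definition eucl_norm (R : realType) (n : nat) (x : 'rV[R]_n) : R :=
  Num.sqrt (\sum_(j < n) x 0 j ^+ 2).

Definition partial_t (R : realType) (n : nat) (f : R * 'rV[R]_n -> R)
    (z : R * 'rV[R]_n) : R :=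
  'D_((1, 0) : R * 'rV[R]_n) f z.

Definition partial_x (R : realType) (n : nat) (j : 'I_n)
    (f : R * 'rV[R]_n -> R) (z : R * 'rV[R]_n) : R :=
  'D_((0, delta_mx 0 j) : R * 'rV[R]_n) f z.

(* Meant for open [Omega]. *)
Definition C1_on (R : realType) (V W : normedModType R) (Omega : set V)
    (f : V -> W) : Prop :=
  forall z, Omega z -> differentiable f z /\
    forall v, {for z, continuous (fun y => 'D_v f y)}.

(* Solves c ^ 2 = gamma * (gamma - 1) * e for e. *)
Definition internal_energy (R : realType) (gamma c : R) : R :=
  c ^+ 2 / (gamma * (gamma - 1)).

Definition pressure (R : realType) (gamma rho e : R) : R :=
  (gamma - 1) * rho * e.

Definition entropy (R : realType) (gamma cv rho e : R) : R :=
  cv * ln (e * rho `^ (1 - gamma)).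

Definition euler_classical_solution (R : realType) (n : nat) (gamma : R)
    (Omega : set (R * 'rV[R]_n)) (rho : R * 'rV[R]_n -> R)
    (u : R * 'rV[R]_n -> 'rV[R]_n) (c : R * 'rV[R]_n -> R) : Prop :=
  let e z := internal_energy gamma (c z) in
  let p z := pressure gamma (rho z) (e z) in
  let E z := e z + eucl_norm (u z) ^+ 2 / 2 in
  [/\ C1_on Omega rho, C1_on Omega u, C1_on Omega c,
      (forall z, Omega z -> 0 < rho z /\ 0 < c z) &
      forall z, Omega z ->
      [/\ partial_t rho z
            + \sum_(j < n) partial_x j (fun y => rho y * u y 0 j) z = 0,
          (forall i : 'I_n,
            partial_t (fun y => rho y * u y 0 i) z
            + \sum_(j < n) partial_x j (fun y => rho y * u y 0 i * u y 0 j) z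
            + partial_x i p z = 0) &
          partial_t (fun y => rho y * E y) z
            + \sum_(j < n) partial_x j
                (fun y => (rho y * E y + p y) * u y 0 j) z = 0]].

Definition similarity_var (R : realType) (lambda t r : R) : R :=
  t / r `^ lambda.

Definition sim_density (R : realType) (lambda kappa : R) (F : R -> R)
    (t r : R) : R :=
  r `^ kappa * F (similarity_var lambda t r).

Definition sim_speed (R : realType) (lambda : R) (F : R -> R) (t r : R) : R :=
  let x := similarity_var lambda t r in
  - (r `^ (1 - lambda) / lambda) * (F x / x).

(* For t <= 0 and x0 < 0 the base is nonnegative and, as 1 / lambda != 0, the
   value at t = 0 is 0. *)
Definition interface (R : realType) (lambda x0 t : R) : R :=
  (t / x0) `^ lambda^-1.

Definition fluid_region (R : realType) (n : nat) (r0 : R -> R) :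
    set (R * 'rV[R]_n) :=
  [set z | z.1 < 0 /\ r0 z.1 < eucl_norm z.2].

Definition cavity (R : realType) (n : nat) (r0 : R -> R) :
    set (R * 'rV[R]_n) :=
  [set z | z.1 < 0 /\ eucl_norm z.2 < r0 z.1].

Definition density_field (R : realType) (n : nat) (r0 : R -> R)
    (rho : R -> R -> R) (z : R * 'rV[R]_n) : R :=
  if r0 z.1 < eucl_norm z.2 then rho z.1 (eucl_norm z.2) else 0.

Definition radial_scalar (R : realType) (n : nat) (f : R -> R -> R)
    (z : R * 'rV[R]_n) : R := f z.1 (eucl_norm z.2).

Definition radial_vector (R : realType) (n : nat) (f : R -> R -> R)
    (z : R * 'rV[R]_n) : 'rV[R]_n :=
  (f z.1 (eucl_norm z.2) / eucl_norm z.2) *: z.2.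

(* A field given for t < 0, with its value at t = 0 taken to be its limit as
   t increases to 0 at fixed r. *)
Definition up_to_collapse (R : realType) (f : R -> R -> R) (t r : R) : R :=
  if t < 0 then f t r else lim (f s r @[s --> 0^'-]).

Definition has_collapse_limit (R : realType) (f : R -> R -> R) : Prop :=
  forall r, 0 < r -> cvg (f s r @[s --> 0^'-]).

Definition blows_up_at_collapse (R : realType) (r0 : R -> R)
    (f : R -> R -> R) : Prop :=
  forall delta, 0 < delta ->
    ereal_sup [set (`|f t r|)%:E | r in `]r0 t, delta[] @[t --> 0^'-] --> +oo%E.

Definition locally_bounded_mass_momentum_energy (R : realType) (n : nat)
    (gamma : R) (r0 : R -> R) (rho u c : R -> R -> R) : Prop :=
  forall t rbar, t <= 0 -> r0 t < rbar ->
  let rho_t := up_to_collapse rho t in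
  let u_t := up_to_collapse u t in
  let e_t r := internal_energy gamma (up_to_collapse c t r) in
  let finite_integral (f : R -> R) :=
    (@lebesgue_measure R).-integrable `]r0 t, rbar[ (EFin \o f) in
  [/\ finite_integral (fun r => rho_t r * r ^+ n.-1),
      finite_integral (fun r => rho_t r * `|u_t r| * r ^+ n.-1) &
      finite_integral
        (fun r => rho_t r * (e_t r + u_t r ^+ 2 / 2) * r ^+ n.-1)].

Definition vacuum_cavity_collapses (R : realType) (n : nat) (r0 : R -> R)
    (rho : R * 'rV[R]_n -> R) : Prop :=
  [/\ (forall z, cavity r0 z -> rho z = 0),
      (forall t, t < 0 -> 0 < r0 t) &
      r0 t @[t --> 0^'-] --> (0 : R)].

Definition non_isentropic (R : realType) (n : nat) (gamma cv : R)
    (Omega : set (R * 'rV[R]_n)) (rho c : R * 'rV[R]_n -> R) : Prop :=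
  ~ exists s : R, forall z, Omega z ->
      entropy gamma cv (rho z) (internal_energy gamma (c z)) = s.

Definition vanishing_interface_pressure (R : realType) (gamma : R)
    (r0 : R -> R) (rho c : R -> R -> R) : Prop :=
  forall t, t < 0 ->
    pressure gamma (rho t r) (internal_energy gamma (c t r))
      @[r --> (r0 t)^'+] --> (0 : R).

Definition material_interface (R : realType) (r0 : R -> R)
    (u : R -> R -> R) : Prop :=
  forall t, t < 0 ->
    derivable r0 t 1 /\ u t r @[r --> (r0 t)^'+] --> derive1 r0 t.

Definition finite_nonzero_acceleration (R : realType) (r0 : R -> R) : Prop :=
  forall t, t < 0 ->
    derivable (derive1 r0) t 1 /\ derive1 (derive1 r0) t != 0.

Definition is_collapsing_cavity_flow (R : realType) (n : nat)
    (gamma cv lambda kappa x0 : R) (Rf V C : R -> R) : Prop :=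
  let r0 := interface lambda x0 in
  let rho := sim_density lambda kappa Rf in
  let u := sim_speed lambda V in
  let c := sim_speed lambda C in
  let Omega := @fluid_region R n r0 in
  let rho_field := @density_field R n r0 rho in
  let u_field := @radial_vector R n u in
  let c_field := @radial_scalar R n c in
  (euler_classical_solution gamma Omega rho_field u_field c_field /\
   vacuum_cavity_collapses r0 rho_field) /\
  non_isentropic gamma cv Omega rho_field c_field /\
  (blows_up_at_collapse r0 u /\ blows_up_at_collapse r0 c) /\
  ([/\ has_collapse_limit rho, has_collapse_limit u & has_collapse_limit c] /\
   locally_bounded_mass_momentum_energy n gamma r0 rho u c) /\
  vanishing_interface_pressure gamma r0 rho c /\
  (material_interface r0 u /\ finite_nonzero_acceleration r0).

(* The profiles are meant as functions on ]x0, 0[: in the fluid region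
   t / r ^ lambda lies there, so their values elsewhere play no role. *)
Definition admits_collapsing_cavity_flow (R : realType) (n : nat)
    (gamma cv : R) : Prop :=
  exists (lambda kappa x0 : R) (Rf V C : R -> R),
    [/\ 1 < lambda, x0 < 0,
        (forall x, x0 < x < 0 -> 0 < Rf x /\ 0 < C x) &
        is_collapsing_cavity_flow n gamma cv lambda kappa x0 Rf V C].

(* Main.v *)
From HB Require Import structures.
Require Import Defs.
From mathcomp Require Import ring lra.
Set Implicit Arguments.
Unset Strict Implicit.
Import Order.TTheory GRing.Theory Num.Theory.
Import numFieldNormedType.Exports.
Local Open Scope classical_set_scope.
Local Open Scope ring_scope.

(** The ansatz turns the Euler system into ordinary differential equations for the
    profiles in the variable [x = t / r ^ lam], and all the asserted properties
    are read off from the behaviour of the profiles at the two ends of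
    [(x0, 0)]: at [x0], the interface, [V] tends to [-1] and [C], [R] tend to
    [0]; at [0], the time of collapse, [V / x], [C / x] and [R] have finite
    limits.  The exponents of [r] do the rest: [lam > 1] makes the speeds blow
    up, [kappa > 2 lam - 1] keeps mass, momentum and energy finite, and the
    entropy is a nonconstant affine function of [ln r] along the curves on
    which [x] is constant.

    The system of the profiles is autonomous in [ln (- x)], and the density can be
    eliminated.  In the variables [W = 1 + V] and [y = C ^ 2 / W] there remains
    an orbit to be found, which runs from the vacuum [W = 0] to the point of
    collapse [W = 1].  The difficulty is that it crosses the sonic line
    [y = W], on which the equations are singular.  One is free to choose [lam]
    and [kappa].  With [lam = 1 + (n - 1) (gamma - 1) / 2] the equations
    simplify, and [kappa] moves the abscissa [ws] of the crossing, which is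
    chosen close to the vacuum.  It is convenient to follow the orbit through
    [v = - lam x dW/dx] as a function of [W].

    - Between [0] and [W1 = 4 ws] two constants [v2 < v0] are barriers
      ([lower_barrier], [upper_barrier]), so there are solutions in the strip
      on both sides of [ws] ([left_arc], [right_arc]).  At [ws] the slope is
      of the form [0 / 0] and the singular point is a node: every solution in
      the strip tends to the same value [vs] ([node_limit]).  At [0] the
      singular point repels, so the left arc tends to [v0] ([vacuum_limit]).
    - Between [W1] and [1] the unknown [Y = y / (1 - W) ^ 2] satisfies a regular
      equation, and the barriers [0] and [Y1] lead the orbit to the point of
      collapse ([collapse_arc]).

    The arcs fit together to one orbit ([orbit_exists]).  Although [v] is only
    shown to be continuous at the junctions, [y] is differentiable there, as
    its derivative is a function of [W], [v] and [y].  Integrating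
    [dx/dW = - lam x / v] recovers the profiles ([profile_exists]).

    Solutions between barriers are limits of Euler polygons along an
    ultrafilter ([ode_segment], [ode_open], [ode_half_open]).  In space-time,
    the Euler system is checked with a calculus of radial functions in terms
    of [r d/dr] and [t d/dt] ([euler_of_radial]). *)

(** * Real functions of one variable *)

Section RealFunctions.
Variable R : realType.
Implicit Types (f g df : R -> R).

Lemma is_derive_continuous f (x l : R) : is_derive x 1 f l -> {for x, continuous f}.
Proof. by move=> [fx _]; exact/differentiable_continuous/derivable1_diffP. Qed.

Lemma mvt f df (a b : R) : a < b ->
  (forall x, a < x < b -> is_derive x 1 f (df x)) ->
  (forall x, a <= x <= b -> {for x, continuous f}) ->
  exists2 z, a < z < b & f b - f a = df z * (b - a).
Proof.
move=> ab fd fc.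
have fd' x : x \in `]a, b[%R -> is_derive x 1 f (df x).
  by rewrite in_itv /=; exact: fd.
have fc' : {within `[a, b], continuous f}.
  by apply: continuous_in_subspaceT => x; rewrite inE /= in_itv /=; exact: fc.
have [z zab E] := MVT ab fd' fc'.
by exists z => //; move: zab; rewrite in_itv.
Qed.

Lemma mvt_open f df (a b p q : R) : (forall x, a < x < b -> is_derive x 1 f (df x)) ->
  a < p -> p < q -> q < b ->
  exists2 z, p < z < q & f q - f p = df z * (q - p).
Proof.
move=> fd ap pq qb; apply: mvt => // x /andP[px xq].
  by apply: fd; apply/andP; split; lra.
by apply: is_derive_continuous (fd x _); apply/andP; split; lra.
Qed.

Lemma nondecreasing_open f df (a b : R) :
  (forall x, a < x < b -> is_derive x 1 f (df x)) ->
  (forall x, a < x < b -> 0 <= df x) ->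
  forall x y, a < x -> x <= y -> y < b -> f x <= f y.
Proof.
move=> fd df0 x y ax + yb; rewrite le_eqVlt => /predU1P[->//|xy].
have [z /andP[xz zy] E] := mvt_open fd ax xy yb.
rewrite -subr_ge0 E; apply: mulr_ge0; last by rewrite subr_ge0 ltW.
by apply: df0; apply/andP; split; lra.
Qed.

Lemma nonincreasing_open f df (a b : R) :
  (forall x, a < x < b -> is_derive x 1 f (df x)) ->
  (forall x, a < x < b -> df x <= 0) ->
  forall x y, a < x -> x <= y -> y < b -> f y <= f x.
Proof.
move=> fd df0 x y ax + yb; rewrite le_eqVlt => /predU1P[->//|xy].
have [z /andP[xz zy] E] := mvt_open fd ax xy yb.
rewrite -subr_le0 E; apply: mulr_le0_ge0; last by rewrite subr_ge0 ltW.
by apply: df0; apply/andP; split; lra.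
Qed.

(** Removable singularity of the derivative, by the mean value theorem; it gives
    the equation of the orbit at the two points where arcs are joined. *)
Lemma is_derive_of_limit f df (a b c : R) : a < c < b ->
  (forall x, a < x < b -> x != c -> is_derive x 1 f (df x)) ->
  {for c, continuous f} -> {for c, continuous df} -> is_derive c 1 f (df c).
Proof.
move=> /andP[ac cb] fd fc dfc.
have cont x : a < x < b -> {for x, continuous f}.
  by have [->//|xc] := eqVneq x c => xab; exact: is_derive_continuous (fd x xab xc).
have H : h^-1 *: ((f \o shift c) (h *: (1 : R)) - f c) @[h --> 0^'] --> df c.
  apply/cvgrPdist_le => e e0.
  move/cvgrPdist_le : dfc => /(_ e e0).
  rewrite -nbhs_nearE => -[r /= r0 rH].
  pose D := Num.min (Num.min (c - a) (b - c)) r.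
  have D0 : 0 < D by rewrite /D !lt_min !subr_gt0 ac cb r0.
  near=> h.
  have hn0 : h != 0 by near: h; exact: nbhs_dnbhs_neq.
  have hD : `|h| < D by near: h; exact: dnbhs0_lt.
  move: hD; rewrite /D !lt_min => /andP[/andP[h1 h2] h3].
  rewrite /= /GRing.scale /= mulr1.
  have [z zh ->] : exists2 z, `|c - z| < r & h^-1 * (f (h + c) - f c) = df z.
    move: h1 h2 h3; rewrite !ltr_norml => /andP[? ?] /andP[? ?] /andP[? ?].
    have [hneg|hpos|//] := ltgtP h 0; last by move=> h0; rewrite h0 eqxx in hn0.
    - have [||| z /andP[z1 z2] E] := @mvt f df (h + c) c; first by lra.
      + move=> x /andP[? ?]; apply: fd; first by apply/andP; split; lra.
        by rewrite lt_eqF//; lra.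
      + by move=> x /andP[? ?]; apply: cont; apply/andP; split; lra.
      exists z; first by rewrite ltr_norml; apply/andP; split; lra.
      have -> : f (h + c) - f c = - (df z * (c - (h + c))) by rewrite -E; ring.
      by field.
    - have [||| z /andP[z1 z2] E] := @mvt f df c (h + c); first by lra.
      + move=> x /andP[? ?]; apply: fd; first by apply/andP; split; lra.
        by rewrite gt_eqF//; lra.
      + by move=> x /andP[? ?]; apply: cont; apply/andP; split; lra.
      exists z; first by rewrite ltr_norml; apply/andP; split; lra.
      by rewrite E; field.
  exact: rH.
apply: DeriveDef; first by apply/cvg_ex; exists (df c).
exact: cvg_lim.
Unshelve. all: by end_near. Qed.

Lemma is_derive_sqr f (x l : R) : is_derive x 1 f l ->
  is_derive x 1 (fun t => f t ^+ 2) (2 * f x * l).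
Proof.
move=> fl; have := @is_deriveM _ _ f f x 1 _ _ fl fl.
by have -> : f x *: l + f x *: l = 2 * f x * l by rewrite /GRing.scale /=; ring.
Qed.

Lemma is_derive_mul f g (x l k : R) : is_derive x 1 f l -> is_derive x 1 g k ->
  is_derive x 1 (fun t => f t * g t) (f x * k + g x * l).
Proof. by move=> fl gk; exact: (@is_deriveM _ _ f g x 1 _ _ fl gk). Qed.

(** Behaviour at a regular singular point of the equation
    [z e' = +- k e + h] with [k >= k0 > 0] and [h = O(z)]. *)
Section SingularPoint.
Variables (e de k h : R -> R) (z1 k0 C M : R).
Hypotheses (z10 : 0 < z1) (k00 : 0 < k0) (C0 : 0 <= C) (M0 : 0 <= M).
Hypothesis ed : forall z, 0 < z < z1 -> is_derive z 1 e (de z).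
Hypothesis kge : forall z, 0 < z < z1 -> k0 <= k z.
Hypothesis hle : forall z, 0 < z < z1 -> `|h z| <= C * z.
Hypothesis eM : forall z, 0 < z < z1 -> `|e z| <= M.

Let eh z : 0 < z < z1 -> `|e z * h z| <= C * M * z.
Proof.
move=> zz; rewrite normrM.
have -> : C * M * z = M * (C * z) by ring.
by apply: ler_pM => //; [exact: eM|exact: hle].
Qed.

Lemma sqr_cvg0 : e z ^+ 2 @[z --> 0^'+] --> 0 -> e z @[z --> 0^'+] --> 0.
Proof.
move=> /cvgrPdist_lt H; apply/cvgrPdist_lt => r r0.
have := H (r ^+ 2) (exprn_gt0 2 r0); apply: filterS => z.
rewrite !sub0r !normrN normrX.
by rewrite ltr_pXn2r// nnegrE ltW.
Qed.

(** All solutions of [z e' = k e] vanish at [0] at least like [z ^ k0].  The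
    energy [e ^ 2] divided by the smaller power [z ^ mu] is nondecreasing after
    a correction that absorbs [h], and so [e ^ 2 = O(z ^ mu)]. *)
Lemma attracting_cvg0 :
  (forall z, 0 < z < z1 -> z * de z = k z * e z + h z) ->
  e z @[z --> 0^'+] --> 0.
Proof.
move=> eq.
(* mu < 1 lets the multiple of z ^ (1 - mu) absorb the remainder *)
pose mu := Num.min k0 2^-1.
have mu0 : 0 < mu by rewrite /mu lt_min k00 invr_gt0 ltr0n.
have muk : mu <= k0 by rewrite /mu ge_min lexx.
have mu2 : mu <= 2^-1 by rewrite /mu ge_min lexx orbT.
pose A := 4 * C * M.
have A0 : 0 <= A by rewrite !mulr_ge0//.
pose F z := e z ^+ 2 * z `^ (- mu) + A * z `^ (1 - mu).
pose dF z := e z ^+ 2 * (- mu * z `^ (- mu - 1)) + z `^ (- mu) * (2 * e z * de z)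
   + A * ((1 - mu) * z `^ (1 - mu - 1)).
have Fd z : 0 < z < z1 -> is_derive z 1 F (dF z).
  move=> /[dup] zz /andP[z0 _]; apply: is_deriveD.
    by apply: is_derive_mul; [exact: is_derive_sqr (ed zz)|exact: is_derive1_powR].
  have := is_derive_mul (is_derive_cst A z 1) (is_derive1_powR (1 - mu) z0).
  by rewrite mulr0 addr0.
have dF0 z : 0 < z < z1 -> 0 <= dF z.
  move=> /[dup] zz /andP[z0 _].
  have E1 : z `^ (- mu) = z * z `^ (- mu - 1).
    rewrite -{2}(powRr1 (ltW z0)) -powRD; first by congr (_ `^ _); ring.
    by rewrite (gt_eqF z0) implybT.
  have E2 : z `^ (1 - mu - 1) = z * z `^ (- mu - 1).
    by rewrite -E1; congr (_ `^ _); ring.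
  have -> : dF z = z `^ (- mu - 1) * ((2 * k z - mu) * e z ^+ 2 + 2 * (e z * h z)
     + A * (1 - mu) * z).
    rewrite /dF E1 E2.
    have -> : z * z `^ (- mu - 1) * (2 * e z * de z) =
       z `^ (- mu - 1) * (2 * e z * (z * de z)) by ring.
    by rewrite eq//; ring.
  rewrite mulr_ge0 ?powR_ge0//.
  have h1 : 0 <= (2 * k z - mu) * e z ^+ 2.
    by rewrite mulr_ge0 ?sqr_ge0//; have := kge zz; lra.
  have h2 := eh zz; move: h2; rewrite ler_norml => /andP[h2 _].
  have CMz : 0 <= C * M * z by rewrite !mulr_ge0// ltW.
  have h3 : 2 * (C * M * z) <= A * (1 - mu) * z.
    have -> : A * (1 - mu) * z = (C * M * z) * (4 * (1 - mu)) by rewrite /A; ring.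
    have : (C * M * z) * 2 <= (C * M * z) * (4 * (1 - mu)).
      by rewrite ler_wpM2l//; lra.
    lra.
  lra.
apply: sqr_cvg0.
pose z2 := z1 / 2; have z2b : 0 < z2 < z1 by rewrite /z2; have := z10; move=> ?; apply/andP; split; lra.
apply: (@squeeze_cvgr _ _ _ _ (fun=> 0) (fun z => F z2 * z `^ mu)).
- near=> z; rewrite sqr_ge0 /=.
  have z0 : 0 < z by near: z; exact: nbhs_right_gt.
  have zz2 : z <= z2 by near: z; apply: nbhs_right_le; case/andP: z2b.
  have /andP[_ z2z1] := z2b.
  have := nondecreasing_open Fd dF0 z0 zz2 z2z1.
  have zm : 0 < z `^ mu by rewrite powR_gt0.
  rewrite -(ler_pM2r zm) => H; apply: (le_trans _ H).
  rewrite /F powRN mulrDl divfK ?gt_eqF// lerDl.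
  by rewrite !mulr_ge0// powR_ge0.
- exact: cvg_cst.
- by rewrite -[X in _ --> X](mulr0 (F z2)); apply: cvgMl_tmp; exact: powR_cvg0.
Unshelve. all: by end_near. Qed.

(** Here the solutions of the linear equation blow up like [z ^ (- k0)] unless
    they vanish, so boundedness is what forces the limit: [e ^ 2 z ^ k0], up to
    a correction for [h], is nonincreasing and starts from [0]. *)
Lemma repelling_cvg0 :
  (forall z, 0 < z < z1 -> z * de z = - k z * e z + h z) ->
  e z @[z --> 0^'+] --> 0.
Proof.
move=> eq; pose A := 2 * C * M.
have A0 : 0 <= A by rewrite !mulr_ge0//.
pose F z := e z ^+ 2 * z `^ k0 - A * z `^ (k0 + 1).
pose dF z := e z ^+ 2 * (k0 * z `^ (k0 - 1)) + z `^ k0 * (2 * e z * de z)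
   - A * ((k0 + 1) * z `^ (k0 + 1 - 1)).
have Fd z : 0 < z < z1 -> is_derive z 1 F (dF z).
  move=> /[dup] zz /andP[z0 _]; apply: is_deriveB.
    by apply: is_derive_mul; [exact: is_derive_sqr (ed zz)|exact: is_derive1_powR].
  have := is_derive_mul (is_derive_cst A z 1) (is_derive1_powR (k0 + 1) z0).
  by rewrite mulr0 addr0.
have dF0 z : 0 < z < z1 -> dF z <= 0.
  move=> /[dup] zz /andP[z0 _].
  have E1 : z `^ k0 = z * z `^ (k0 - 1).
    rewrite -{2}(powRr1 (ltW z0)) -powRD; first by congr (_ `^ _); ring.
    by rewrite (gt_eqF z0) implybT.
  have -> : dF z = z `^ (k0 - 1) * ((k0 - 2 * k z) * e z ^+ 2 + 2 * (e z * h z)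
     - A * (k0 + 1) * z).
    rewrite /dF addrK E1.
    have -> : z * z `^ (k0 - 1) * (2 * e z * de z) =
       z `^ (k0 - 1) * (2 * e z * (z * de z)) by ring.
    by rewrite eq//; ring.
  rewrite mulr_ge0_le0 ?powR_ge0//.
  have h1 : (k0 - 2 * k z) * e z ^+ 2 <= 0.
    by rewrite mulr_le0_ge0 ?sqr_ge0//; have := kge zz; have := k00; lra.
  have h2 := eh zz; move: h2; rewrite ler_norml => /andP[_ h2].
  have CMz : 0 <= C * M * z by rewrite !mulr_ge0// ltW.
  have h3 : 2 * (C * M * z) <= A * (k0 + 1) * z.
    have -> : A * (k0 + 1) * z = 2 * (C * M * z) + 2 * (C * M * z) * k0 by rewrite /A; ring.
    by rewrite lerDl !mulr_ge0// ltW.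
  lra.
have F0 z : 0 < z < z1 -> F z <= 0.
  move=> /andP[z0 zz1].
  have : M ^+ 2 * t `^ k0 @[t --> 0^'+] --> M ^+ 2 * 0.
    by apply: cvgMl_tmp; exact: powR_cvg0.
  rewrite mulr0 => /cvgr_to_ge; apply; near=> t.
  have t0 : 0 < t by near: t; exact: nbhs_right_gt.
  have tz : t <= z by near: t; exact: nbhs_right_le.
  apply: (le_trans (nonincreasing_open Fd dF0 t0 tz zz1)).
  rewrite /F; apply: (@le_trans _ _ (e t ^+ 2 * t `^ k0)).
    by rewrite gerBl mulr_ge0// powR_ge0.
  rewrite ler_wpM2r ?powR_ge0// -(real_normK (num_real (e t))).
  by rewrite ler_sqr ?nnegrE// eM// t0 (le_lt_trans tz).
apply: sqr_cvg0.
apply: (@squeeze_cvgr _ _ _ _ (fun=> 0) (fun z => A * z)).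
- near=> z; rewrite sqr_ge0 /=.
  have z0 : 0 < z by near: z; exact: nbhs_right_gt.
  have zz1 : z < z1 by near: z; exact: nbhs_right_lt.
  have := F0 z; rewrite z0 zz1 => /(_ erefl).
  rewrite /F powRD ?(gt_eqF z0) ?implybT// (powRr1 (ltW z0)).
  rewrite subr_le0 [z `^ k0 * z]mulrC mulrA ler_pM2r// powR_gt0//.
- exact: cvg_cst.
- rewrite -[X in _ --> X](mulr0 A); apply: cvgMl_tmp.
  by apply: cvg_at_right_filter; exact: cvg_id.
Unshelve. all: by end_near. Qed.

End SingularPoint.

End RealFunctions.

Section Glue.
Variable R : realType.
Implicit Types (f g : R -> R).

(** Limits instead of values are recorded at the ends, as several functions below
    are given by formulas that are singular there. *)
Definition continuous_onto f (a b l r : R) :=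
  [/\ forall x, a < x < b -> {for x, continuous f},
      f x @[x --> a^'+] --> l & f x @[x --> b^'-] --> r].

Definition glue (c m : R) f g (x : R) : R :=
  if x < c then f x else if c < x then g x else m.

Definition extend (a b l r : R) f (x : R) : R :=
  if x <= a then l else if x < b then f x else r.

Lemma near_continuous f g (x : R) : (\forall z \near x, g z = f z) ->
  {for x, continuous f} -> {for x, continuous g}.
Proof.
move=> fg fc; have E : g x = f x by exact: (nbhs_singleton fg).
suff : g z @[z --> x] --> g x by [].
rewrite E.
apply: cvg_trans fc; apply: near_eq_cvg.
by apply: filterS fg => z ->.
Qed.

Lemma glue_continuous_onto f g (a b c l m r : R) : a < c < b ->
  continuous_onto f a c l m -> continuous_onto g c b m r ->
  continuous_onto (glue c m f g) a b l r.
Proof.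
move=> /andP[ac cb] [fc fl fm] [gc gm gr]; split.
- move=> x /andP[ax xb]; have [xc|cx|xc] := ltgtP x c.
  + apply: (@near_continuous f); last by apply: fc; rewrite ax.
    by near=> z; rewrite /glue ifT//; near: z; exact: lt_nbhsl.
  + apply: (@near_continuous g); last by apply: gc; rewrite cx.
    near=> z; rewrite /glue; have cz : c < z by near: z; exact: lt_nbhsr.
    by rewrite ltNge (ltW cz) /= cz.
  + rewrite xc; apply/left_right_continuousP; rewrite /glue ltxx; split.
      apply: cvg_trans fm; apply: near_eq_cvg; near=> z.
      by rewrite ifT//; near: z; exact: nbhs_left_lt.
    apply: cvg_trans gm; apply: near_eq_cvg; near=> z.
    have cz : c < z by near: z; exact: nbhs_right_gt.
    by rewrite ltNge (ltW cz) /= cz.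
- apply: cvg_trans fl; apply: near_eq_cvg; near=> z.
  by rewrite /glue ifT//; near: z; exact: nbhs_right_lt.
- apply: cvg_trans gr; apply: near_eq_cvg; near=> z.
  have cz : c < z by near: z; exact: nbhs_left_gt.
  by rewrite /glue ltNge (ltW cz) /= cz.
Unshelve. all: by end_near. Qed.

Lemma extend_continuous f (a b l r : R) : a < b -> continuous_onto f a b l r ->
  continuous (extend a b l r f).
Proof.
move=> ab [fc fl fr] x; have [xa|ax|xa] := ltgtP x a.
- apply: (@near_continuous (cst l)); last exact: cvg_cst.
  by near=> z; rewrite /extend ifT// ltW//; near: z; exact: lt_nbhsl.
- have [xb|bx|xb] := ltgtP x b.
  + apply: (@near_continuous f); last by apply: fc; rewrite ax.
    near=> z; have az : a < z by near: z; exact: lt_nbhsr.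
    have zb : z < b by near: z; exact: lt_nbhsl.
    by rewrite /extend leNgt az /= zb.
  + apply: (@near_continuous (cst r)); last exact: cvg_cst.
    near=> z; have bz : b < z by near: z; exact: lt_nbhsr.
    by rewrite /extend leNgt (lt_trans ab bz) /= ltNge (ltW bz).
  + rewrite xb; apply/left_right_continuousP.
    rewrite /extend leNgt ab /= ltxx; split.
      apply: cvg_trans fr; apply: near_eq_cvg; near=> z.
      have az : a < z by near: z; exact: nbhs_left_gt.
      by rewrite leNgt az /= ifT//; near: z; exact: nbhs_left_lt.
    apply: (@cvg_trans _ (cst r z @[z --> b^'+])); last exact: cvg_cst.
    apply: near_eq_cvg; near=> z; have bz : b < z by near: z; exact: nbhs_right_gt.
    by rewrite leNgt (lt_trans ab bz) /= ltNge (ltW bz).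
- rewrite xa; apply/left_right_continuousP; rewrite /extend lexx; split.
    apply: (@cvg_trans _ (cst l z @[z --> a^'-])); last exact: cvg_cst.
    by apply: near_eq_cvg; near=> z; rewrite ifT//; near: z; exact: nbhs_left_le.
  apply: cvg_trans fl; apply: near_eq_cvg; near=> z.
  have az : a < z by near: z; exact: nbhs_right_gt.
  by rewrite leNgt az /= ifT//; near: z; exact: nbhs_right_lt.
Unshelve. all: by end_near. Qed.

Lemma antiderivative f (a : R) : continuous f ->
  exists F : R -> R, forall x, a < x -> is_derive x 1 F (f x).
Proof.
move=> fc.
exists (fun x => \int[@lebesgue_measure R]_(t in `[a, x]) f t)%R => x ax.
have xu : x < x + 1 by rewrite ltrDl.
have fi : (@lebesgue_measure R).-integrable `[a, x + 1] (EFin \o f).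
  apply: continuous_compact_integrable; first exact: segment_compact.
  exact: continuous_subspaceT.
have [H1 H2] := continuous_FTC1_closed xu fi ax (fc x).
by apply: DeriveDef; [exact: H1|rewrite -derive1E; exact: H2].
Qed.
End Glue.

(** * Existence for scalar differential equations *)

Section Euler.
Variable R : realType.
Implicit Types (f : R -> R -> R).

(** An ultrafilter finer than the filter of cofinite sets picks a limit at all
    points at once, which spares the extraction of subsequences. *)
Lemma ultra_cvg_bounded (v : nat -> R -> R) (l u : R) :
  (forall k x, l <= v k x <= u) ->
  exists2 F : set_system nat, ProperFilter F /\ (\oo `<=` F) &
  exists w : R -> R, forall x, v k x @[k --> F] --> w x.
Proof.
move=> vb.
have [F [FU ooF]] := @ultraFilterLemma nat (\oo : set_system nat) _.
have FP : ProperFilter F by exact: ultra_proper.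
exists F => //.
suff H : forall x, exists y : R, v k x @[k --> F] --> y.
  by have [w wE] := choice H; exists w.
move=> x.
have [|y [_ yF]] := @segment_compact R l u (v k x @[k --> F]) _.
  by apply: (@filterE _ F) => k /=; rewrite in_itv /= vb.
exists y => A Ay.
have [//|FA] := in_ultra_setVsetC (v ^~ x @^-1` A) FU.
by have [z []] := yF (~` A) A FA Ay.
Qed.

(** Approximate solutions are measured by their quadratic Taylor remainder.  This
    estimate involves two points at a time, hence passes to pointwise limits;
    an eventually constant value, such as the initial one, also does. *)
Lemma solution_limit f (v : nat -> R -> R) (l u : R) :
  (forall k x, l <= v k x <= u) ->
  exists w : R -> R, [/\ forall x, l <= w x <= u,
    forall x c : R, (\forall k \near \oo, v k x = c) -> w x = c &
    forall x x' K L : R,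
     (forall y y' : R, l <= y <= u -> l <= y' <= u ->
        `|f x y - f x y'| <= L * `|y - y'|) ->
     (forall e : R, 0 < e -> \forall k \near \oo,
        `|v k x' - v k x - (x' - x) * f x (v k x)| <= K + e) ->
     `|w x' - w x - (x' - x) * f x (w x)| <= K].
Proof.
move=> vb; have [F [FP ooF] [w wE]] := ultra_cvg_bounded vb.
have wb x : l <= w x <= u.
  apply/andP; split.
    by apply: (cvgr_to_ge (wE x)); apply: (@filterE _ F) => k; have /andP[] := vb k x.
  by apply: (cvgr_to_le (wE x)); apply: (@filterE _ F) => k; have /andP[] := vb k x.
exists w; split.
- exact: wb.
- move=> x c vc; have cF : v k x @[k --> F] --> c by apply: cvg_near_cst; exact: ooF.
  apply/eqP; rewrite eq_le (cvgr_to_le (wE x)) ?(cvgr_to_ge (wE x))//.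
  - by apply: ooF; apply: filterS vc => k ->.
  - by apply: ooF; apply: filterS vc => k ->.
- move=> x x' K L fL He.
  have fc : f x (v k x) @[k --> F] --> f x (w x).
    apply/cvgrPdist_le => e e0.
    have L0 : 0 < `|L| + 1 by rewrite ltr_wpDl.
    move/cvgrPdist_le : (wE x) => /(_ (e / (`|L| + 1)) (divr_gt0 e0 L0)).
    apply: filterS => k /= ke.
    apply: (le_trans (fL _ _ (wb x) (vb k x))).
    have : L * `|w x - v k x| <= (`|L| + 1) * `|w x - v k x|.
      by apply: ler_wpM2r => //; rewrite (le_trans (ler_norm L))// lerDl.
    move=> /le_trans; apply.
    by rewrite mulrC -ler_pdivlMr.
  apply/ler_addgt0Pr => e e0.
  have : `|v k x' - v k x - (x' - x) * f x (v k x)| @[k --> F] -->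
         `|w x' - w x - (x' - x) * f x (w x)|.
    apply: cvg_norm; apply: cvgB; first by apply: cvgB.
    by apply: cvgMl_tmp.
  move/cvgr_to_le; apply; apply: ooF; exact: He.
Qed.

Fixpoint euler f (a h y0 : R) k : R :=
  if k is k'.+1 then let e := euler f a h y0 k' in e + h * f (a + k'%:R * h) e
  else y0.

Section Step.
Variables (f : R -> R -> R) (a b l u L y0 : R).
Hypothesis L0 : 0 <= L.
Hypothesis y0b : l <= y0 <= u.
Hypothesis fL : forall x x' y y' : R, a <= x <= b -> a <= x' <= b ->
  l <= y <= u -> l <= y' <= u ->
  `|f x y - f x' y'| <= L * (`|x - x'| + `|y - y'|).
Hypothesis fl : forall x : R, a <= x <= b -> 0 <= f x l.
Hypothesis fu : forall x : R, a <= x <= b -> f x u <= 0.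

Let B := L * (u - l).
Let lu : l <= u. Proof. by move: y0b => /andP[/le_trans]; apply. Qed.

(** As [f] changes sign between the barriers, its Lipschitz constant bounds it. *)
Lemma slope_bound (x y : R) : a <= x <= b -> l <= y <= u -> `|f x y| <= B.
Proof.
move=> xab /andP[ly yu].
have l_ : l <= l <= u by rewrite lexx lu.
have u_ : l <= u <= u by rewrite lexx lu.
have y_ : l <= y <= u by rewrite ly yu.
have := fL xab xab y_ l_; have := fL xab xab y_ u_.
rewrite subrr normr0 !add0r [`|y - u|]distrC.
rewrite (@ger0_norm _ (y - l)) ?subr_ge0// (@ger0_norm _ (u - y)) ?subr_ge0//.
have := fl xab; have := fu xab; rewrite /B !ler_norml.
have : 0 <= L * (u - y) by rewrite mulr_ge0 ?subr_ge0.
have : 0 <= L * (y - l) by rewrite mulr_ge0 ?subr_ge0.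
by move=> ? ? ? ? /andP[? ?] /andP[? ?]; apply/andP; split; lra.
Qed.

Variables (h : R) (N : nat).
Hypothesis h0 : 0 <= h.
Hypothesis hL : h * L <= 1.
Hypothesis hN : a + N%:R * h <= b.

Let e := euler f a h y0.
Let x_ (k : nat) := a + k%:R * h.

Lemma grid_in k : (k <= N)%N -> a <= x_ k <= b.
Proof.
move=> kN; rewrite /x_ lerDl mulr_ge0//=.
by apply: le_trans hN; rewrite lerD2l ler_wpM2r// ler_nat.
Qed.

(** The barrier conditions alone keep the polygon inside the strip: one step
    moves it towards [l] by at most [h L] times its distance to [l]. *)
Lemma euler_in k : (k <= N)%N -> l <= e k <= u.
Proof.
elim: k => [//|k IH] kN.
have /andP[lk ku] := IH (ltnW kN).
have xk := grid_in (ltnW kN).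
have l_ : l <= l <= u by rewrite lexx lu.
have u_ : l <= u <= u by rewrite lexx lu.
have y_ : l <= e k <= u by rewrite lk ku.
have := fL xk xk y_ l_; have := fL xk xk y_ u_.
rewrite subrr normr0 !add0r [`|e k - u|]distrC.
rewrite (@ger0_norm _ (e k - l)) ?subr_ge0// (@ger0_norm _ (u - e k)) ?subr_ge0//.
have := fl xk; have := fu xk; rewrite !ler_norml /= -/e -/(x_ k) => H1 H2 /andP[H3 H3'] /andP[H4 H4'].
have := ler_wpM2r (_ : 0 <= u - e k) hL; rewrite subr_ge0 => /(_ ku).
have := ler_wpM2r (_ : 0 <= e k - l) hL; rewrite subr_ge0 => /(_ lk).
have : h * f (x_ k) (e k) <= h * (L * (u - e k)) by apply: ler_wpM2l => //; lra.
have : - (h * (L * (e k - l))) <= h * f (x_ k) (e k).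
  by rewrite -mulrN; apply: ler_wpM2l => //; lra.
have -> : e k.+1 = e k + h * f (x_ k) (e k) by [].
by rewrite !mulrA => ? ? ? ?; apply/andP; split; lra.
Qed.

Lemma euler_lip i j : (i + j <= N)%N -> `|e (i + j)%N - e i| <= B * (j%:R * h).
Proof.
elim: j => [|j IH] ijN; first by rewrite addn0 subrr normr0 mul0r mulr0.
rewrite addnS in ijN *.
have -> : e (i + j).+1 = e (i + j)%N + h * f (x_ (i + j)) (e (i + j)%N) by [].
have ij : (i + j <= N)%N by exact: ltnW.
have := slope_bound (grid_in ij) (euler_in ij) => Hs.
have -> : e (i + j)%N + h * f (x_ (i + j)) (e (i + j)%N) - e i =
  (e (i + j)%N - e i) + h * f (x_ (i + j)) (e (i + j)%N) by ring.
apply: (le_trans (ler_normD _ _)).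
rewrite -natr1 mulrDl mul1r mulrDr; apply: lerD; first exact: IH.
by rewrite normrM (ger0_norm h0) mulrC ler_wpM2r.
Qed.

Let B0 : 0 <= B. Proof. by rewrite mulr_ge0// subr_ge0. Qed.

Lemma euler_taylor i j : (i + j <= N)%N ->
  `|e (i + j)%N - e i - (j%:R * h) * f (x_ i) (e i)|
    <= L * (1 + B) * (j%:R * h) ^+ 2.
Proof.
elim: j => [|j IH] ijN.
  by rewrite addn0 subrr sub0r normrN !mul0r expr0n mulr0 normr0.
rewrite addnS in ijN *.
have -> : e (i + j).+1 = e (i + j)%N + h * f (x_ (i + j)) (e (i + j)%N) by [].
have ij : (i + j <= N)%N by exact: ltnW.
have iN : (i <= N)%N by apply: leq_trans ij; exact: leq_addr.
set F1 := f (x_ (i + j)) _; set F0 := f (x_ i) _.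
have -> : e (i + j)%N + h * F1 - e i - j.+1%:R * h * F0 =
  (e (i + j)%N - e i - (j%:R * h) * F0) + h * (F1 - F0).
  by rewrite -natr1; ring.
apply: (le_trans (ler_normD _ _)).
have FF : `|F1 - F0| <= L * (1 + B) * (j%:R * h).
  apply: (le_trans (fL (grid_in ij) (grid_in iN) (euler_in ij) (euler_in iN))).
  rewrite -mulrA; apply: ler_wpM2l => //.
  rewrite mulrDl mul1r; apply: lerD; last exact: euler_lip.
  rewrite /x_ natrD.
  have -> : a + (i%:R + j%:R) * h - (a + i%:R * h) = j%:R * h by ring.
  by rewrite ger0_norm// mulr_ge0.
rewrite normrM (ger0_norm h0).
apply: (@le_trans _ _ (L * (1 + B) * (j%:R * h) ^+ 2 + h * (L * (1 + B) * (j%:R * h)))).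
  by apply: lerD; [exact: IH | exact: ler_wpM2l].
have A0 : 0 <= L * (1 + B) by rewrite mulr_ge0// addr_ge0.
have -> : L * (1 + B) * (j%:R * h) ^+ 2 + h * (L * (1 + B) * (j%:R * h)) =
   L * (1 + B) * ((j%:R * h) ^+ 2 + h * (j%:R * h)) by ring.
apply: ler_wpM2l => //; rewrite -natr1.
have : 0 <= j%:R * h * h by rewrite !mulr_ge0.
have : 0 <= h * h by rewrite mulr_ge0.
nra.
Qed.

Lemma euler_taylor2 i j : (i <= N)%N -> (j <= N)%N ->
  `|e j - e i - (x_ j - x_ i) * f (x_ i) (e i)|
    <= (2 * (L * (1 + B))) * (x_ j - x_ i) ^+ 2.
Proof.
have A0 : 0 <= L * (1 + B) by rewrite mulr_ge0// addr_ge0.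
move=> iN jN; have [ij|/ltnW ji] := leqP i j.
  rewrite -(subnKC ij) in jN *; have := euler_taylor jN.
  rewrite /x_ natrD.
  have -> : a + (i%:R + (j - i)%:R) * h - (a + i%:R * h) = (j - i)%:R * h by ring.
  move=> /le_trans; apply; apply: ler_wpM2r; [exact: sqr_ge0|lra].
rewrite -(subnKC ji) in iN *; set k := (i - j)%N in iN *.
have H1 := euler_taylor iN.
have H2 := euler_lip iN.
have := fL (grid_in iN) (grid_in jN) (euler_in iN) (euler_in jN).
rewrite /x_ natrD.
have -> : a + (j%:R + k%:R) * h - (a + j%:R * h) = k%:R * h by ring.
have -> : a + j%:R * h - (a + (j%:R + k%:R) * h) = - (k%:R * h) by ring.
rewrite -/(x_ j) sqrrN.
have -> : a + (j%:R + k%:R) * h = x_ (j + k) by rewrite /x_ natrD.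
set F1 := f (x_ (j + k)) _; set F0 := f (x_ j) _ in H1 *.
have kh : 0 <= k%:R * h by rewrite mulr_ge0.
rewrite (ger0_norm kh) => FF.
have -> : e j - e (j + k)%N - - (k%:R * h) * F1 =
  - (e (j + k)%N - e j - k%:R * h * F0) + k%:R * h * (F1 - F0) by ring.
apply: (le_trans (ler_normD _ _)).
rewrite normrN [`|_ * (F1 - _)|]normrM (ger0_norm kh).
have : k%:R * h * `|F1 - F0| <= k%:R * h * (L * (1 + B) * (k%:R * h)).
  apply: ler_wpM2l => //; apply: (le_trans FF).
  by rewrite -mulrA; apply: ler_wpM2l => //; lra.
move: H1; lra.
Qed.
End Step.

(** The solution property as a uniform Taylor estimate: it makes sense at the ends
    of the interval, and gives the derivative at interior points. *)
Definition solves_on f (K a b : R) (w : R -> R) :=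
  forall x x' : R, a <= x <= b -> a <= x' <= b ->
  `|w x' - w x - (x' - x) * f x (w x)| <= K * (x' - x) ^+ 2.

(** Constant barriers [l] and [u], on which the slope points inwards, keep Euler
    polygons of small step in the strip, and the limit of the polygons is a
    solution. *)
Lemma ode_segment f (a b l u L y0 : R) : a < b -> 0 <= L -> l <= y0 <= u ->
  (forall x x' y y' : R, a <= x <= b -> a <= x' <= b ->
  l <= y <= u -> l <= y' <= u ->
  `|f x y - f x' y'| <= L * (`|x - x'| + `|y - y'|)) ->
  (forall x : R, a <= x <= b -> 0 <= f x l) ->
  (forall x : R, a <= x <= b -> f x u <= 0) ->
  exists w : R -> R, [/\ forall x, l <= w x <= u, w a = y0 &
    solves_on f (2 * (L * (1 + L * (u - l)))) a b w].
Proof.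
move=> ab L0 y0b fL fl fu.
set K := 2 * _.
have lu : l <= u by move: y0b => /andP[/le_trans]; apply.
have B0 : 0 <= L * (u - l) by rewrite mulr_ge0// subr_ge0.
have K0 : 0 <= K by rewrite mulr_ge0// mulr_ge0// addr_ge0.
pose h k : R := (b - a) / k.+1%:R.
have h0 k : 0 < h k by rewrite divr_gt0// subr_gt0.
pose idx k x := Num.truncn ((x - a) / h k).
have hk k : k.+1%:R * h k = b - a by rewrite /h mulrC divfK.
have idxN k x : a <= x <= b -> (idx k x <= k.+1)%N.
  move=> /andP[ax xb]; rewrite /idx truncn_le_nat ltr_pdivrMr// -natr1 mulrDl hk mul1r.
  by move: (h0 k); lra.
have idxx k x : a <= x <= b ->
    a + (idx k x)%:R * h k <= x < a + (idx k x)%:R * h k + h k.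
  move=> /andP[ax xb]; have := @truncn_itv _ ((x - a) / h k).
  rewrite divr_ge0 ?subr_ge0// ?(ltW (h0 k))// => /(_ erefl).
  rewrite -/(idx k x) ler_pdivlMr// ltr_pdivrMr// -natr1 mulrDl mul1r.
  by move=> /andP[? ?]; apply/andP; split; lra.
(* the polygons stay in the strip once h k * L <= 1; the others are replaced by
   a constant *)
pose good k x := (h k * L <= 1) && (a <= x <= b).
pose v k x := if good k x then euler f a (h k) y0 (idx k x) else y0.
have hN k : a + k.+1%:R * h k <= b by rewrite hk; lra.
have vb k x : l <= v k x <= u.
  rewrite /v /good; case: ifP => // /andP[hL xab].
  exact: (euler_in y0b fL fl fu (ltW (h0 k)) hL (hN k) (idxN k x xab)).
have hsmall (e : R) : 0 < e -> \forall k \near \oo, h k <= e.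
  move=> e0; have ba0 : 0 < b - a by rewrite subr_gt0.
  have := @near_infty_natSinv_lt R (PosNum (divr_gt0 e0 ba0)); apply: filterS => k /= H.
  by rewrite /h mulrC -ler_pdivlMr ?subr_gt0// ltW.
have hL : \forall k \near \oo, h k * L <= 1.
  have L1 : 0 < L + 1 by lra.
  apply: filterS (hsmall (L + 1)^-1 _); last by rewrite invr_gt0.
  move=> k hk1; apply: (@le_trans _ _ (h k * (L + 1))).
    by rewrite ler_wpM2l ?(ltW (h0 k))//; lra.
  by rewrite -ler_pdivlMr// mul1r.
have [w [wb wa wE]] := solution_limit f vb.
exists w; split => //.
  apply: wa; apply: filterS hL => k hLk; rewrite /v /good hLk lexx (ltW ab)/=.
  by rewrite /idx subrr mul0r truncn0.
move=> x x' xab xab'.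
apply: (wE _ _ _ L) => [y y' yb yb'|e e0].
  by have := fL _ _ _ _ xab xab yb yb'; rewrite subrr normr0 add0r.
set D := `|x' - x|.
have D0 : 0 <= D by exact: normr_ge0.
pose M := 2 * K * D + K * (b - a) + L * D + L * (b - a) + L * (u - l).
have ba0 : 0 <= b - a by rewrite subr_ge0 ltW.
have M0 : 0 <= M by rewrite /M; do !apply: addr_ge0 => //; do ?apply: mulr_ge0 => //; apply: mulr_ge0.
have M1 : 0 < M + 1 by lra.
have := hsmall (e / (M + 1)) (divr_gt0 e0 M1).
move: hL; apply: filterS2 => k hLk hke.
have -> : v k x = euler f a (h k) y0 (idx k x) by rewrite /v /good hLk xab.
have -> : v k x' = euler f a (h k) y0 (idx k x') by rewrite /v /good hLk xab'.
set i := idx k x; set j := idx k x'.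
have T2 := euler_taylor2 L0 y0b fL fl fu (ltW (h0 k)) hLk (hN k) (idxN k x xab) (idxN k x' xab').
rewrite -/i -/j -/K in T2.
have ib := euler_in y0b fL fl fu (ltW (h0 k)) hLk (hN k) (idxN k x xab).
have gi := grid_in (ltW (h0 k)) (hN k) (idxN k x xab).
rewrite -/i in ib gi.
set X := a + i%:R * h k in T2 gi; set X' := a + j%:R * h k in T2.
have /andP[iX Xi] := idxx k x xab; rewrite -/i -/X in iX Xi.
have /andP[jX Xj] := idxx k x' xab'; rewrite -/j -/X' in jX Xj.
set ei := euler _ _ _ _ i in ib T2 *; set ej := euler _ _ _ _ j in T2 *.
have -> : ej - ei - (x' - x) * f x ei = (ej - ei - (X' - X) * f X ei)
  + (X' - X) * (f X ei - f x ei) + ((X' - X) - (x' - x)) * f x ei by ring.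
have hb : h k <= b - a.
  by rewrite /h ler_pdivrMr// ler_peMr ?subr_ge0 ?(ltW ab)// -(@natr1 _ k); have := ler0n R k; lra.
have XD : `|X' - X| <= D + h k.
  have -> : X' - X = (x' - x) + ((X' - X) - (x' - x)) by ring.
  apply: (le_trans (ler_normD _ _)); rewrite lerD2l ler_norml.
  by clear -iX Xi jX Xj; apply/andP; split; lra.
have Xh : `|(X' - X) - (x' - x)| <= h k.
  by clear -iX Xi jX Xj; rewrite ler_norml; apply/andP; split; lra.
have H1 : `|(X' - X) * (f X ei - f x ei)| <= (D + h k) * (L * h k).
  rewrite normrM; apply: ler_pM => //.
  have := fL _ _ _ _ gi xab ib ib; rewrite subrr normr0 addr0 => /le_trans; apply.
  by rewrite ler_wpM2l// ler_norml; clear -iX Xi; apply/andP; split; lra.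
have H2 : `|((X' - X) - (x' - x)) * f x ei| <= h k * (L * (u - l)).
  rewrite normrM; apply: ler_pM => //.
  exact: (slope_bound L0 y0b fL fl fu xab ib).
have H3 : K * (X' - X) ^+ 2 <= K * (D + h k) ^+ 2.
  apply: ler_wpM2l => //; rewrite -(real_normK (num_real (X' - X))).
  by rewrite ler_sqr ?nnegrE// addr_ge0// ltW.
have H4 : (x' - x) ^+ 2 = D ^+ 2 by rewrite /D real_normK ?num_real.
rewrite H4.
apply: (@le_trans _ _ (K * (D + h k) ^+ 2 + (D + h k) * (L * h k) + h k * (L * (u - l)))).
  apply: (le_trans (ler_normD _ _)); apply: lerD => //.
  apply: (le_trans (ler_normD _ _)); apply: lerD => //.
  exact: le_trans H3.
apply: (@le_trans _ _ (K * D ^+ 2 + h k * M)).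
  rewrite /M.
  have : K * h k * h k <= K * h k * (b - a) by rewrite ler_wpM2l// mulr_ge0// ltW.
  have : L * h k * h k <= L * h k * (b - a) by rewrite ler_wpM2l// mulr_ge0// ltW.
  lra.
rewrite lerD2l; apply: (@le_trans _ _ (h k * (M + 1))).
  by rewrite ler_wpM2l ?(ltW (h0 k))//; lra.
by rewrite -ler_pdivlMr.
Qed.

End Euler.

Section Exhaustion.
Variable R : realType.
Implicit Types (f : R -> R -> R).

Lemma lipschitz_within (g : R -> R) (M a b : R) :
  (forall x x' : R, a <= x <= b -> a <= x' <= b -> `|g x' - g x| <= M * `|x' - x|) ->
  {within `[a, b], continuous g}.
Proof.
move=> gM; apply/subspace_continuousP => x; rewrite /= in_itv /= => xab.
apply/cvgrPdist_le => e e0.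
have M0 : 0 < `|M| + 1 by rewrite ltr_wpDl.
rewrite near_withinE.
move/cvgrPdist_le : (@cvg_id _ (nbhs x)) => /(_ (e / (`|M| + 1)) (divr_gt0 e0 M0)).
apply: filterS => z /= xz; rewrite in_itv /= => zab; apply: (le_trans (gM _ _ zab xab)).
apply: (@le_trans _ _ ((`|M| + 1) * `|x - z|)).
  by apply: ler_wpM2r => //; have := ler_norm M; lra.
by rewrite mulrC -ler_pdivlMr.
Qed.

Lemma is_derive_quadratic (w : R -> R) (K a b c x : R) : a < x < b ->
  (forall x', a <= x' <= b -> `|w x' - w x - (x' - x) * c| <= K * (x' - x) ^+ 2) ->
  is_derive x (1 : R) w c.
Proof.
move=> /andP[ax xb] wK.
have H : h^-1 *: ((w \o shift x) (h *: (1 : R)) - w x) @[h --> 0^'] --> c.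
  apply/cvgrPdist_le => e e0.
  have K0 : 0 < `|K| + 1 by rewrite ltr_wpDl.
  pose d := Num.min (Num.min (x - a) (b - x)) (e / (`|K| + 1)).
  have d0 : 0 < d by rewrite /d !lt_min !subr_gt0 ax xb divr_gt0.
  have : \forall h \near (0 : R)^', h != 0 /\ `|h| < d.
    near=> h; split; first by near: h; exact: nbhs_dnbhs_neq.
    near: h; apply: dnbhs0_lt => //.
  apply: filterS => h [hn0 hd].
  rewrite /= /GRing.scale /= mulr1.
  move: hd; rewrite /d !lt_min => /andP[/andP[h1 h2] h3].
  have hb : a <= h + x <= b.
    by move: h1 h2; rewrite !ltr_norml => /andP[? ?] /andP[? ?]; apply/andP; split; lra.
  have := wK _ hb; rewrite addrK => Hw.
  have -> : c - h^-1 * (w (h + x) - w x) = - h^-1 * (w (h + x) - w x - h * c).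
    by field.
  rewrite normrM normrN normfV ler_pdivrMl ?normr_gt0//.
  apply: (le_trans Hw); rewrite -(real_normK (num_real h)) expr2.
  apply: (@le_trans _ _ ((`|K| + 1) * (`|h| * `|h|))).
    by apply: ler_wpM2r; [rewrite mulr_ge0|have := ler_norm K; lra].
  by rewrite mulrCA; apply: ler_wpM2l => //; rewrite mulrC -ler_pdivlMr// ltW.
apply: DeriveDef; first by apply/cvg_ex; exists c.
exact: cvg_lim.
Unshelve. all: by end_near. Qed.

Lemma solves_on_lipschitz f (K B a b : R) (w : R -> R) : 0 <= K ->
  (forall x, a <= x <= b -> `|f x (w x)| <= B) -> solves_on f K a b w ->
  forall x x' : R, a <= x <= b -> a <= x' <= b ->
    `|w x' - w x| <= (B + K * (b - a)) * `|x' - x|.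
Proof.
move=> K0 fB wK x x' xab xab'.
have -> : w x' - w x = (w x' - w x - (x' - x) * f x (w x)) + (x' - x) * f x (w x).
  by ring.
apply: (le_trans (ler_normD _ _)); rewrite [X in _ <= X]mulrDl [X in _ <= X]addrC; apply: lerD.
  apply: (le_trans (wK _ _ xab xab')).
  rewrite -(real_normK (num_real _)) expr2 mulrA; apply: ler_wpM2r => //.
  apply: ler_wpM2l => //; rewrite ler_norml.
  by move: xab xab' => /andP[? ?] /andP[? ?]; apply/andP; split; lra.
by rewrite normrM mulrC; apply: ler_wpM2r => //; exact: fB.
Qed.

(** The remainder on the smaller interval is controlled by the Lipschitz constant
    on that interval; this makes the estimates uniform along an exhaustion. *)
Lemma solves_on_sub f (K L l u a b c d : R) (w : R -> R) :
  a <= c -> d <= b -> 0 <= K -> 0 <= L -> (forall x, l <= w x <= u) ->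
  (exists B, forall x, a <= x <= b -> `|f x (w x)| <= B) ->
  (forall x x' y y' : R, c <= x <= d -> c <= x' <= d ->
    l <= y <= u -> l <= y' <= u ->
    `|f x y - f x' y'| <= L * (`|x - x'| + `|y - y'|)) ->
  (forall x : R, c <= x <= d -> 0 <= f x l) ->
  (forall x : R, c <= x <= d -> f x u <= 0) ->
  solves_on f K a b w -> solves_on f (L * (1 + L * (u - l))) c d w.
Proof.
move=> ac db K0 L0 wb fB fL fl fu wK x x' xcd xcd'.
have sub z : c <= z <= d -> a <= z <= b.
  by move=> /andP[? ?]; apply/andP; split; lra.
have [B0 wB0] := fB.
have lip := solves_on_lipschitz K0 wB0 wK.
have wB z : c <= z <= d -> `|f z (w z)| <= L * (u - l).
  by move=> zcd; apply: (slope_bound L0 (wb z) fL fl fu zcd (wb z)).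
set B := L * (u - l) in wB *.
have Bge : 0 <= B by exact: le_trans (wB _ xcd).
(* the slope bound turns into an increment bound through the mean value theorem *)
have mvt (p q s : R) : c <= p -> p < q -> q <= d ->
   exists2 z, p <= z <= q & w q - w p - (q - p) * s = (f z (w z) - s) * (q - p).
  move=> cp pq qd.
  have [z|| z zpq E] := @MVT R (fun t => w t - t * s) (fun z => f z (w z) - s) p q pq.
  - rewrite in_itv /= => /andP[pz zq].
    apply: is_deriveB.
      apply: (@is_derive_quadratic w K a b); first by apply/andP; split; lra.
      by move=> z' zab'; apply: wK => //; apply/andP; split; lra.
    have := @is_deriveM _ _ (@id R) (cst s) z 1 1 0.
    by rewrite scaler0 add0r /GRing.scale /= mulr1; apply; exact: is_derive_cst.
  - apply: (@lipschitz_within _ (B0 + K * (b - a) + `|s|)) => t t' /andP[? ?] /andP[? ?].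
    have -> : w t' - t' * s - (w t - t * s) = (w t' - w t) - (t' - t) * s by ring.
    apply: (le_trans (ler_normB _ _)); rewrite [X in _ <= X]mulrDl; apply: lerD.
      by apply: lip; apply/andP; split; lra.
    by rewrite normrM mulrC.
  exists z; first by move: zpq; rewrite in_itv /= => /andP[? ?]; rewrite !ltW.
  by rewrite -E; ring.
have lipB (p q : R) : c <= p -> p < q -> q <= d -> `|w q - w p| <= B * (q - p).
  move=> cp pq qd; have [z /andP[pz zq]] := mvt p q 0 cp pq qd.
  have qp0 : 0 <= q - p by rewrite subr_ge0 ltW.
  rewrite mulr0 !subr0 => ->; rewrite normrM (ger0_norm qp0).
  by apply: ler_wpM2r => //; apply: wB; apply/andP; split; lra.
have lipB' (p q : R) : c <= p <= d -> c <= q <= d -> `|w q - w p| <= B * `|q - p|.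
  move=> /andP[cp pd] /andP[cq qd]; have [pq|qp|->] := ltgtP p q; last first.
  - by rewrite !subrr normr0 mulr0.
  - by rewrite distrC [`|q - p|]distrC [X in _ * X]ger0_norm ?subr_ge0 ?(ltW qp)//; exact: lipB.
  - by rewrite [X in _ * X]ger0_norm ?subr_ge0 ?(ltW pq)//; exact: lipB.
have fin z D : c <= z <= d -> `|z - x| <= D ->
   `|f z (w z) - f x (w x)| <= L * (1 + B) * D.
  move=> zcd zD; apply: (le_trans (fL _ _ _ _ zcd xcd (wb z) (wb x))).
  rewrite -mulrA; apply: ler_wpM2l => //.
  apply: (@le_trans _ _ (`|z - x| + B * `|z - x|)); first by rewrite lerD2l lipB'.
  by rewrite mulrDl mul1r lerD// ler_wpM2l.
move: (xcd) (xcd') => /andP[cx xd] /andP[cx' xd'].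
rewrite -(real_normK (num_real (x' - x))) expr2 mulrA.
have [xx|xx|->] := ltgtP x x'; last first.
- by rewrite !subrr mul0r subrr normr0 mulr0.
- have [z /andP[z1 z2] E] := mvt x' x (f x (w x)) cx' xx xd.
  have -> : w x' - w x - (x' - x) * f x (w x) = - (w x - w x' - (x - x') * f x (w x)) by ring.
  rewrite E normrN normrM [`|x - x'|]distrC; apply: ler_wpM2r => //.
  apply: fin; first by apply/andP; split; lra.
  by rewrite !ler0_norm ?subr_le0 ?(ltW xx)//; lra.
- have [z /andP[z1 z2] E] := mvt x x' (f x (w x)) cx xx xd'.
  rewrite E normrM; apply: ler_wpM2r => //.
  apply: fin; first by apply/andP; split; lra.
  by rewrite !ger0_norm ?subr_ge0 ?(ltW xx)//; lra.
Qed.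

(** The limit of solutions on the segments of an exhaustion: on each segment the
    later ones satisfy a common estimate, by the preceding lemma. *)
Lemma ode_exhaust f (A B L : nat -> R) (l u y0 : R) :
  l <= y0 <= u -> (forall k, A k < B k) -> (forall k, 0 <= L k) ->
  (forall i j, (i <= j)%N -> A j <= A i /\ B i <= B j) ->
  (forall k (x x' y y' : R), A k <= x <= B k -> A k <= x' <= B k ->
    l <= y <= u -> l <= y' <= u ->
    `|f x y - f x' y'| <= L k * (`|x - x'| + `|y - y'|)) ->
  (forall k (x : R), A k <= x <= B k -> 0 <= f x l) ->
  (forall k (x : R), A k <= x <= B k -> f x u <= 0) ->
  exists w : R -> R, [/\ forall x, l <= w x <= u,
    forall a, (forall k, A k = a) -> w a = y0 &
    forall k, exists K, solves_on f K (A k) (B k) w].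
Proof.
move=> y0b AB L0 mono fL fl fu.
have H k := ode_segment (AB k) (L0 k) y0b (fL k) (fl k) (fu k).
have [v vP] := choice H.
have vb k x : l <= v k x <= u by have [] := vP k.
have [w [wb wa wE]] := solution_limit f vb.
exists w; split => // [a Aa|k].
  by apply: wa; apply: nearW => k; rewrite -(Aa k); have [] := vP k.
have lu : l <= u by move: y0b => /andP[/le_trans]; apply.
pose K := fun k => L k * (1 + L k * (u - l)).
exists (K k) => x x' xk xk'.
apply: (wE _ _ _ (L k)) => [y y' yb yb'|e e0].
  by have := fL k _ _ _ _ xk xk yb yb'; rewrite subrr normr0 add0r.
suff HH : forall j, (k <= j)%N ->
  `|v j x' - v j x - (x' - x) * f x (v j x)| <= K k * (x' - x) ^+ 2.
  by near=> j; apply: (le_trans (HH _ _)); [near: j; exact: nbhs_infty_ge|lra].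
move=> j kj; have [Ajk Bkj] := mono _ _ kj.
have [_ _ vs] := vP j.
apply: (solves_on_sub Ajk Bkj _ (L0 k) (vb j) _ (fL k) (fl k) (fu k) vs) => //.
  by rewrite mulr_ge0// mulr_ge0// addr_ge0// mulr_ge0// subr_ge0.
exists (L j * (u - l)) => z zj.
exact: (slope_bound (L0 j) (vb j z) (fL j) (fl j) (fu j) zj (vb j z)).
Unshelve. all: by end_near. Qed.

End Exhaustion.

Section OdeOpen.
Variable R : realType.
Implicit Types (f : R -> R -> R).

Definition lipschitz_strip f (L a b l u : R) :=
  forall x x' y y' : R, a <= x <= b -> a <= x' <= b ->
    l <= y <= u -> l <= y' <= u ->
    `|f x y - f x' y'| <= L * (`|x - x'| + `|y - y'|).

Lemma exists_lt_natdiv (c r : R) : 0 < r -> exists k, c / k.+2%:R < r.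
Proof.
move=> r0; pose k := Num.truncn (`|c| / r).
exists k; rewrite ltr_pdivrMr//.
have := truncnS_gt (`|c| / r); rewrite -/k ltr_pdivrMr// => H.
apply: (le_lt_trans (ler_norm c)); apply: (lt_le_trans H).
by rewrite mulrC ler_wpM2l ?(ltW r0)// ler_nat.
Qed.

Lemma le_natdiv (c : R) i j : 0 <= c -> (i <= j)%N -> c / j.+2%:R <= c / i.+2%:R.
Proof.
by move=> c0 ij; rewrite ler_wpM2l// lef_pV2 ?posrE// ler_nat.
Qed.

Lemma natdiv_bounds (c : R) k : 0 < c -> 0 < c / k.+2%:R /\ 2 * (c / k.+2%:R) <= c.
Proof.
move=> c0; split; first by rewrite divr_gt0.
rewrite mulrCA ler_piMr ?(ltW c0)// ler_pdivrMr// mul1r.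
by rewrite -[2]/(2%:R) ler_nat.
Qed.

(** The Lipschitz constants may blow up at the ends of the interval: this is how
    the singular slope field of the phase plane is handled.  No initial value
    is prescribed. *)
Lemma ode_open f (a b l u : R) : a < b -> l <= u ->
  (forall c d, a < c -> c < d -> d < b -> exists2 L, 0 <= L & lipschitz_strip f L c d l u) ->
  (forall x, a < x < b -> 0 <= f x l) ->
  (forall x, a < x < b -> f x u <= 0) ->
  exists w : R -> R, (forall x, l <= w x <= u) /\
    forall x, a < x < b -> is_derive x 1 w (f x (w x)).
Proof.
move=> ab lu fL fl fu.
have ba0 : 0 < b - a by rewrite subr_gt0.
pose r k : R := (b - a) / 2 / k.+2%:R.
have r0 k : 0 < r k /\ 2 * r k <= (b - a) / 2 by apply: natdiv_bounds; rewrite divr_gt0.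
pose A k := a + r k; pose B k := b - r k.
have in_ab k x : A k <= x <= B k -> a < x < b.
  by rewrite /A /B => /andP[? ?]; have [? ?] := r0 k; apply/andP; split; lra.
have AB k : A k < B k by rewrite /A /B; have [? ?] := r0 k; lra.
have HL k : exists L, 0 <= L /\ lipschitz_strip f L (A k) (B k) l u.
  have [? ?] := r0 k; have [|||L L0 HL] := fL (A k) (B k); rewrite ?AB// /A /B; try lra.
  by exists L.
have [L LP] := choice HL.
have ulu : l <= u <= u by rewrite lu lexx.
have [|i j ij||||w [wb _ wS]] := @ode_exhaust R f A B L l u u ulu AB.
- by move=> k; have [] := LP k.
- have := @le_natdiv ((b - a) / 2) i j _ ij; rewrite divr_ge0 ?(ltW ba0)// => /(_ erefl).
  by rewrite -/(r i) -/(r j) /A /B; lra.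
- by move=> k; have [] := LP k.
- by move=> k x /in_ab; exact: fl.
- by move=> k x /in_ab; exact: fu.
exists w; split => // x /andP[ax xb].
have min0 : 0 < Num.min (x - a) (b - x) by rewrite lt_min !subr_gt0 ax.
have [k] := exists_lt_natdiv ((b - a) / 2) min0.
rewrite -/(r k) lt_min => /andP[h1 h2].
have [K KS] := wS k; have [rk _] := r0 k.
apply: (@is_derive_quadratic _ _ K (A k) (B k)); first by rewrite /A /B; apply/andP; split; lra.
by move=> x' xx'; apply: KS => //; rewrite /A /B; apply/andP; split; lra.
Qed.

(** The same with a singularity at the right end only, so that a value can be
    prescribed at the left end. *)
Lemma ode_half_open f (a b l u y0 : R) : a < b -> l <= y0 <= u ->
  (forall d, a < d -> d < b -> exists2 L, 0 <= L & lipschitz_strip f L a d l u) ->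
  (forall x, a <= x < b -> 0 <= f x l) ->
  (forall x, a <= x < b -> f x u <= 0) ->
  exists w : R -> R, [/\ (forall x, l <= w x <= u), w a = y0,
    forall x, a < x < b -> is_derive x 1 w (f x (w x)) &
    w x @[x --> a^'+] --> y0].
Proof.
move=> ab y0b fL fl fu.
have ba0 : 0 < b - a by rewrite subr_gt0.
pose r k : R := (b - a) / 2 / k.+2%:R.
have r0 k : 0 < r k /\ 2 * r k <= (b - a) / 2 by apply: natdiv_bounds; rewrite divr_gt0.
pose B k := b - r k.
have in_ab k x : a <= x <= B k -> a <= x < b.
  by rewrite /B => /andP[? ?]; have [? ?] := r0 k; apply/andP; split; lra.
have AB k : a < B k by rewrite /B; have [? ?] := r0 k; lra.
have HL k : exists L, 0 <= L /\ lipschitz_strip f L a (B k) l u.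
  have [? ?] := r0 k; have [||L L0 HL] := fL (B k); rewrite ?AB// /B; try lra.
  by exists L.
have [L LP] := choice HL.
have [|i j ij||||w [wb wa wS]] := @ode_exhaust R f (fun=> a) B L l u y0 y0b AB.
- by move=> k; have [] := LP k.
- have := @le_natdiv ((b - a) / 2) i j _ ij; rewrite divr_ge0 ?(ltW ba0)// => /(_ erefl).
  by rewrite -/(r i) -/(r j) /B; lra.
- by move=> k; have [] := LP k.
- by move=> k x /in_ab; exact: fl.
- by move=> k x /in_ab; exact: fu.
have wa0 : w a = y0 by exact: wa.
exists w; split => //.
- move=> x /andP[ax xb].
  have min0 : 0 < b - x by rewrite subr_gt0.
  have [k] := exists_lt_natdiv ((b - a) / 2) min0; rewrite -/(r k) => h1.
  have [K KS] := wS k; have [rk _] := r0 k.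
  apply: (@is_derive_quadratic _ _ K a (B k)); first by rewrite /B; apply/andP; split; lra.
  by move=> x' xx'; apply: KS => //; rewrite /B; apply/andP; split; lra.
- have [K KS] := wS 0%N; have aB := AB 0%N.
  rewrite -wa0; apply/cvgrPdist_le => e e0.
  set c := f a (w a).
  pose M := `|K| * (B 0%N - a) + `|c| + 1.
  have M0 : 0 < M by rewrite /M ltr_wpDl// addr_ge0// mulr_ge0// subr_ge0 ltW.
  near=> x.
  have ax : a < x by near: x; exact: nbhs_right_gt.
  have xB : x <= B 0%N by near: x; exact: nbhs_right_le.
  have xe : x - a <= e / M.
    rewrite lerBlDr addrC; near: x; apply: nbhs_right_le.
    by rewrite ltrDl divr_gt0.
  have := KS a x; rewrite lexx (ltW aB) (ltW ax) xB => /(_ erefl erefl) H.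
  have xa0 : 0 <= x - a by rewrite subr_ge0 ltW.
  have : `|w x - w a| <= (x - a) * M.
    have -> : w x - w a = (w x - w a - (x - a) * c) + (x - a) * c by ring.
    apply: (le_trans (ler_normD _ _)); rewrite [`|(x - a) * c|]normrM (ger0_norm xa0).
    have : K * (x - a) ^+ 2 <= (x - a) * (`|K| * (B 0%N - a)).
      have -> : K * (x - a) ^+ 2 = (x - a) * (K * (x - a)) by ring.
      rewrite ler_wpM2l//; apply: (@le_trans _ _ (`|K| * (x - a))).
        by rewrite ler_wpM2r// ler_norm.
      by rewrite ler_wpM2l// lerD2r.
    by move: H; rewrite -/c /M => H1 H2; lra.
  rewrite distrC => /le_trans; apply.
  by rewrite -ler_pdivlMr.
Unshelve. all: by end_near. Qed.

(** Bounded and Lipschitz on a rectangle: unlike the Lipschitz property alone,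
    this is stable under products. *)
Definition lipb (a b l u : R) f := exists2 M, 0 <= M &
  forall x y, a <= x <= b -> l <= y <= u -> `|f x y| <= M /\
  forall x' y', a <= x' <= b -> l <= y' <= u ->
     `|f x y - f x' y'| <= M * (`|x - x'| + `|y - y'|).

Section Closure.
Variables (a b l u : R).
Implicit Types (k : R).

Lemma lipb_strip f : lipb a b l u f -> exists2 L, 0 <= L & lipschitz_strip f L a b l u.
Proof. by move=> [M M0 H]; exists M => // x x' y y' xx xx' yy yy'; have [_] := H _ _ xx yy; apply. Qed.

Lemma lipb_cst k : lipb a b l u (fun _ _ => k).
Proof.
exists `|k| => // x y _ _; split => // x' y' _ _.
by rewrite subrr normr0 mulr_ge0// addr_ge0.
Qed.

Lemma norm_segment (p q x : R) : p <= x <= q -> `|x| <= `|p| + `|q|.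
Proof.
move=> /andP[px xq]; rewrite ler_norml; have := ler_norm q; have := ler_norm (- p).
by rewrite normrN => *; apply/andP; split; have := normr_ge0 p; have := normr_ge0 q; lra.
Qed.

Lemma lipb_fst : lipb a b l u (fun x _ => x).
Proof.
exists (`|a| + `|b| + 1); first by rewrite !addr_ge0.
move=> x y xab _; split; first by apply: (le_trans (norm_segment xab)); rewrite lerDl.
move=> x' y' _ _; have := normr_ge0 (x - x'); have := normr_ge0 (y - y').
have : 0 <= `|a| + `|b| by rewrite addr_ge0.
move: (`|a| + `|b|) => t t0 h1 h2; nra.
Qed.

Lemma lipb_snd : lipb a b l u (fun _ y => y).
Proof.
exists (`|l| + `|u| + 1); first by rewrite !addr_ge0.
move=> x y _ yab; split; first by apply: (le_trans (norm_segment yab)); rewrite lerDl.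
move=> x' y' _ _; have := normr_ge0 (x - x'); have := normr_ge0 (y - y').
have : 0 <= `|l| + `|u| by rewrite addr_ge0.
move: (`|l| + `|u|) => t t0 h1 h2; nra.
Qed.

Lemma lipbD f g : lipb a b l u f -> lipb a b l u g -> lipb a b l u (fun x y => f x y + g x y).
Proof.
move=> [M M0 Hf] [K K0 Hg]; exists (M + K); first by rewrite addr_ge0.
move=> x y xx yy; have [f1 f2] := Hf _ _ xx yy; have [g1 g2] := Hg _ _ xx yy.
split; first by apply: (le_trans (ler_normD _ _)); exact: lerD.
move=> x' y' xx' yy'; rewrite opprD addrACA; apply: (le_trans (ler_normD _ _)).
by rewrite mulrDl; apply: lerD; [exact: f2|exact: g2].
Qed.

Lemma lipbM f g : lipb a b l u f -> lipb a b l u g -> lipb a b l u (fun x y => f x y * g x y).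
Proof.
move=> [M M0 Hf] [K K0 Hg]; exists (2 * (M * K)); first by rewrite !mulr_ge0.
move=> x y xx yy; have [f1 f2] := Hf _ _ xx yy; have [g1 g2] := Hg _ _ xx yy.
have MK : 0 <= M * K by rewrite mulr_ge0.
split.
  by rewrite normrM; apply: (@le_trans _ _ (M * K)); [exact: ler_pM|lra].
move=> x' y' xx' yy'; have [f1' _] := Hf _ _ xx' yy'.
have -> : f x y * g x y - f x' y' * g x' y' =
  (f x y - f x' y') * g x y + f x' y' * (g x y - g x' y') by ring.
apply: (le_trans (ler_normD _ _)); rewrite !normrM.
set D := `|x - x'| + `|y - y'|.
have h1 : `|f x y - f x' y'| * `|g x y| <= M * D * K by apply: ler_pM => //; exact: f2.
have h2 : `|f x' y'| * `|g x y - g x' y'| <= M * (K * D) by apply: ler_pM => //; exact: g2.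
lra.
Qed.

Lemma lipbN f : lipb a b l u f -> lipb a b l u (fun x y => - f x y).
Proof.
move=> [M M0 Hf]; exists M => // x y xx yy; have [f1 f2] := Hf _ _ xx yy.
split; first by rewrite normrN.
move=> x' y' xx' yy'; have -> : - f x y - - f x' y' = - (f x y - f x' y') by ring.
by rewrite normrN; exact: f2.
Qed.

Lemma lipbV f c : 0 < c -> (forall x y, a <= x <= b -> l <= y <= u -> c <= `|f x y|) ->
  lipb a b l u f -> lipb a b l u (fun x y => (f x y)^-1).
Proof.
move=> c0 fc [M M0 Hf]; exists (c^-1 + M * (c^-1 * c^-1)).
  by rewrite addr_ge0 ?mulr_ge0// invr_ge0 ltW.
have ci : 0 <= c^-1 by rewrite invr_ge0 ltW.
have fi x y : a <= x <= b -> l <= y <= u -> `|(f x y)^-1| <= c^-1.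
  by move=> xx yy; rewrite normfV lef_pV2 ?posrE ?fc// (lt_le_trans c0)// fc.
have fn x y : a <= x <= b -> l <= y <= u -> f x y != 0.
  by move=> xx yy; rewrite -normr_gt0 (lt_le_trans c0)// fc.
have Mcc : 0 <= M * (c^-1 * c^-1) by rewrite !mulr_ge0.
move=> x y xx yy; have [f1 f2] := Hf _ _ xx yy; split.
  by apply: (le_trans (fi _ _ xx yy)); lra.
move=> x' y' xx' yy'.
have n1 := fn _ _ xx yy; have n2 := fn _ _ xx' yy'.
have -> : (f x y)^-1 - (f x' y')^-1 = - (f x y - f x' y') * ((f x y)^-1 * (f x' y')^-1).
  by field; rewrite ?n1 ?n2.
rewrite !normrM normrN.
set D := `|x - x'| + `|y - y'|.
have D0 : 0 <= D by rewrite addr_ge0.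
have h1 : `|f x y - f x' y'| * (`|(f x y)^-1| * `|(f x' y')^-1|) <= M * D * (c^-1 * c^-1).
  apply: ler_pM; [exact: normr_ge0|by rewrite mulr_ge0|exact: f2|].
  by apply: ler_pM => //; exact: fi.
have : 0 <= c^-1 * D by rewrite mulr_ge0.
lra.
Qed.
End Closure.

End OdeOpen.

(** * The phase plane *)

Section PhasePlane.
Variable R : realType.
Variables (N d : R).

(** [N] is the dimension and [d] the adiabatic index minus one.  Put
    [W = 1 + V], [C ^ 2 = W y] and [v = - lam x W'].  Eliminating the density,
    the profile equations become
    - [v (W - y) = Hf W - y Sf W],
    - [W v dy/dW = - y ((1 + d) v - d + mm W)].
    The exponent [kappa] of the density enters through [s0] only.  The orbit
    meets the sonic line [y = W] where [Pf W = Hf W - W Sf W] vanishes, and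
    [s0] is chosen so that this happens at [W = ws], a small abscissa for
    which the estimates below hold.  The value of [lam] is such
    that [mm - 2 lam = d], whence the simple form of the second equation.
    Solving the first one for [y] gives the scalar equation
    [dv/dW = rhs W v / (W v Pf W)], for which the constants [v2] and [v0] are
    barriers between [0] and [W1]. *)
Definition eps := (N - 1) * d / 2.
Definition lam := 1 + eps.
Definition mm := 2 + N * d.
Definition v0 := d / (1 + d).
Definition W1 := d / (2 * mm).
Definition ws := d / (8 * mm).
Definition s0 := 1 - eps + (N - 1) * (4 * mm + ws).
Definition Hf (W : R) := (1 - W) * (eps + W).
Definition Hd (W : R) := 1 - eps - 2 * W.
Definition Sf (W : R) := s0 - N * W.
Definition Pf (W : R) := (N - 1) * (ws - W) * (4 * mm - W).
Definition rhs (W v : R) :=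
  (Sf W - v) * (W * v * (v - Hd W) - (Hf W - v * W) * ((1 + d) * v - d + mm * W))
  - N * W * v * (Hf W - v * W).
Definition v2 := eps * d / (2 * eps * (2 + d) + 1).

(** Beyond [W1], which lies to the right of the sonic point, the orbit is described
    by [Y = y / (1 - W) ^ 2].  Then [v = (1 - W) num / den],
    [v - lam (1 - W) = (1 - W) ^ 2 kap / den] and
    [dY/dW = - Y bar / (W num)].  The initial value [Y1] corresponds to
    [v = v0], where the two descriptions are joined. *)
Definition y1 := (Hf W1 - v0 * W1) / (Sf W1 - v0).
Definition Y1 := y1 / (1 - W1) ^+ 2.
Definition num (W Y : R) := eps + W - (1 - W) * Sf W * Y.
Definition den (W Y : R) := W - (1 - W) ^+ 2 * Y.
Definition kap (W Y : R) := eps - Sf W * Y + lam * (1 - W) * Y.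
Definition bar (W Y : R) :=
  (1 + d) * num W Y - d * den W Y - 2 * W * kap W Y.

Hypothesis N23 : N = 2 \/ N = 3.
Hypothesis d0 : 0 < d.

Ltac dlra := have := d0; lra.
Ltac dnra := have := d0; nra.

Lemma N_gt0 : 0 < N. Proof. by case: N23 => ->; dlra. Qed.
Lemma mm_gt0 : 0 < mm. Proof. by rewrite /mm; case: N23 => ->; dlra. Qed.
Lemma mm_ge : 2 + 2 * d <= mm. Proof. by rewrite /mm; case: N23 => ->; dlra. Qed.
Lemma eps_ge : d / 2 <= eps. Proof. by rewrite /eps; case: N23 => ->; dlra. Qed.
Lemma eps_le : eps <= d. Proof. by rewrite /eps; case: N23 => ->; dlra. Qed.
Lemma eps_gt0 : 0 < eps. Proof. by have := eps_ge; dlra. Qed.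

Lemma mmW1 : mm * W1 = d / 2.
Proof. by rewrite /W1; field; rewrite gt_eqF// mm_gt0. Qed.
Lemma W1_gt0 : 0 < W1.
Proof. by rewrite divr_gt0// mulr_gt0// mm_gt0. Qed.
Lemma W1_lt : W1 < 1 / 4.
Proof. by rewrite /W1 ltr_pdivrMr ?mulr_gt0 ?mm_gt0//; have := mm_ge; dlra. Qed.
Lemma W1_le : W1 <= d / 4.
Proof.
rewrite /W1 ler_pdivrMr ?mulr_gt0 ?mm_gt0//; have := mm_ge; dnra.
Qed.
Lemma NW1 : N * W1 <= 1 / 2.
Proof.
rewrite /W1 mulrA ler_pdivrMr ?mulr_gt0 ?mm_gt0// /mm.
by case: N23 => ->; dlra.
Qed.
Lemma ws_gt0 : 0 < ws. Proof. by rewrite divr_gt0// mulr_gt0// mm_gt0. Qed.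
Lemma ws4 : 4 * ws = W1.
Proof. by rewrite /W1 /ws; field; rewrite gt_eqF// mm_gt0. Qed.
Lemma ws_lt : ws < W1. Proof. by have := ws4; have := ws_gt0; dlra. Qed.

Lemma v0d : (1 + d) * v0 = d.
Proof. by rewrite /v0 mulrC divfK// gt_eqF//; dlra. Qed.
Lemma v0_gt0 : 0 < v0. Proof. by rewrite divr_gt0//; dlra. Qed.
Lemma v0_lt1 : v0 < 1.
Proof. by rewrite /v0 ltr_pdivrMr; dlra. Qed.
Lemma v0_lt : v0 < d.
Proof. by rewrite /v0 ltr_pdivrMr; dnra. Qed.

Lemma v2_eq : v2 * (2 * eps * (2 + d) + 1) = eps * d.
Proof. by rewrite /v2 divfK// gt_eqF//; have := d0; have := eps_gt0; dnra. Qed.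
Lemma v2_gt0 : 0 < v2.
Proof.
have e0 := eps_gt0; have ed := mulr_gt0 e0 d0.
by rewrite /v2 divr_gt0//; dlra.
Qed.
Lemma v2_le : 2 * (2 + d) * v2 <= d.
Proof.
have e0 := eps_gt0; have v20 := v2_gt0; rewrite -(ler_pM2l e0) -v2_eq; dlra.
Qed.
Lemma v2_lt : v2 < v0.
Proof. by have := v2_le; have := v0d; have := d0; have := v2_gt0; dnra. Qed.

(** The definition of [s0] is this identity solved for [s0]: the quadratic
    [Hf W - W Sf W] has leading coefficient [N - 1] and constant term [eps], so
    its second root [4 mm] follows from the first one, [ws]. *)
Lemma PfE W : Hf W - W * Sf W = Pf W.
Proof.
by rewrite /Hf /Sf /Pf /s0 /ws /eps /mm; case: N23 => ->; field; dnra.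
Qed.

Lemma s0_ge : N + 5 <= s0.
Proof.
rewrite /s0; have := ws_gt0; have := d0; rewrite /eps /mm; case: N23 => ->; dnra.
Qed.
Lemma Sf_ge W : W <= 1 -> 5 <= Sf W.
Proof. by move=> W1_; have := s0_ge; rewrite /Sf; case: N23 => ->; dlra. Qed.

(** The inequalities between quadratic polynomials in [W] needed below concern
    concave ones, hence are checked at the ends of the interval. *)
Lemma concave_ge0 (A B C p q W : R) : C <= 0 -> p <= W <= q ->
  0 <= A + B * p + C * p ^+ 2 -> 0 <= A + B * q + C * q ^+ 2 ->
  0 <= A + B * W + C * W ^+ 2.
Proof.
move=> C0 /andP[pW Wq] fp fq.
have [pq|pq] := eqVneq p q.
  by have -> : W = p by apply/eqP; rewrite eq_le pW pq Wq.
have pq' : 0 < q - p by rewrite subr_gt0 lt_neqAle pq (le_trans pW Wq).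
rewrite -(pmulr_rge0 _ pq').
have -> : (q - p) * (A + B * W + C * W ^+ 2) =
  (q - W) * (A + B * p + C * p ^+ 2) + (W - p) * (A + B * q + C * q ^+ 2)
  + (- C) * ((q - p) * ((q - W) * (W - p))) by ring.
apply: addr_ge0; first by apply: addr_ge0; apply: mulr_ge0; rewrite ?subr_ge0.
apply: mulr_ge0; first by rewrite oppr_ge0.
by do !apply: mulr_ge0; rewrite ?subr_ge0// -subr_ge0 ltW.
Qed.

Lemma Q_ge W v : 0 <= W <= W1 -> v <= v0 -> eps / 2 <= Hf W - v * W.
Proof.
move=> /andP[W0 WW] vv.
apply: (@le_trans _ _ (Hf W - v0 * W)); last first.
  by have : v * W <= v0 * W by [rewrite ler_wpM2r|]; dlra.
rewrite -subr_ge0.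
have -> : Hf W - v0 * W - eps / 2 = eps / 2 + (1 - eps - v0) * W + (-1) * W ^+ 2.
  by rewrite /Hf; field.
apply: (@concave_ge0 _ _ _ 0 W1); [dlra|by rewrite W0 WW| |].
  by have := eps_gt0; dlra.
have := eps_ge; have := W1_gt0; have := W1_lt; have := W1_le; have := v0_lt1.
dnra.
Qed.

Lemma slope_gap W : 0 <= W <= W1 ->
  0 <= mm * (Hf W - v0 * W) - v0 * (v0 - Hd W).
Proof.
move=> WW.
have -> : mm * (Hf W - v0 * W) - v0 * (v0 - Hd W) =
  (mm * eps - v0 * (v0 - 1 + eps)) + (mm * (1 - eps - v0) - 2 * v0) * W
   + (- mm) * W ^+ 2 by rewrite /Hf /Hd; ring.
apply: (@concave_ge0 _ _ _ 0 W1); [by have := mm_gt0; dlra|by []| |].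
- rewrite mulr0 expr0n mulr0 !addr0.
  have := mm_ge; have := eps_gt0; have := v0_lt1; have := v0_gt0; dnra.
have -> : (mm * eps - v0 * (v0 - 1 + eps)) + (mm * (1 - eps - v0) - 2 * v0) * W1
   + (- mm) * W1 ^+ 2 = mm * eps + (mm * W1) * (1 - eps - v0) - (mm * W1) * W1 -
     v0 * (v0 - 1 + eps) - 2 * v0 * W1 by ring.
rewrite mmW1.
have h1 : v0 ^+ 2 <= d / 4.
  have E : v0 = d * (1 - v0) by have := v0d; dlra.
  have -> : v0 ^+ 2 = d * (v0 * (1 - v0)) by rewrite expr2 {1}E; ring.
  have : v0 * (1 - v0) <= 1 / 4 by have := sqr_ge0 (v0 - 1 / 2); dlra.
  by move/(ler_wpM2l (ltW d0)); dlra.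
have h2 : d * v0 <= d * d by rewrite ler_wpM2l ?(ltW d0)// ltW// v0_lt.
have h3 : (2 + 2 * d) * eps <= mm * eps by rewrite ler_wpM2r ?mm_ge// ltW// eps_gt0.
have h4 : v0 * eps <= eps by have := v0_lt1; have := eps_gt0; dnra.
have h5 : v0 * W1 <= v0 / 4 by have := W1_lt; have := v0_gt0; dnra.
have h6 : d * W1 <= d / 4 by have := W1_lt; dnra.
have h7 : d * d / 2 <= d * eps by have := eps_ge; dnra.
by have := eps_ge; have := v0_gt0; dnra.
Qed.

(** At [v = v0] the factor [(1 + d) v - d] vanishes, and [rhs] reduces to
    [- W] times a quantity that [slope_gap] shows to be nonnegative. *)
Lemma upper_barrier W : 0 <= W <= W1 -> rhs W v0 <= 0.
Proof.
move=> WW; have Wb := WW; case/andP: Wb => W0 WW1.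
have Q0 := Q_ge WW (lexx v0).
have G := slope_gap WW.
have SS := Sf_ge (_ : W <= 1); have W1l := W1_lt.
have {}SS : 5 <= Sf W by apply: SS; dlra.
have -> : rhs W v0 = - (W * ((Sf W - v0) * (mm * (Hf W - v0 * W) - v0 * (v0 - Hd W))
    + N * v0 * (Hf W - v0 * W))) by rewrite /rhs v0d; ring.
rewrite oppr_le0 mulr_ge0// addr_ge0// mulr_ge0//.
- by have := v0_lt1; dlra.
- by have := v0_gt0; case: N23 => ->; dlra.
- by have := eps_gt0; dlra.
Qed.

(** The dominant term is [Sf Hf (d - (1 + d) v - mm W)], where [mm W <= d / 2]; the
    other terms have the factor [v], and [v2] is small enough. *)
Lemma lower_barrier W : 0 <= W <= W1 -> 0 <= rhs W v2.
Proof.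
move=> WW; have Wb := WW; case/andP: Wb => W0 WW1.
have Q0 := Q_ge WW (ltW v2_lt).
have W1l := W1_lt.
have SS : 5 <= Sf W by apply: Sf_ge; dlra.
set Q := Hf W - v2 * W in Q0 *.
have vv := v2_lt; have v01 := v0_lt1; have v20 := v2_gt0; have e0 := eps_gt0.
have dd := d0.
have NW : N * W <= 1 / 2.
  by apply: le_trans NW1; rewrite ler_wpM2l ?(ltW N_gt0).
have mW : mm * W <= d / 2 by rewrite -mmW1 ler_wpM2l// ltW// mm_gt0.
have -> : rhs W v2 = (Sf W - v2) * (W * v2 * (v2 - Hd W) + Q * (d - (1 + d) * v2 - mm * W))
   - (N * W) * (v2 * Q) by rewrite /rhs -/Q; ring.
have h1 : - (v2 / 4) <= W * v2 * (v2 - Hd W).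
  have : 0 <= W * v2 by rewrite mulr_ge0// ltW.
  have : W * v2 <= v2 / 4 by dnra.
  have hY : -1 <= v2 - Hd W by rewrite /Hd; dlra.
  by move=> hX h0; have := ler_wpM2l h0 hY; dlra.
have v2Q : 0 <= v2 * Q by rewrite mulr_ge0 ?(ltW v20)//; dlra.
have h2 : N * W * (v2 * Q) <= (Sf W - v2) * (v2 * Q / 2).
  have : N * W * (v2 * Q) <= 1 / 2 * (v2 * Q) by rewrite ler_wpM2r.
  have : 1 * (v2 * Q / 2) <= (Sf W - v2) * (v2 * Q / 2) by rewrite ler_wpM2r//; dlra.
  dlra.
have h3 : Q * (d / 2 - (1 + d) * v2) <= Q * (d - (1 + d) * v2 - mm * W).
  by rewrite ler_wpM2l//; dlra.
have h4 : 0 <= Q * (d / 2 - (1 + d) * v2 - v2 / 2) - v2 / 4.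
  have : 0 <= d / 2 - (1 + d) * v2 - v2 / 2 by have := v2_le; dlra.
  have := v2_eq; dnra.
have h5 : 0 <= (Sf W - v2) * (W * v2 * (v2 - Hd W) + Q * (d - (1 + d) * v2 - mm * W) - v2 * Q / 2).
  by rewrite mulr_ge0//; dlra.
dlra.
Qed.

Lemma PfW1 : Hf W1 < W1 * Sf W1.
Proof.
rewrite -subr_lt0 PfE /Pf.
have := ws_lt; have := W1_lt; have := mm_ge; have := d0 => h1 h2 h3 h4.
have N1 : 0 < N - 1 by case: N23 => ->; dlra.
by rewrite -mulrA pmulr_rlt0// nmulr_rlt0; dlra.
Qed.

Lemma S1v0 : 0 < Sf W1 - v0.
Proof. by have := Sf_ge (_ : W1 <= 1); have := W1_lt; have := v0_lt1; dlra. Qed.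
Lemma y1_eq : y1 * (Sf W1 - v0) = Hf W1 - v0 * W1.
Proof. by rewrite /y1 divfK// gt_eqF// S1v0. Qed.
Lemma y1_gt0 : 0 < y1.
Proof.
rewrite /y1 divr_gt0 ?S1v0//.
have := @Q_ge W1 v0; rewrite lexx (ltW W1_gt0) => /(_ erefl (lexx _)).
by have := eps_gt0; dlra.
Qed.
Lemma y1_lt : y1 < W1.
Proof. by rewrite /y1 ltr_pdivrMr ?S1v0// mulrBr; have := PfW1; dlra. Qed.
Lemma Y1_eq : (1 - W1) ^+ 2 * Y1 = y1.
Proof.
by rewrite /Y1 mulrC divfK// expf_neq0// subr_eq0 eq_sym lt_eqF//; have := W1_lt; dlra.
Qed.
Lemma Y1_gt0 : 0 < Y1.
Proof. by rewrite divr_gt0 ?y1_gt0// exprn_gt0//; have := W1_lt; dlra. Qed.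
Lemma numW1 : (1 - W1) * num W1 Y1 = v0 * (W1 - y1).
Proof.
transitivity (Hf W1 - Sf W1 * ((1 - W1) ^+ 2 * Y1)); first by rewrite /num /Hf; ring.
by rewrite Y1_eq; have := y1_eq; dlra.
Qed.

Lemma num_gt0 W Y : W1 <= W <= 1 -> 0 <= Y <= Y1 -> num W1 Y1 <= num W Y.
Proof.
move=> /andP[h1 h2] /andP[h3 h4].
have N0 : 0 <= N by case: N23 => ->; dlra.
have : (1 - W) * Sf W <= (1 - W1) * Sf W1.
  apply: ler_pM; [by rewrite subr_ge0|by have := Sf_ge h2; dlra|dlra|].
  by rewrite /Sf lerD2l lerN2 ler_wpM2l.
move=> h5; have h6 : (1 - W) * Sf W * Y <= (1 - W1) * Sf W1 * Y1.
  apply: ler_pM => //; apply: mulr_ge0; first by rewrite subr_ge0.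
  by have := Sf_ge h2; dlra.
by rewrite /num; dlra.
Qed.
Lemma numW1_gt0 : 0 < num W1 Y1.
Proof.
have := numW1; have := W1_lt; have := v0_gt0; have := y1_lt => h1 h2 h3 E.
have : 0 < (1 - W1) * num W1 Y1 by rewrite E mulr_gt0// subr_gt0.
by rewrite pmulr_rgt0//; dlra.
Qed.
Lemma den_ge W Y : W1 <= W <= 1 -> 0 <= Y <= Y1 -> W1 - y1 <= den W Y.
Proof.
move=> /andP[h1 h2] /andP[h3 h4]; rewrite -Y1_eq /den.
have : (1 - W) ^+ 2 * Y <= (1 - W1) ^+ 2 * Y1.
  by apply: ler_pM => //; rewrite ?sqr_ge0// ler_sqr ?nnegrE; dlra.
dlra.
Qed.

(** The constant [Y1] is an upper barrier for the equation of [Y].  Concavity in [W]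
    leaves the ends: at [W1] the value of [bar] is known through [v = v0], and
    at [1] it is a sum of nonnegative terms. *)
Lemma bar_ge0 W : W1 <= W <= 1 -> 0 <= bar W Y1.
Proof.
move=> WW; have Yp := Y1_gt0.
have E (x : R) : bar x Y1 = ((1 + d) * eps - s0 * (1 + d) * Y1 + d * Y1)
   + ((1 - 2 * eps) + Y1 * (N * (1 + d) + s0 * (3 + d) - 2 * d - 2 * lam)) * x
   + (Y1 * (2 - 3 * N)) * x ^+ 2.
  by rewrite /bar /num /den /kap /Sf /lam /eps; field.
rewrite E; apply: concave_ge0 WW _ _.
- by apply: mulr_ge0_le0; [exact: ltW|case: N23 => ->; dlra].
- rewrite -E; have W10 := W1_gt0; have W1l := W1_lt.
  have p1 : 0 < 1 - W1 by dlra.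
  rewrite -(pmulr_rge0 _ p1).
  have D1 : den W1 Y1 = W1 - y1 by rewrite /den Y1_eq.
  have -> : (1 - W1) * bar W1 Y1 = (1 + d) * ((1 - W1) * num W1 Y1)
    + (mm * W1 - d) * den W1 Y1 - 2 * W1 * num W1 Y1.
    by rewrite /bar /num /den /kap /lam /mm /eps; field.
  rewrite numW1 D1 mulrA v0d.
  rewrite -(pmulr_rge0 _ p1).
  have -> : (1 - W1) * (d * (W1 - y1) + (mm * W1 - d) * (W1 - y1) - 2 * W1 * num W1 Y1)
    = W1 * ((1 - W1) * mm * (W1 - y1) - 2 * ((1 - W1) * num W1 Y1)) by ring.
  rewrite numW1 mulr_ge0 ?(ltW W10)//.
  have -> : (1 - W1) * mm * (W1 - y1) - 2 * (v0 * (W1 - y1)) =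
     (W1 - y1) * ((1 - W1) * mm - 2 * v0) by ring.
  rewrite mulr_ge0 ?subr_ge0 ?(ltW y1_lt)//.
  rewrite mulrBl mul1r [W1 * _]mulrC mmW1.
  by have := mm_ge; have := v0_lt; have := v0_lt1; dlra.
- rewrite -E.
  have -> : bar 1 Y1 = (1 - eps + d * eps) + 2 * (Sf 1 * Y1).
    by rewrite /bar /num /den /kap /lam /eps; field.
  have := Sf_ge (lexx 1) => S1.
  have : 0 <= Sf 1 * Y1 by rewrite mulr_ge0 ?(ltW Yp)//; dlra.
  have : 0 <= 1 - eps + d * eps by rewrite /eps; case: N23 => ->; dnra.
  dlra.
Qed.

(** * Arcs of the orbit *)

Ltac lipb_poly := repeat first
  [ exact: lipb_cst | exact: lipb_fst | exact: lipb_snd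
  | apply: lipbD | apply: lipbN | apply: lipbM ].

Definition slope (W v : R) := rhs W v / (W * v * Pf W).

(** The sign [sg] is [-1] for the arc to the right of the sonic point, which is
    followed backwards from its prescribed value at [W1]. *)
Lemma lipb_slope (sg a b : R) : `|sg| = 1 ->
  (exists2 c, 0 < c & forall W, a <= W <= b -> c <= `|sg * W| /\ c <= `|Pf (sg * W)|) ->
  lipb a b v2 v0 (fun x y => sg * slope (sg * x) y).
Proof.
move=> sg1 [c c0 Hc]; rewrite /slope.
apply: lipbM; first by lipb_poly.
apply: lipbM; first by rewrite /rhs /Sf /Hd /Hf; lipb_poly.
apply: (@lipbV _ _ _ _ _ _ (c * v2 * c)).
- exact: (mulr_gt0 (mulr_gt0 c0 (v2_gt0)) c0).
- move=> W v /Hc[h1 h2] /andP[h3 h4].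
  have v20 := v2_gt0.
  rewrite normrM; apply: ler_pM => //; first by rewrite mulr_ge0// ltW.
    by rewrite ltW.
  rewrite normrM; apply: ler_pM => //; try by rewrite ltW.
  by rewrite (le_trans h3)// ler_norm.
- by rewrite /Pf; lipb_poly.
Qed.

Lemma Pf_left_ge W e : W <= e -> e < ws -> (N - 1) * (ws - e) * (4 * mm - ws) <= Pf W.
Proof.
move=> We ews; rewrite /Pf.
have wl := ws_lt; have w1l := W1_lt; have mg := mm_ge.
have N1 : 0 < N - 1 by case: N23 => ->; lra.
have := d0 => dd.
rewrite -!mulrA ler_pM2l// ; apply: ler_pM; lra.
Qed.

Lemma Pf_right_ge W e : e <= W -> ws < e -> W <= W1 -> (N - 1) * (e - ws) * (4 * mm - W1) <= - Pf W.
Proof.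
move=> We ews WW; rewrite /Pf.
have wl := ws_lt; have w1l := W1_lt; have mg := mm_ge.
have N1 : 0 < N - 1 by case: N23 => ->; lra.
have := d0 => dd.
have -> : - ((N - 1) * (ws - W) * (4 * mm - W)) = (N - 1) * ((W - ws) * (4 * mm - W)) by ring.
rewrite -!mulrA ler_pM2l// ; apply: ler_pM; lra.
Qed.

Lemma mm4_gt : W1 < 4 * mm.
Proof. by have := W1_lt; have := mm_ge; have := d0; lra. Qed.

Lemma Pf_gt0 W : W < ws -> 0 < Pf W.
Proof.
move=> Wws; have := Pf_left_ge (lexx W) Wws; apply: lt_le_trans.
have := mm4_gt; have := ws_lt => h1 h2.
by rewrite !mulr_gt0//; [case: N23 => ->; lra|lra|lra].
Qed.

Lemma Pf_lt0 W : ws < W -> W <= W1 -> Pf W < 0.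
Proof.
move=> wsW WW; rewrite -oppr_gt0; have := Pf_right_ge (lexx W) wsW WW; apply: lt_le_trans.
have := mm4_gt => h1.
by rewrite !mulr_gt0//; [case: N23 => ->; lra|lra|lra].
Qed.

(** Any solution between the barriers will do: its limits at the two singular ends
    are determined afterwards. *)
Lemma left_arc : exists v : R -> R, (forall W, v2 <= v W <= v0) /\
  forall W, 0 < W < ws -> is_derive W 1 v (slope W (v W)).
Proof.
have wsW := ws_lt.
apply: ode_open; [exact: ws_gt0|exact: ltW (v2_lt)| | |].
- move=> c e c0 ce ews; apply: lipb_strip.
  have -> : slope = (fun x y => 1 * slope (1 * x) y).
    by apply/funext => x; apply/funext => y; rewrite !mul1r.
  apply: lipb_slope; first by rewrite normr1.
  pose P0 := (N - 1) * (ws - e) * (4 * mm - ws).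
  have P00 : 0 < P0.
    by have := mm4_gt => h1; rewrite /P0 !mulr_gt0//; [case: N23 => ->; lra|lra|lra].
  exists (Num.min c P0); first by rewrite lt_min c0.
  move=> W /andP[cW We]; rewrite mul1r; split.
    by rewrite ge_min (le_trans cW)// ler_norm.
  by rewrite ge_min (le_trans (Pf_left_ge We ews)) ?orbT// ler_norm.
- move=> W /andP[W0 Wws]; have Wb : 0 <= W <= W1 by apply/andP; split; lra.
  apply: divr_ge0; first exact: lower_barrier.
  exact: ltW (mulr_gt0 (mulr_gt0 W0 (v2_gt0)) (Pf_gt0 Wws)).
- move=> W /andP[W0 Wws]; have Wb : 0 <= W <= W1 by apply/andP; split; lra.
  rewrite /slope mulr_le0_ge0 ?upper_barrier//.
  by rewrite invr_ge0; exact: ltW (mulr_gt0 (mulr_gt0 W0 (v0_gt0)) (Pf_gt0 Wws)).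
Qed.

(** To the right of [ws] the polynomial [Pf] is negative, so the barriers act
    backwards; the solution is started at [W1] on the upper one. *)
Lemma right_arc : exists v : R -> R, [/\ forall W, v2 <= v W <= v0,
  forall W, ws < W < W1 -> is_derive W 1 v (slope W (v W)) &
  v W @[W --> W1^'-] --> v0].
Proof.
have wsW := ws_lt.
have := @ode_half_open R (fun x y => - 1 * slope (-1 * x) y) (- W1) (- ws) v2 v0 v0.
rewrite ltrN2 wsW lexx (ltW (v2_lt)) => /(_ erefl erefl).
case.
- move=> e We ews; apply: lipb_strip; apply: lipb_slope; first by rewrite normrN1.
  pose P0 := (N - 1) * (- e - ws) * (4 * mm - W1).
  have P00 : 0 < P0.
    by have := mm4_gt => h1; rewrite /P0 !mulr_gt0//; [case: N23 => ->; lra|lra|lra].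
  exists (Num.min ws P0); first by rewrite lt_min ws_gt0.
  move=> W /andP[cW Wl]; rewrite mulN1r normrN; split.
    by rewrite ge_min -normrN (le_trans (_ : ws <= - W))//; [lra|rewrite ler_norm].
  rewrite ge_min -normrN; apply/orP; right.
  by apply: le_trans (ler_norm _); apply: Pf_right_ge; lra.
- move=> W /andP[W0 Wws]; rewrite mulN1r oppr_ge0 /slope.
  have Wb : 0 <= -1 * W <= W1 by have := ws_gt0 => ?; apply/andP; split; lra.
  rewrite mulr_ge0_le0 ?lower_barrier// invr_le0 ltW//.
  have W0' : 0 < -1 * W by have := ws_gt0; lra.
  by rewrite (pmulr_rlt0 _ (mulr_gt0 W0' (v2_gt0))) Pf_lt0//; lra.
- move=> W /andP[W0 Wws]; rewrite mulN1r oppr_le0 /slope.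
  have Wb : 0 <= -1 * W <= W1 by have := ws_gt0 => ?; apply/andP; split; lra.
  rewrite mulr_le0 ?upper_barrier// invr_le0 ltW//.
  have W0' : 0 < -1 * W by have := ws_gt0; lra.
  by rewrite (pmulr_rlt0 _ (mulr_gt0 W0' (v0_gt0))) Pf_lt0//; lra.
move=> w [wb wW1 wd wc]; exists (fun W => w (- W)); split => //.
- move=> W /andP[h1 h2].
  have Wb : - W1 < - W < - ws by rewrite !ltrN2 h1 h2.
  have H1 := wd _ Wb.
  have H2 : is_derive W 1 (fun x : R => - x) (-1).
    by apply: is_deriveN.
  have := @is_derive1_comp _ w (fun x : R => - x) W _ _ H1 H2.
  by rewrite !mulN1r opprK mulrN1 opprK.
- apply: (@cvg_comp _ _ _ (fun x : R => - x) w _ (- W1)^'+ _ _ wc).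
  by rewrite at_rightN.
Qed.

(** At [W = ws] the slope [rhs / (W v Pf)] is of the form [0 / 0] on the zeros of
    [qf ws]. *)
Definition qf (W v : R) :=
  v * (v - Hd W - N * W) - (Sf W - v) * ((1 + d) * v - d + mm * W).
Definition rf (W v : R) := (Sf W - v) * ((1 + d) * v - d + mm * W) + N * W * v.
Definition qf_slope (W v : R) :=
  (2 - N) * v - (s0 - v) * mm + N * ((1 + d) * v - d) + N * mm * (W + ws).

Lemma rhs_split W v : rhs W v = W * (Sf W - v) * qf W v - Pf W * rf W v.
Proof.
have E : Hf W = W * Sf W + Pf W by rewrite -(PfE); ring.
by rewrite /rhs E /qf /rf; ring.
Qed.

Lemma qf_increment W v : qf W v = qf ws v + (W - ws) * qf_slope W v.
Proof. by rewrite /qf /qf_slope /Hd /Sf; ring. Qed.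

(** The quadratic polynomial [qf ws] is nonnegative at [v2] and negative at [v0],
    whence the root [vs] between them.  The negative sign of the other factor
    makes the singular point a node. *)
Lemma node_root : exists vs cc, [/\ v2 <= vs <= v0,
  forall v, qf ws v = (v - vs) * ((2 + d) * v + cc) & (2 + d) * v0 + cc < 0].
Proof.
have wsb : 0 <= ws <= W1 by rewrite !ltW// ?ws_gt0// ws_lt.
have ws0 := ws_gt0; have v20 := v2_gt0.
have v00 := v0_gt0; have v01 := v0_lt1.
have S5 : 5 <= Sf ws by apply: Sf_ge => //; have := ws_lt; have := W1_lt; lra.
have P0 : Pf ws = 0 by rewrite /Pf subrr mulr0 mul0r.
have v2v := v2_lt.
have q2 : 0 <= qf ws v2.
  have := lower_barrier wsb; rewrite rhs_split P0 mul0r subr0.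
  by rewrite pmulr_rge0// mulr_gt0//; lra.
have q0 : qf ws v0 < 0.
  have := slope_gap wsb.
  have -> : Hf ws = ws * Sf ws by have := PfE ws; rewrite P0; lra.
  rewrite -(pmulr_rge0 _ ws0) /qf => H.
  have : 0 < N * ws * v0 by exact: (mulr_gt0 (mulr_gt0 (N_gt0) ws0) v00).
  have vd := v0d.
  have -> : (1 + d) * v0 - d = 0 by lra.
  move: H; rewrite (pmulr_rge0 _ ws0); lra.
have qc : {within `[v2, v0], continuous (qf ws)}.
  apply: continuous_subspaceT => x; rewrite /qf.
  apply: cvgB; apply: cvgM; try exact: cvg_id.
  - by apply: cvgB; [apply: cvgB; [exact: cvg_id|exact: cvg_cst]|exact: cvg_cst].
  - by apply: cvgB; [exact: cvg_cst|exact: cvg_id].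
  - apply: cvgD; last exact: cvg_cst.
    by apply: cvgB; [apply: cvgMl_tmp; exact: cvg_id|exact: cvg_cst].
have [|vs vsb qvs] := @IVT R (qf ws) v2 v0 0 (ltW v2v) qc.
  by rewrite ge_min le_max (ltW q0) q2 orbT.
move: vsb; rewrite in_itv /= => vsb.
pose q1 := - Hd ws - N * ws - Sf ws * (1 + d) + mm * ws - d.
have qE v : qf ws v = (v - vs) * ((2 + d) * v + (q1 + (2 + d) * vs)).
  by rewrite -[LHS]subr0 -{1}qvs /qf /q1; ring.
exists vs, (q1 + (2 + d) * vs); split => //.
move: q0; rewrite qE; case/andP: vsb => _; rewrite le_eqVlt => /predU1P[->|vlt].
  by rewrite subrr mul0r ltxx.
by rewrite pmulr_rlt0// subr_gt0.
Qed.

Lemma lipb_qf_slope a b l u : lipb a b l u qf_slope.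
Proof. by rewrite /qf_slope; lipb_poly. Qed.

Lemma lipb_rf a b l u : lipb a b l u rf.
Proof. by rewrite /rf /Sf; lipb_poly. Qed.

(** Near [ws] the equation reads [(W - ws) v' = k (v - vs) + O(W - ws)] with
    [k > 0] bounded below: every solution in the strip tends to [vs], from
    either side, so that arbitrary arcs fit together. *)
Lemma node_limit (vs cc sg z1 : R) (v : R -> R) :
  v2 <= vs <= v0 ->
  (forall v, qf ws v = (v - vs) * ((2 + d) * v + cc)) ->
  (2 + d) * v0 + cc < 0 -> sg = 1 \/ sg = -1 -> 0 < z1 ->
  (forall z, 0 < z < z1 -> ws / 2 <= ws + sg * z <= W1) ->
  (forall W, v2 <= v W <= v0) ->
  (forall z, 0 < z < z1 ->
     is_derive (ws + sg * z) 1 v (slope (ws + sg * z) (v (ws + sg * z)))) ->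
  v (ws + sg * z) @[z --> 0^'+] --> vs.
Proof.
move=> vsb qE cc0 sg1 z10 zb vb vd.
have v20 := v2_gt0; have v01 := v0_lt1.
have ws0 := ws_gt0; have W10 := W1_gt0; have W14 := W1_lt; have m4 := mm4_gt.
have N1 : 0 < N - 1 by case: N23 => ->; lra.
have sgN : sg * sg = 1 by case: sg1 => ->; ring.
pose D W v := v * ((N - 1) * (4 * mm - W)).
pose B W v := - ((Sf W - v) * qf_slope W v * (D W v)^-1 + rf W v * (W * v)^-1).
have Bl : lipb (ws / 2) W1 v2 v0 B.
  rewrite /B; apply: lipbN; apply: lipbD; apply: lipbM.
  - by apply: lipbM; [rewrite /Sf; lipb_poly|exact: lipb_qf_slope].
  - apply: (@lipbV _ _ _ _ _ _ (v2 * ((N - 1) * (4 * mm - W1)))).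
    + by rewrite (mulr_gt0 v20)// mulr_gt0//; lra.
    + move=> W w /andP[h1 h2] /andP[h3 h4]; apply: le_trans (ler_norm _).
      rewrite /D; apply: ler_pM; rewrite ?(ltW v20)//.
        by rewrite mulr_ge0//; lra.
      by rewrite ler_wpM2l// ?(ltW N1)//; lra.
    + by rewrite /D; lipb_poly.
  - exact: lipb_rf.
  - apply: (@lipbV _ _ _ _ _ _ (ws / 2 * v2)).
    + by rewrite mulr_gt0// divr_gt0.
    + move=> W w /andP[h1 h2] /andP[h3 h4]; apply: le_trans (ler_norm _).
      by apply: ler_pM; rewrite ?(ltW v20)//; lra.
    + by lipb_poly.
have [M M0 BM] := Bl.
pose e z := v (ws + sg * z) - vs.
pose k z := (Sf (ws + sg * z) - v (ws + sg * z)) *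
   (- ((2 + d) * v (ws + sg * z) + cc)) / D (ws + sg * z) (v (ws + sg * z)).
pose h z := sg * z * B (ws + sg * z) (v (ws + sg * z)).
pose kk := - ((2 + d) * v0 + cc) / (v0 * ((N - 1) * (4 * mm))).
suff : e z @[z --> 0^'+] --> 0.
  move=> H; have : e z + vs @[z --> 0^'+] --> 0 + vs by apply: cvgD => //; exact: cvg_cst.
  by rewrite add0r; apply: cvg_trans; apply: near_eq_cvg; apply: nearW => z; rewrite /e subrK.
apply: (@attracting_cvg0 _ e (fun z => sg * slope (ws + sg * z) (v (ws + sg * z))) k h z1 kk M (v0 - v2)) => //.
- have a1 : 0 < - ((2 + d) * v0 + cc) by rewrite oppr_gt0.
  have a2 : 0 < (N - 1) * (4 * mm) by rewrite mulr_gt0//; lra.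
  exact: (divr_gt0 a1 (mulr_gt0 (v0_gt0) a2)).
- by rewrite subr_ge0 ltW// v2_lt.
- move=> z zz; have H1 := vd _ zz.
  have H2 : is_derive z 1 (fun x : R => ws + sg * x) sg.
    have := is_deriveD (is_derive_cst ws z 1) (is_derive_mul (is_derive_cst sg z 1) (is_derive_id z 1)).
    by rewrite add0r mulr1 mulr0 addr0.
  have H3 := @is_derive1_comp _ v (fun x : R => ws + sg * x) z _ _ H1 H2.
  have := is_deriveB H3 (is_derive_cst vs z 1).
  by rewrite subr0 mulrC.
- move=> z zz; have /andP[h1 h2] := zb _ zz.
  have /andP[w1 w2] := vb (ws + sg * z).
  have S4 : 1 <= Sf (ws + sg * z) - v (ws + sg * z).
    have W1' : ws + sg * z <= 1 by lra.
    by have := Sf_ge W1'; lra.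
  rewrite /k /kk; apply: ler_pM.
  + by rewrite oppr_ge0 ltW.
  + by rewrite invr_ge0 ltW// (mulr_gt0 (v0_gt0))// mulr_gt0//; lra.
  + apply: (@le_trans _ _ (1 * (- ((2 + d) * v (ws + sg * z) + cc)))).
      rewrite mul1r lerN2 lerD2r ler_wpM2l//; have := d0; lra.
    rewrite ler_wpM2r// oppr_ge0 ltW// (le_lt_trans _ cc0)// lerD2r ler_wpM2l//.
    by have := d0; lra.
  + have vp : 0 < v (ws + sg * z) by exact: lt_le_trans w1.
    rewrite lef_pV2 ?posrE /D.
    * by apply: ler_pM => //; rewrite ?(ltW vp)// ?ler_wpM2l ?(ltW N1)//; [rewrite mulr_ge0//; lra|lra].
    * by rewrite (mulr_gt0 (v0_gt0))// mulr_gt0//; lra.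
    * by rewrite (mulr_gt0 vp)// mulr_gt0//; lra.
- move=> z zz; have [z0 _] := andP zz.
  have [Bb _] := BM _ _ (zb _ zz) (vb (ws + sg * z)).
  rewrite /h normrM [M * z]mulrC; apply: ler_pM => //.
  by rewrite normrM (gtr0_norm z0); case: sg1 => ->; rewrite ?normrN1 ?normr1 mul1r.
- move=> z zz; have /andP[w1 w2] := vb (ws + sg * z); have /andP[? ?] := vsb.
  by rewrite /e ler_norml; apply/andP; split; lra.
- move=> z zz; have /andP[h1 h2] := zb _ zz; have [z0 _] := andP zz.
  have /andP[w1 w2] := vb (ws + sg * z).
  rewrite /k /h /B /e /slope rhs_split qf_increment qE.
  set W := ws + sg * z in h1 h2 w1 w2 *; set u := v W in w1 w2 *.
  have zE : z = sg * (W - ws) by rewrite /W addrAC subrr add0r mulrA sgN mul1r.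
  have Pz : Pf W = - ((N - 1) * (sg * z) * (4 * mm - W)) by rewrite /Pf /W; ring.
  rewrite Pz /D (_ : W - ws = sg * z); last by rewrite /W; ring.
  have u0 : 0 < u by exact: lt_le_trans w1.
  field.
  have sg0 : sg != 0 by case: sg1 => ->; rewrite ?oppr_eq0 oner_eq0.
  have Wp : 0 < W by lra.
  have Mp : 0 < 4 * mm - W by lra.
  by rewrite (gt_eqF u0) (gt_eqF Wp) (gt_eqF Mp) (gt_eqF N1) (gt_eqF z0) sg0.
Qed.

Lemma cvg_at_left_reflect (f : R -> R) (c l : R) :
  f (c - z) @[z --> 0^'+] --> l -> f x @[x --> c^'-] --> l.
Proof.
move=> /cvgrPdist_lt H; apply/cvgrPdist_lt => e e0.
have := H e e0; rewrite !near_withinE => -[r /= r0 rH].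
exists r => //= x /= xr xc.
have := rH (c - x); rewrite /= sub0r normrN subKr; apply; last by rewrite subr_gt0.
exact: xr.
Qed.

Lemma cvg_at_right_shift (f : R -> R) (c l : R) :
  f (c + z) @[z --> 0^'+] --> l -> f x @[x --> c^'+] --> l.
Proof.
move=> /cvgrPdist_lt H; apply/cvgrPdist_lt => e e0.
have := H e e0; rewrite !near_withinE => -[r /= r0 rH].
exists r => //= x /= xr xc.
have := rH (x - c); rewrite /= sub0r normrN (addrC c) subrK; apply; last by rewrite subr_gt0.
by rewrite distrC.
Qed.

Definition rhs_slope (W v : R) :=
  (Sf W - v) * (v * (v - Hd W) - (1 - eps - W - v) * ((1 + d) * v - d)
     - mm * (Hf W - v * W)) + N * eps * ((1 + d) * v - d) - N * v * (Hf W - v * W).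

Lemma rhs_at_vacuum W v :
  rhs W v = - ((s0 - v) * eps * ((1 + d) * v - d)) + W * rhs_slope W v.
Proof. by rewrite /rhs /rhs_slope /Sf /Hf /Hd; ring. Qed.

(** At [W = 0] the sign of the linear part is the opposite of the one at the
    node: a solution in the strip has to tend to [v0]. *)
Lemma vacuum_limit (v : R -> R) : (forall W, v2 <= v W <= v0) ->
  (forall W, 0 < W < ws -> is_derive W 1 v (slope W (v W))) ->
  v W @[W --> 0^'+] --> v0.
Proof.
move=> vb vd.
have v20 := v2_gt0; have v01 := v0_lt1; have v00 := v0_gt0.
have ws0 := ws_gt0; have wl := ws_lt; have W14 := W1_lt.
have m4 := mm4_gt; have W10 := W1_gt0; have e0 := eps_gt0.
have s5 := s0_ge; have NN := N_gt0; have dd := d0.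
have N1 : 0 < N - 1 by case: N23 => ->; lra.
pose B W u := rhs_slope W u * (u * Pf W)^-1.
pose P0 := (N - 1) * (ws - ws / 2) * (4 * mm - ws).
have P00 : 0 < P0 by rewrite /P0 !mulr_gt0//; lra.
have [M M0 BM] : lipb 0 (ws / 2) v2 v0 B.
  rewrite /B; apply: lipbM; first by rewrite /rhs_slope /Sf /Hd /Hf; lipb_poly.
  apply: (@lipbV _ _ _ _ _ _ (v2 * P0)).
  - exact: mulr_gt0.
  - move=> W u /andP[h1 h2] /andP[h3 h4]; apply: le_trans (ler_norm _).
    apply: ler_pM => //; [exact: ltW|exact: ltW|apply: Pf_left_ge => //; lra].
  - by rewrite /Pf; lipb_poly.
pose e z := v z - v0.
pose k z := (s0 - v z) * eps * (1 + d) / (v z * Pf z).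
pose h z := z * B z (v z).
pose kk := eps * (1 + d) / (v0 * ((N - 1) * ws * (4 * mm))).
suff : e z @[z --> 0^'+] --> 0.
  move=> H; have : e z + v0 @[z --> 0^'+] --> 0 + v0 by apply: cvgD => //; exact: cvg_cst.
  by rewrite add0r; apply: cvg_trans; apply: near_eq_cvg; apply: nearW => z; rewrite /e subrK.
have big : 0 < (N - 1) * ws * (4 * mm).
  by rewrite (mulr_gt0 (mulr_gt0 N1 ws0))//; lra.
apply: (@repelling_cvg0 _ e (fun z => slope z (v z)) k h (ws / 2) kk M (v0 - v2)) => //.
- by rewrite divr_gt0.
- have a1 : 0 < eps * (1 + d) by rewrite (mulr_gt0 e0)//; lra.
  exact: (divr_gt0 a1 (mulr_gt0 v00 big)).
- by rewrite subr_ge0 ltW// v2_lt.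
- move=> z /andP[z0 z1].
  have zz : 0 < z < ws by rewrite z0 /=; lra.
  have := is_deriveB (vd _ zz) (is_derive_cst v0 z 1).
  by rewrite subr0.
- move=> z /andP[z0 z1]; have /andP[w1 w2] := vb z.
  have vp : 0 < v z by exact: lt_le_trans w1.
  have zw : z < ws by lra.
  have Pz := Pf_gt0 zw.
  rewrite /k /kk; apply: ler_pM.
  + by apply: ltW; rewrite (mulr_gt0 e0)//; lra.
  + by rewrite invr_ge0 ltW// mulr_gt0.
  + rewrite -[X in _ <= X]mulrA ler_peMl//; last by lra.
    by apply: ltW; rewrite (mulr_gt0 e0)//; lra.
  + rewrite lef_pV2 ?posrE; [|exact: mulr_gt0|exact: mulr_gt0].
    apply: ler_pM => //; try exact: ltW.
    by rewrite /Pf; apply: ler_pM; [apply: mulr_ge0; lra|lra|apply: ler_wpM2l; lra|lra].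
- move=> z /andP[z0 z1].
  have [|Bb _] := BM z (v z) _ (vb z); first by rewrite (ltW z0) (ltW z1).
  by rewrite /h normrM (gtr0_norm z0) mulrC ler_wpM2r// ltW.
- move=> z _; have /andP[w1 w2] := vb z.
  by rewrite /e ler_norml; apply/andP; split; lra.
- move=> z /andP[z0 z1]; have /andP[w1 w2] := vb z.
  have vp : 0 < v z by exact: lt_le_trans w1.
  have zw : z < ws by lra.
  have Pz := Pf_gt0 zw.
  rewrite /k /h /B /e /slope rhs_at_vacuum.
  have -> : (1 + d) * v z - d = (1 + d) * (v z - v0) by rewrite mulrBr v0d.
  by field; rewrite (gt_eqF vp) (gt_eqF Pz) (gt_eqF z0).
Qed.

Lemma lipschitz_cvg_right (f : R -> R) (M a b : R) : a < b ->
  (forall x x' : R, a <= x <= b -> a <= x' <= b -> `|f x' - f x| <= M * `|x' - x|) ->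
  f x @[x --> a^'+] --> f a /\ f x @[x --> b^'-] --> f b.
Proof.
move=> ab fM; have := lipschitz_within fM.
by move=> /(continuous_within_itvP _ ab)[_ ? ?].
Qed.

(** In the variable [Y = y / (1 - W) ^ 2] the equation is regular at [W = 1]:
    the orbit reaches the point of collapse, and [Y] is continuous there. *)
Lemma collapse_arc : exists Y : R -> R, [/\ forall W, 0 <= Y W <= Y1,
  forall W, W1 < W < 1 -> 0 < Y W,
  forall W, W1 < W < 1 ->
    is_derive W 1 Y (Y W * (- bar W (Y W) / (W * num W (Y W)))),
  Y W @[W --> W1^'+] --> Y1 & Y W @[W --> 1^'-] --> Y 1].
Proof.
have W10 := W1_gt0; have W14 := W1_lt; have Y10 := Y1_gt0.
have n10 := numW1_gt0.
have W11 : W1 < 1 by lra.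
have gl : lipb W1 1 0 Y1 (fun W Y => - bar W Y / (W * num W Y)).
  apply: lipbM; first by rewrite /bar /num /den /kap /Sf; lipb_poly.
  apply: (@lipbV _ _ _ _ _ _ (W1 * num W1 Y1)).
  - exact: mulr_gt0.
  - move=> W y WW yy; apply: le_trans (ler_norm _).
    have /andP[h1 h2] := WW.
    by apply: ler_pM; [exact: ltW|exact: ltW|by []|exact: num_gt0].
  - by rewrite /num /Sf; lipb_poly.
have fl : lipb W1 1 0 Y1 (fun W Y => Y * (- bar W Y / (W * num W Y))).
  by apply: lipbM => //; exact: lipb_snd.
have [L L0 Lf] := lipb_strip fl.
have YY : 0 <= Y1 <= Y1 by rewrite lexx ltW.
have [||Y [Yb Y0 Ys]] := @ode_segment R (fun W Y => Y * (- bar W Y / (W * num W Y)))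
   W1 1 0 Y1 L Y1 W11 L0 YY Lf.
- by move=> W _; rewrite mul0r.
- move=> W WW; rewrite mulr_ge0_le0 ?(ltW Y10)// mulr_le0_ge0 ?oppr_le0 ?bar_ge0//.
  have /andP[h1 h2] := WW.
  by rewrite invr_ge0; apply: mulr_ge0; [lra|exact: le_trans (ltW n10) (num_gt0 WW YY)].
have Yd W : W1 < W < 1 -> is_derive W 1 Y (Y W * (- bar W (Y W) / (W * num W (Y W)))).
  move=> /[dup] WW /andP[h1 h2].
  apply: (is_derive_quadratic WW) => W' WW'; apply: Ys => //.
  by rewrite !ltW.
have [M M0 fM] := fl.
have lip : forall x x' : R, W1 <= x <= 1 -> W1 <= x' <= 1 ->
  `|Y x' - Y x| <= (M + 2 * (L * (1 + L * (Y1 - 0))) * (1 - W1)) * `|x' - x|.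
  apply: (solves_on_lipschitz _ _ Ys).
    by rewrite mulr_ge0// mulr_ge0// addr_ge0// mulr_ge0// subr0 ltW.
  by move=> x xx; have [] := fM _ _ xx (Yb x).
have [Yr Yl] := lipschitz_cvg_right W11 lip.
exists Y; split => //; last by rewrite -Y0.
move=> W /andP[W1W W_1].
have [K K0 gK] := gl.
pose F W := Y W * expR (K * W).
pose dF W := Y W * (K * expR (K * W)) +
   expR (K * W) * (Y W * (- bar W (Y W) / (W * num W (Y W)))).
have Fd x : W1 < x < 1 -> is_derive x 1 F (dF x).
  move=> xx; apply: is_derive_mul; first exact: Yd.
  have H1 : is_derive x 1 (fun t : R => K * t) K.
    have := is_derive_mul (is_derive_cst K x 1) (is_derive_id x 1).
    by rewrite mulr1 mulr0 addr0.
  have := @is_derive1_comp _ expR (fun t : R => K * t) x _ _ (is_derive_expR _) H1.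
  by rewrite [_ * K]mulrC.
have dF0 x : W1 < x < 1 -> 0 <= dF x.
  move=> /andP[x1 x2]; have xx : W1 <= x <= 1 by rewrite !ltW.
  have /andP[y0 _] := Yb x.
  have -> : dF x = (Y x * expR (K * x)) * (K + (- bar x (Y x) / (x * num x (Y x)))).
    by rewrite /dF; ring.
  rewrite mulr_ge0//; first by rewrite mulr_ge0// expR_ge0.
  have [+ _] := gK x (Y x) xx (Yb x); rewrite ler_norml => /andP[+ _]; lra.
have mono := nondecreasing_open Fd dF0.
have lim : F x @[x --> W1^'+] --> Y1 * expR (K * W1).
  rewrite -Y0; apply: cvgM => //.
  apply: cvg_at_right_filter; apply: (@cvg_comp _ _ _ (fun t : R => K * t) expR).
    by apply: cvgMl_tmp; exact: cvg_id.
  exact: continuous_expR.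
have FW : Y1 * expR (K * W1) <= F W.
  apply: (cvgr_to_le lim); near=> x.
  have h1 : W1 < x by near: x; exact: nbhs_right_gt.
  have h2 : x <= W by near: x; exact: nbhs_right_le.
  exact: mono.
have : 0 < F W by apply: lt_le_trans FW; rewrite mulr_gt0// expR_gt0.
by rewrite pmulr_lgt0// expR_gt0.
Unshelve. all: by end_near. Qed.

(** The derivative of [y] along the orbit.  It involves [v] but not [dv/dW]: the
    function [y] is continuously differentiable also at the sonic point, where
    [v] is only known to be continuous. *)
Definition dorbit (W v y : R) := - (y * ((1 + d) * v - d + mm * W)) / (W * v).

Lemma is_derive_quotient (f g : R -> R) (x l k : R) : g x != 0 ->
  is_derive x 1 f l -> is_derive x 1 g k ->
  is_derive x 1 (fun t => f t / g t) ((l * g x - f x * k) / g x ^+ 2).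
Proof.
move=> g0 fl gk; have H := is_derive_mul fl (is_deriveV g0 gk).
have -> : (l * g x - f x * k) / g x ^+ 2 =
   f x * (- (g x ^- 2) *: k) + (g x)^-1 * l by rewrite /GRing.scale /=; field.
exact: H.
Qed.

Lemma is_derive_Hf (W : R) : is_derive W 1 Hf (Hd W).
Proof.
have H1 : is_derive W 1 (fun t : R => 1 - t) (-1).
  by have := is_deriveB (is_derive_cst (1 : R) W 1) (is_derive_id W 1); rewrite sub0r.
have H2 : is_derive W 1 (fun t : R => eps + t) 1.
  by have := is_deriveD (is_derive_cst eps W 1) (is_derive_id W 1); rewrite add0r.
have := is_derive_mul H1 H2.
by have -> : (1 - W) * 1 + (eps + W) * -1 = Hd W by rewrite /Hd; ring.
Qed.

Lemma is_derive_Sf (W : R) : is_derive W 1 Sf (- N).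
Proof.
have H1 := is_derive_mul (is_derive_cst N W 1) (is_derive_id W 1).
have := is_deriveB (is_derive_cst s0 W 1) H1.
by rewrite mulr1 mulr0 addr0 sub0r.
Qed.

Lemma is_derive_orbit (v : R -> R) (W : R) : W != 0 -> v W != 0 -> Pf W != 0 ->
  Sf W - v W != 0 -> is_derive W 1 v (slope W (v W)) ->
  let y := fun W => (Hf W - v W * W) / (Sf W - v W) in
  is_derive W 1 y (dorbit W (v W) (y W)).
Proof.
move=> W0 vW0 P0 S0 vd /=.
have H1 := is_deriveB (is_derive_Hf W) (is_derive_mul vd (is_derive_id W 1)).
have H2 := is_deriveB (is_derive_Sf W) vd.
have := @is_derive_quotient (fun W => Hf W - v W * W) (fun W => Sf W - v W) W _ _ S0 H1 H2.
suff -> : dorbit W (v W) ((Hf W - v W * W) / (Sf W - v W)) =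
  ((Hd W - (v W * 1 + W * slope W (v W))) * (Sf W - v W)
   - (Hf W - v W * W) * (- N - slope W (v W))) / (Sf W - v W) ^+ 2 by [].
rewrite /dorbit /slope /rhs.
have E : Pf W = Hf W - W * Sf W by rewrite (PfE).
rewrite E in P0 *.
move: (Hf W) (Hd W) (Sf W) P0 S0 => H D S P0 S0.
by field; rewrite P0 S0 W0 vW0.
Qed.

(** * The orbit from the vacuum to the point of collapse *)

(** The three arcs are joined at [ws], where both arcs tend to the node, and at
    [W1], where both arcs take the value [v0].  The orbit starts at the vacuum
    [W = 0] and ends at the point of collapse [W = 1]; the last two limits
    describe the self-similar variable and the sound speed there. *)
Lemma orbit_exists : exists (v y : R -> R) (k1 y2 : R),
  [/\ forall W, 0 < W < 1 -> [/\ 0 < v W, 0 < y W,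
         v W * (W - y W) = Hf W - y W * Sf W,
         {for W, continuous v} & is_derive W 1 y (dorbit W (v W) (y W))],
      v W @[W --> 0^'+] --> v0,
      exists y0 : R, y W @[W --> 0^'+] --> y0,
      (v W - lam * (1 - W)) / (v W * (1 - W)) @[W --> 1^'-] --> k1 &
      y W / (1 - W) ^+ 2 @[W --> 1^'-] --> y2].
Proof.
have [vs [cc [vsb qE cc0]]] := node_root.
have [vL [vLb vLd]] := left_arc.
have [vR [vRb vRd vR1]] := right_arc.
have [Y [Yb Yp Yd Y_W1 Y_1]] := collapse_arc.
have ws0 := ws_gt0; have wsW := ws_lt; have W14 := W1_lt.
have ws4 := ws4; have W10 := W1_gt0; have m4 := mm4_gt.
have v20 := v2_gt0; have v01 := v0_lt1; have v00 := v0_gt0.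
have n10 := numW1_gt0.
have y1l := y1_lt.
have dd := d0; have mg := mm_ge.
have W1l1 : W1 < 1 by clear -W14 N23 d0; lra.
have wsl1 : ws < 1 by exact: lt_trans W1l1.
have N1 : 0 < N - 1 by clear -N23 N23 d0; case: N23 => ->; lra.
have m41 : 1 < 4 * mm by clear -dd mg N23 d0; lra.
have vL0 : vL W @[W --> 0^'+] --> v0 by exact: (vacuum_limit vLb vLd).
have vLs : vL W @[W --> ws^'-] --> vs.
  apply: cvg_at_left_reflect.
  have -> : (fun z => vL (ws - z)) = (fun z => vL (ws + -1 * z)).
    by apply/funext => z; rewrite mulN1r.
  have w20 : 0 < ws / 2 by rewrite divr_gt0.
  apply: (@node_limit vs cc (-1) (ws / 2) vL) => //; first by right.
    by move=> z /andP[? ?]; apply/andP; split; lra.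
  by move=> z /andP[? ?]; apply: vLd; apply/andP; split; lra.
have vRs : vR W @[W --> ws^'+] --> vs.
  apply: cvg_at_right_shift.
  have -> : (fun z => vR (ws + z)) = (fun z => vR (ws + 1 * z)).
    by apply/funext => z; rewrite mul1r.
  have w20 : 0 < W1 - ws by rewrite subr_gt0.
  apply: (@node_limit vs cc 1 (W1 - ws) vR) => //; first by left.
    by move=> z /andP[? ?]; apply/andP; split; lra.
  by move=> z /andP[? ?]; apply: vRd; apply/andP; split; lra.
pose v3 W := (1 - W) * num W (Y W) / den W (Y W).
have W1_in W : W1 < W < 1 -> W1 <= W <= 1 by move=> /andP[? ?]; rewrite !ltW.
have num_p W : W1 < W < 1 -> 0 < num W (Y W).
  by move=> /W1_in H; apply: lt_le_trans n10 _; exact: num_gt0.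
have den_p W : W1 < W < 1 -> 0 < den W (Y W).
  by move=> /W1_in H; have := den_ge H (Yb W); apply: lt_le_trans; lra.
have num_cont (F : set_system R) (FF : Filter F) (W y : R) (g f : R -> R) :
    g x @[x --> F] --> W -> f x @[x --> F] --> y -> num (g x) (f x) @[x --> F] --> num W y.
  move=> gc fc; rewrite /num /Sf.
  apply: cvgB; first by apply: cvgD => //; exact: cvg_cst.
  apply: cvgM => //; apply: cvgM; first by apply: cvgB => //; exact: cvg_cst.
  by apply: cvgB; [exact: cvg_cst|exact: cvgMl_tmp].
have den_cont (F : set_system R) (FF : Filter F) (W y : R) (g f : R -> R) :
    g x @[x --> F] --> W -> f x @[x --> F] --> y -> den (g x) (f x) @[x --> F] --> den W y.
  move=> gc fc; rewrite /den; apply: cvgB => //; apply: cvgM => //.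
  have H : (fun x => 1 - g x) x @[x --> F] --> 1 - W by apply: cvgB => //; exact: cvg_cst.
  by have := cvgM H H; rewrite -expr2; apply.
have v3_cont (F : set_system R) (FF : Filter F) (W y : R) :
    x @[x --> F] --> W -> Y x @[x --> F] --> y -> den W y != 0 ->
    v3 x @[x --> F] --> (1 - W) * num W y / den W y.
  move=> xc Yc den0; apply: cvgM; last by apply: cvgV => //; exact: den_cont.
  by apply: cvgM; [apply: cvgB => //; exact: cvg_cst|exact: num_cont].
have right_id (a : R) : x @[x --> a^'+] --> a by apply: cvg_at_right_filter; exact: cvg_id.
have left_id (a : R) : x @[x --> a^'-] --> a by apply: cvg_at_left_filter; exact: cvg_id.
have Y1b : 0 <= Y1 <= Y1 by rewrite lexx ltW// Y1_gt0.
have denW1 : den W1 Y1 = W1 - y1 by rewrite /den Y1_eq.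
have v3W1 : v3 W @[W --> W1^'+] --> v0.
  have -> : v0 = (1 - W1) * num W1 Y1 / den W1 Y1.
    by rewrite (numW1) denW1 mulfK// gt_eqF// subr_gt0.
  by apply: v3_cont => //; rewrite denW1 gt_eqF// subr_gt0.
have den1 : den 1 (Y 1) = 1 by rewrite /den subrr expr0n mul0r subr0.
have v31 : v3 W @[W --> 1^'-] --> 0.
  have -> : 0 = (1 - 1) * num 1 (Y 1) / den 1 (Y 1) by rewrite subrr !mul0r.
  by apply: v3_cont => //; rewrite den1 oner_eq0.
have v3c (W : R) : W1 < W < 1 -> {for W, continuous v3}.
  move=> WW; apply: v3_cont; [exact: cvg_id| |by rewrite gt_eqF// den_p].
  exact: is_derive_continuous (Yd _ WW).
have cL : continuous_onto vL 0 ws v0 vs.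
  by split => // W WW; exact: is_derive_continuous (vLd _ WW).
have cR : continuous_onto vR ws W1 vs v0.
  by split => // W WW; exact: is_derive_continuous (vRd _ WW).
have c3 : continuous_onto v3 W1 1 v0 0 by [].
pose v := glue ws vs vL (glue W1 v0 vR v3).
have cv : continuous_onto v 0 1 v0 0.
  apply: glue_continuous_onto cL _; first by rewrite ws0.
  by apply: glue_continuous_onto cR c3; rewrite wsW.
have [vc v_0 v_1] := cv.
have v_left W : W < ws -> v W = vL W by rewrite /v /glue => ->.
have v_ws : v ws = vs by rewrite /v /glue ltxx.
have v_mid W : ws < W < W1 -> v W = vR W.
  by move=> /andP[h1 h2]; rewrite /v /glue ltNge (ltW h1) h1 h2.
have v_W1 : v W1 = v0 by rewrite /v /glue ltNge (ltW wsW) wsW /= ltxx.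
have v_right W : W1 < W -> v W = v3 W.
  move=> h; have h' : ws < W by exact: lt_trans h.
  by rewrite /v /glue ltNge (ltW h') h' /= ltNge (ltW h) h.
have v_strip (W : R) : W <= W1 -> v2 <= v W <= v0.
  rewrite le_eqVlt => /predU1P[->|WW]; first by rewrite v_W1 lexx ltW// v2_lt.
  have [h|h|->] := ltgtP W ws; [by rewrite v_left|by rewrite v_mid ?h|by rewrite v_ws].
pose y W := (Hf W - v W * W) / (Sf W - v W).
have y_right (W : R) : W1 < W < 1 -> [/\ 0 < v W, 0 < Sf W - v W & y W = (1 - W) ^+ 2 * Y W].
  move=> /[dup] WW /andP[h1 h2]; have np := num_p _ WW; have dp := den_p _ WW.
  have vE : v W * den W (Y W) = (1 - W) * num W (Y W).
    by rewrite v_right// /v3 divfK// gt_eqF.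
  have w1 : 0 < 1 - W by rewrite subr_gt0.
  have HSY : (1 - W) * num W (Y W) = Hf W - Sf W * ((1 - W) ^+ 2 * Y W).
    by rewrite /num /Hf; ring.
  have dE : den W (Y W) = W - (1 - W) ^+ 2 * Y W by [].
  have HS : Hf W < W * Sf W.
    rewrite -subr_lt0 (PfE) /Pf -mulrA.
    rewrite (pmulr_rlt0 _ N1) nmulr_rlt0 ?subr_lt0 ?(lt_trans wsW)//.
    by rewrite subr_gt0 (lt_trans h2).
  have vp : 0 < v W by rewrite v_right// /v3 !mulr_gt0// invr_gt0.
  have sp : 0 < Sf W - v W.
    rewrite -(pmulr_lgt0 _ dp) mulrBl vE HSY dE; clear -HS N23 d0; lra.
  split => //; rewrite /y.
  have s0n : Sf W - v W != 0 by rewrite gt_eqF.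
  apply: (canLR (mulfK s0n)).
  have : v W * (W - (1 - W) ^+ 2 * Y W) = Hf W - Sf W * ((1 - W) ^+ 2 * Y W).
    by rewrite -HSY -vE.
  by rewrite mulrBr => E; rewrite mulrBr; clear -E N23 d0; lra.
have pos (W : R) : 0 < W < 1 -> [/\ 0 < v W, 0 < Sf W - v W & 0 < y W].
  move=> /andP[h1 h2]; have [WW|WW] := leP W W1; last first.
    have WWW : W1 < W < 1 by rewrite WW.
    have [a b c] := y_right _ WWW; split => //; rewrite c.
    by rewrite mulr_gt0 ?exprn_gt0 ?subr_gt0// Yp.
  have /andP[b1 b2] := v_strip _ WW.
  have S5 : 5 <= Sf W by apply: Sf_ge => //; exact: ltW.
  have sp : 0 < Sf W - v W by clear -S5 b2 v01 N23 d0; lra.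
  have WW' : 0 <= W <= W1 by rewrite ltW.
  split; [exact: lt_le_trans b1|exact: sp|].
  rewrite /y divr_gt0//; have := Q_ge WW' b2; have := eps_gt0; clear -N23 d0; lra.
have yc (W : R) : 0 < W < 1 -> {for W, continuous y}.
  move=> WW; have [a b c] := pos _ WW.
  have Sc : Sf x @[x --> W] --> Sf W.
    by exact: is_derive_continuous (is_derive_Sf W).
  apply: cvgM.
    apply: cvgB; first by exact: is_derive_continuous (is_derive_Hf W).
    by apply: cvgM; [exact: vc|exact: cvg_id].
  apply: cvgV; first by rewrite gt_eqF.
  by apply: cvgB => //; exact: vc.
have dyc (W : R) : 0 < W < 1 -> {for W, continuous (fun W => dorbit W (v W) (y W))}.
  move=> /[dup] WW /andP[h1 h2]; have [a b c] := pos _ WW.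
  rewrite /dorbit; apply: cvgM; last first.
    apply: cvgV; first by rewrite gt_eqF// mulr_gt0.
    by apply: cvgM; [exact: cvg_id|exact: vc].
  apply: cvgN; apply: cvgM; first exact: yc.
  apply: cvgD; last by apply: cvgMl_tmp; exact: cvg_id.
  by apply: cvgB; [apply: cvgMl_tmp; exact: vc|exact: cvg_cst].
have near_eq_derive (f g : R -> R) (W l : R) : (\forall x \near W, g x = f x) ->
    is_derive W 1 f l -> is_derive W 1 g l.
  by move=> fg fl; apply: (near_eq_is_derive _ fl); apply: filterS fg => x ->.
have yd_off (W : R) : 0 < W < 1 -> W != ws -> W != W1 -> is_derive W 1 y (dorbit W (v W) (y W)).
  move=> /[dup] WW /andP[h1 h2] nws nW1; have [a b c] := pos _ WW.
  have W0 : W != 0 by rewrite gt_eqF.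
  have v0' : v W != 0 by rewrite gt_eqF.
  have S0 : Sf W - v W != 0 by rewrite gt_eqF.
  have [hl|hr|E] := ltgtP W W1; last by rewrite E eqxx in nW1.
  - have [l1|l2|E] := ltgtP W ws; last by rewrite E eqxx in nws.
    + apply: is_derive_orbit => //; first by rewrite gt_eqF// Pf_gt0.
      apply: (near_eq_derive vL); last by rewrite v_left//; apply: vLd; rewrite h1.
      by near=> x; apply: v_left; near: x; exact: lt_nbhsl.
    + apply: is_derive_orbit => //; first by rewrite lt_eqF// Pf_lt0// ltW.
      apply: (near_eq_derive vR); last by rewrite v_mid ?l2//; apply: vRd; rewrite l2.
      near=> x; apply: v_mid; apply/andP; split; near: x.
        exact: lt_nbhsr.
      exact: lt_nbhsl.
  - have WWW : W1 < W < 1 by rewrite hr.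
    have [_ _ yE] := y_right _ WWW.
    pose g x := (1 - x) ^+ 2 * Y x.
    have H1 : is_derive W 1 (fun t : R => 1 - t) (-1).
      by have := is_deriveB (is_derive_cst (1 : R) W 1) (is_derive_id W 1); rewrite sub0r.
    have H2 := is_derive_mul (is_derive_sqr H1) (Yd _ WWW).
    apply: (near_eq_derive g).
      near=> x; have x1 : W1 < x < 1.
        by apply/andP; split; near: x; [exact: lt_nbhsr|exact: lt_nbhsl].
      by have [_ _] := y_right _ x1.
    suff -> : dorbit W (v W) (y W) = (1 - W) ^+ 2 *
      (Y W * (- bar W (Y W) / (W * num W (Y W)))) + Y W * (2 * (1 - W) * -1) by [].
    have np := num_p _ WWW; have dp := den_p _ WWW.
    have w1 : 1 - W != 0 by rewrite gt_eqF// subr_gt0.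
    have n0 : num W (Y W) != 0 by rewrite gt_eqF.
    have e0 : den W (Y W) != 0 by rewrite gt_eqF.
    rewrite /dorbit yE v_right// /v3 /bar.
    have mE : mm * W = d * W + 2 * lam * W + (N * d - d - 2 * eps) * W.
      by rewrite /mm /lam; ring.
    have kE : 2 * W * kap W (Y W) = (2 * W * num W (Y W) - 2 * lam * W * den W (Y W)) / (1 - W).
      by rewrite /kap /num /den /lam; field.
    have epE : N * d - d - 2 * eps = 0 by rewrite /eps; field.
    rewrite mE kE epE mul0r addr0.
    move: (num W (Y W)) (den W (Y W)) n0 e0 => nn de n0 e0.
    by field; rewrite n0 e0 W0 w1.
(* at the junctions the derivative is recovered as the limit of nearby ones *)
have yd (W : R) : 0 < W < 1 -> is_derive W 1 y (dorbit W (v W) (y W)).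
  have ws_in : 0 < ws < 1 by rewrite ws0.
  have W1_in1 : 0 < W1 < 1 by rewrite W10.
  move=> WW; have [->|nws] := eqVneq W ws.
    apply: (@is_derive_of_limit _ y (fun W => dorbit W (v W) (y W)) 0 W1).
    - by rewrite ws0.
    - move=> x /andP[x0 x1] xs; apply: yd_off; [|exact: xs|by rewrite lt_eqF].
      by rewrite x0 (lt_trans x1).
    - exact: yc.
    - exact: dyc.
  have [->|nW1] := eqVneq W W1; last exact: yd_off.
  apply: (@is_derive_of_limit _ y (fun W => dorbit W (v W) (y W)) ws 1).
  - by rewrite wsW.
  - move=> x /andP[x0 x1] xs; apply: yd_off; [|by rewrite gt_eqF|exact: xs].
    by rewrite x1 (lt_trans ws0).
  - exact: yc.
  - exact: dyc.
exists v, y, (kap 1 (Y 1) / num 1 (Y 1)), (Y 1); split.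
- move=> W WW; have [a b c] := pos _ WW; split; [exact: a|exact: c| | |].
  + rewrite /y; have S0 : Sf W - v W != 0 by rewrite gt_eqF.
    by field.
  + exact: vc.
  + exact: yd.
- exact: v_0.
- exists ((Hf 0 - v0 * 0) / (Sf 0 - v0)); apply: cvgM.
    apply: cvgB; last by apply: cvgM.
    by apply: cvg_at_right_filter; exact: is_derive_continuous (is_derive_Hf 0).
  apply: cvgV; first by have S5 := Sf_ge (@ler01 R); rewrite gt_eqF//; clear -S5 v01 N23 d0; lra.
  apply: cvgB => //.
  by apply: cvg_at_right_filter; exact: is_derive_continuous (is_derive_Sf 0).
- have num1 : num 1 (Y 1) = lam by rewrite /num subrr !mul0r subr0 /lam addrC.
  have lam0 : lam != 0 by have e0 := eps_gt0; rewrite gt_eqF// /lam; clear -e0 N23 d0; lra.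
  apply: (@cvg_trans _ (kap x (Y x) / num x (Y x) @[x --> 1^'-])).
    apply: near_eq_cvg; near=> W.
    have WWW : W1 < W < 1.
      by apply/andP; split; near: W; [exact: nbhs_left_gt|exact: nbhs_left_lt].
    have np := num_p _ WWW; have dp := den_p _ WWW.
    have w1 : 1 - W != 0 by rewrite gt_eqF// subr_gt0; case/andP: WWW.
    have n0 : num W (Y W) != 0 by rewrite gt_eqF.
    have e0 : den W (Y W) != 0 by rewrite gt_eqF.
    have [WW1 _] := andP WWW.
    rewrite v_right// /v3.
    have kE : kap W (Y W) = (num W (Y W) - lam * den W (Y W)) / (1 - W).
      by rewrite /kap /num /den /lam; field.
    rewrite kE; move: (num W (Y W)) (den W (Y W)) n0 e0 => nn de n0 e0.
    by field; rewrite n0 e0 w1.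
  apply: cvgM; last by apply: cvgV; [rewrite num1|exact: num_cont].
  rewrite /kap /Sf; apply: cvgD.
    apply: cvgB; first exact: cvg_cst.
    by apply: cvgM => //; apply: cvgB; [exact: cvg_cst|exact: cvgMl_tmp].
  apply: cvgM => //; apply: cvgMl_tmp.
  by apply: cvgB => //; exact: cvg_cst.
- apply: (@cvg_trans _ (Y x @[x --> 1^'-])) => //.
  apply: near_eq_cvg; near=> W.
  have WWW : W1 < W < 1.
    by apply/andP; split; near: W; [exact: nbhs_left_gt|exact: nbhs_left_lt].
  have [_ _ ->] := y_right _ WWW.
  by rewrite mulrC mulrA mulVf ?mul1r// expf_neq0// gt_eqF// subr_gt0; case/andP: WWW.
Unshelve. all: by end_near. Qed.

(** * The profiles *)

Lemma powR_cvg (T : Type) (F : set_system T) (FF : Filter F) (f : T -> R) (l b : R) :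
  0 < b -> 0 <= l -> (\forall x \near F, 0 < f x) -> f x @[x --> F] --> l ->
  f x `^ b @[x --> F] --> l `^ b.
Proof.
move=> b0; rewrite le_eqVlt => /predU1P[<-|l0] fp fl.
  rewrite powR0 ?gt_eqF//.
  apply: (@cvg_comp _ _ _ f (fun t => t `^ b) _ (0^'+)); last exact: powR_cvg0.
  move/cvgrPdist_lt : fl => fl.
  move=> A /=; rewrite /at_right /within /= => -[e /= e0 eA].
  have := fl e e0; apply: filterS2 fp => x fx xe.
  by apply: eA => //=.
apply: (@cvg_comp _ _ _ f (fun t => t `^ b) _ (nbhs l)) => //.
exact: is_derive_continuous (is_derive1_powR b l0).
Qed.

(** The sum of the dimension and the exponent of the density. *)
Definition N0 := (1 + d) * s0 - d.
Definition kappa := N0 - N.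

(** Through [s0], the exponent of the density is so large that the energy density
    [r ^ (kappa - 2 (lam - 1))] is bounded at the centre. *)
Lemma N0_gt : 2 * eps + N + 1 < N0.
Proof.
rewrite /N0; have := s0_ge; have := eps_le; have := d0 => dd e s.
have : 0 <= d * (s0 - N - 5) by rewrite mulr_ge0 ?(ltW dd)//; lra.
have : 0 <= d * N by rewrite mulr_ge0 ?(ltW dd)// ltW// (N_gt0).
lra.
Qed.

Lemma lam_gt1 : 1 < lam. Proof. by rewrite /lam ltrDl eps_gt0. Qed.

(** Along the orbit [dx/dW = - lam x / v], so [x = - (1 - W) exp (zeta W)] with
    [zeta' = 1 / (1 - W) - lam / v], whose singularities at [W = 1] cancel.
    Inverting this increasing function of [W] gives [W = om x], hence [V] and
    [Z].  The density comes from a first integral, conservation of entropy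
    combined with conservation of mass: the profile is
    [W ^ (N0 - 1) (Z / x ^ 2) ^ (N0 / d)]. *)
Lemma profile_exists : exists (x0 : R) (V Z Rf dV dZ dR : R -> R),
  [/\ x0 < 0,
    forall x, x0 < x < 0 -> [/\ [/\ -1 < V x < 0, 0 < Z x & 0 < Rf x],
      [/\ is_derive x 1 V (dV x), is_derive x 1 Z (dZ x) & is_derive x 1 Rf (dR x)],
      [/\ {for x, continuous dV}, {for x, continuous dZ} & {for x, continuous dR}] &
      [/\ (1 + V x) * (- lam * x * dR x)
            + Rf x * (- lam * x * dV x + (kappa + N) * V x) = 0,
          (1 + V x) * (- lam * x * dZ x)
            + Z x * (d * (- lam * x * dV x) + 2 * lam + mm * V x) = 0 &
          (1 + V x) * (- lam * x * dV x) + (- lam * x * dZ x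
            + Z x * (- lam * x * dR x) / Rf x) / (1 + d)
            + V x * (lam + V x) + (kappa + 2) * Z x / (1 + d) = 0]],
    [/\ V x @[x --> x0^'+] --> (-1 : R), Z x @[x --> x0^'+] --> 0 &
        Rf x @[x --> x0^'+] --> 0] &
    exists lV lZ lR : R, [/\ V x / x @[x --> 0^'-] --> lV,
      Z x / x ^+ 2 @[x --> 0^'-] --> lZ & Rf x @[x --> 0^'-] --> lR]].
Proof.
have [v [y [k1 [y2 [orb v_0 [y0 y_0] k_1 y_1]]]]] := orbit_exists.
have v00 := v0_gt0; have l1 := lam_gt1; have dd := d0; have N0g := N0_gt.
have e0 := eps_gt0; have NN := N_gt0.
have right_id (a : R) : x @[x --> a^'+] --> a by apply: cvg_at_right_filter; exact: cvg_id.
have left_id (a : R) : x @[x --> a^'-] --> a by apply: cvg_at_left_filter; exact: cvg_id.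
pose k W := (v W - lam * (1 - W)) / (v W * (1 - W)).
have ck : continuous_onto k 0 1 ((v0 - lam * (1 - 0)) / (v0 * (1 - 0))) k1.
  split => //.
    move=> W /[dup] WW /andP[h1 h2]; have [vp _ _ vc _] := orb _ WW.
    apply: cvgM.
      apply: cvgB => //; apply: cvgMl_tmp.
      by apply: cvgB; [exact: cvg_cst|exact: cvg_id].
    apply: cvgV; first by rewrite gt_eqF// mulr_gt0// subr_gt0.
    by apply: cvgM => //; apply: cvgB; [exact: cvg_cst|exact: cvg_id].
  apply: cvgM.
    apply: cvgB => //; apply: cvgMl_tmp.
    by apply: cvgB => //; exact: cvg_cst.
  apply: cvgV; first by rewrite subr0 mulr1 gt_eqF.
  by apply: cvgM => //; apply: cvgB => //; exact: cvg_cst.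
(* starting at -1 makes the antiderivative differentiable at 0 *)
have [zeta zd] := antiderivative (-1) (extend_continuous ltr01 ck).
have zc (x : R) : -1 < x -> {for x, continuous zeta}.
  by move=> h; exact: is_derive_continuous (zd _ h).
have zd' (W : R) : 0 < W < 1 -> is_derive W 1 zeta (k W).
  move=> /andP[h1 h2]; have := zd W (lt_trans (_ : -1 < 0) h1).
  by rewrite /extend leNgt h1 h2 /=; apply; rewrite ltrN10.
pose X W := - ((1 - W) * expR (zeta W)).
have Xd (W : R) : 0 < W < 1 -> is_derive W 1 X (lam * (1 - W) * expR (zeta W) / v W).
  move=> /[dup] WW /andP[h1 h2]; have [vp _ _ _ _] := orb _ WW.
  have H1 : is_derive W 1 (fun t : R => 1 - t) (-1).
    by have := is_deriveB (is_derive_cst (1 : R) W 1) (is_derive_id W 1); rewrite sub0r.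
  have H2 := @is_derive1_comp _ expR zeta W _ _ (is_derive_expR _) (zd' _ WW).
  have := is_deriveN (is_derive_mul H1 H2).
  suff -> : lam * (1 - W) * expR (zeta W) / v W =
    - ((1 - W) * (expR (zeta W) * k W) + expR (zeta W) * -1) by [].
  rewrite /k; field; rewrite (gt_eqF vp) /=.
  by rewrite gt_eqF// subr_gt0.
have Xc (W : R) : 0 <= W <= 1 -> {for W, continuous X}.
  move=> /andP[h1 h2]; apply: cvgN; apply: cvgM.
    by apply: cvgB; [exact: cvg_cst|exact: cvg_id].
  apply: (@cvg_comp _ _ _ zeta expR); last exact: continuous_expR.
  by apply: zc; apply: lt_le_trans h1; rewrite ltrN10.
have Xmono (a b : R) : 0 <= a -> a < b -> b <= 1 -> X a < X b.
  move=> a0 ab b1; have [||z /andP[z1 z2] E] := @mvt _ X (fun W => lam * (1 - W) * expR (zeta W) / v W) a b ab.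
  - by move=> x /andP[h1 h2]; apply: Xd; rewrite (le_lt_trans a0)//= (lt_le_trans h2).
  - by move=> x /andP[h1 h2]; apply: Xc; rewrite (le_trans a0)//= (le_trans h2).
  have zz : 0 < z < 1 by rewrite (le_lt_trans a0)//= (lt_le_trans z2).
  have [vp _ _ _ _] := orb _ zz; have /andP[_ z_1] := zz.
  rewrite -subr_gt0 E mulr_gt0 ?subr_gt0// divr_gt0// mulr_gt0 ?expR_gt0//.
  by rewrite mulr_gt0 ?subr_gt0// (lt_trans ltr01).
have X1 : X 1 = 0 by rewrite /X subrr mul0r oppr0.
pose x0 := X 0.
have x00 : x0 < 0 by rewrite -X1 Xmono.
have X_in (W : R) : 0 < W < 1 -> x0 < X W < 0.
  move=> /andP[h1 h2]; apply/andP; split; first by apply: Xmono => //; exact: ltW.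
  by rewrite -X1; apply: Xmono => //; exact: ltW.
have surj (x : R) : exists W : R, x0 < x < 0 -> 0 < W < 1 /\ X W = x.
  have [/andP[h1 h2]|//] := boolP (x0 < x < 0); last by exists 0.
  have Xw : {within `[0, 1], continuous X}.
    by apply: continuous_in_subspaceT => z; rewrite inE /= in_itv /=; exact: Xc.
  have [|W] := @IVT R X 0 1 x ler01 Xw.
    by rewrite X1 ge_min le_max (ltW h1) (ltW h2) orbT.
  rewrite in_itv /= => /andP[w1 w2] XW; exists W => _; split => //.
  rewrite !lt_neqAle w1 w2 !andbT; apply/andP; split; apply/eqP => E.
    by move: h1; rewrite -XW -E ltxx.
  by move: h2; rewrite -XW E X1 ltxx.
have [om omP] := choice surj.
have om_in (x : R) : x0 < x < 0 -> 0 < om x < 1 by move=> /omP[].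
have Xom (x : R) : x0 < x < 0 -> X (om x) = x by move=> /omP[].
have om_mono (x W : R) : x0 < x < 0 -> 0 < W < 1 -> x < X W -> om x < W.
  move=> xx WW xW; rewrite ltNge; apply/negP; rewrite le_eqVlt => /predU1P[E|H].
    by move: xW; rewrite E Xom// ltxx.
  have /andP[w1 _] := WW; have /andP[_ p2] := om_in _ xx.
  by have := Xmono _ _ (ltW w1) H (ltW p2); rewrite Xom// ltNge ltW.
have om_mono' (x W : R) : x0 < x < 0 -> 0 < W < 1 -> X W < x -> W < om x.
  move=> xx WW xW; rewrite ltNge; apply/negP; rewrite le_eqVlt => /predU1P[E|H].
    by move: xW; rewrite -E Xom// ltxx.
  have /andP[_ w2] := WW; have /andP[p1 _] := om_in _ xx.
  by have := Xmono _ _ (ltW p1) H (ltW w2); rewrite Xom// ltNge ltW.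
have omX (W : R) : 0 < W < 1 -> om (X W) = W.
  move=> WW; have xx := X_in _ WW; have oo := om_in _ xx.
  have [h|h|//] := ltgtP (om (X W)) W.
    have /andP[w1 w2] := WW; have /andP[p1 p2] := oo.
    by have := Xmono _ _ (ltW p1) h (ltW w2); rewrite Xom// ltxx.
  have /andP[w1 w2] := WW; have /andP[p1 p2] := oo.
  by have := Xmono _ _ (ltW w1) h (ltW p2); rewrite Xom// ltxx.
have xE (x : R) : x0 < x < 0 -> x = - ((1 - om x) * expR (zeta (om x))).
  by move=> xx; rewrite -{1}(Xom _ xx).
have omd (x : R) : x0 < x < 0 -> is_derive x 1 om (- v (om x) / (lam * x)).
  move=> xx; have oo := om_in _ xx; have /andP[p1 p2] := oo.
  have [vp _ _ _ _] := orb _ oo.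
  have lp : lam * (1 - om x) * expR (zeta (om x)) / v (om x) != 0.
    by rewrite gt_eqF// divr_gt0// !mulr_gt0 ?expR_gt0 ?subr_gt0// (lt_trans ltr01).
  have nearin : \forall W \near om x, 0 < W < 1.
    near=> W; apply/andP; split; near: W; [exact: lt_nbhsr|exact: lt_nbhsl].
  have := @is_derive_inverse R X om _ (om x) _ _ (Xd _ oo) lp.
  rewrite Xom// (_ : - v (om x) / (lam * x) = (lam * (1 - om x) * expR (zeta (om x)) / v (om x))^-1).
    apply; first by apply: filterS nearin => W; exact: omX.
    apply: filterS nearin => W /andP[h1 h2]; apply: Xc; by rewrite !ltW.
  have := lp; have hx := xE _ xx; move: hx.
  move: (om x) (expR (zeta (om x))) (v (om x)) => ww ee vv hx; rewrite hx.
  rewrite mulf_eq0 invr_eq0 negb_or => /andP[+ vn].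
  rewrite !mulf_eq0 !negb_or => /andP[/andP[ln wn] en].
  by field; rewrite ln wn en vn.
have omc (x : R) : x0 < x < 0 -> {for x, continuous om}.
  by move=> xx; exact: is_derive_continuous (omd _ xx).
have om0 : om x @[x --> x0^'+] --> 0.
  apply/cvgrPdist_lt => e e0'.
  pose W := Num.min e (2^-1).
  have WW : 0 < W < 1.
    by rewrite /W lt_min e0' invr_gt0 ltr0n /= gt_min (_ : 2^-1 < 1) ?orbT// invf_lt1// ltr1n.
  near=> x.
  have xx : x0 < x < 0.
    by apply/andP; split; near: x; [exact: nbhs_right_gt|exact: nbhs_right_lt].
  have xW : x < X W by near: x; apply: nbhs_right_lt; have /andP[] := X_in _ WW.
  have /andP[p1 _] := om_in _ xx.
  rewrite sub0r normrN gtr0_norm// (lt_le_trans (om_mono _ _ xx WW xW))//.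
  by rewrite /W ge_min lexx.
have om1 : om x @[x --> 0^'-] --> (1 : R).
  apply/cvgrPdist_lt => e e0'.
  pose W := Num.max (1 - e) (2^-1).
  have WW : 0 < W < 1.
    by rewrite /W lt_max gt_max invr_gt0 ltr0n orbT /= gtrBl e0' invf_lt1// ltr1n.
  near=> x.
  have xx : x0 < x < 0.
    by apply/andP; split; near: x; [exact: nbhs_left_gt|exact: nbhs_left_lt].
  have xW : X W < x by near: x; apply: nbhs_left_gt; have /andP[] := X_in _ WW.
  have /andP[_ p1] := om_in _ xx.
  rewrite gtr0_norm ?subr_gt0// ltrBlDr -ltrBlDl.
  by apply: le_lt_trans (om_mono' _ _ xx WW xW); rewrite /W le_max lexx.
have om1' : om x @[x --> 0^'-] --> (1 : R)^'-.
  move=> A [e /= e0' eA]; suff : \forall x \near (0 : R)^'-, A (om x) by [].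
  move/cvgrPdist_lt : om1 => /(_ e e0') H.
  near=> x; apply: eA; first by near: x.
  have xx : x0 < x < 0.
    by apply/andP; split; near: x; [exact: nbhs_left_gt|exact: nbhs_left_lt].
  by have /andP[] := om_in _ xx.
have om0' : om x @[x --> x0^'+] --> 0^'+.
  move=> A [e /= e0' eA]; suff : \forall x \near x0^'+, A (om x) by [].
  move/cvgrPdist_lt : om0 => /(_ e e0') H.
  near=> x; apply: eA; first by near: x.
  have xx : x0 < x < 0.
    by apply/andP; split; near: x; [exact: nbhs_right_gt|exact: nbhs_right_lt].
  by have /andP[] := om_in _ xx.
pose Z x := om x * y (om x).
pose a := N0 - 1.
pose b := N0 / d.
have a0 : 0 < a by rewrite /a; clear -N0g e0 NN; lra.
have b0 : 0 < b by rewrite /b divr_gt0//; clear -N0g e0 NN; lra.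
pose Rf x := om x `^ a * (Z x / x ^+ 2) `^ b.
pose dV x := - v (om x) / (lam * x).
pose dZ x := y (om x) * (d * v (om x) - d + mm * om x) / (lam * x).
pose dR x := Rf x * (v (om x) + N0 * (om x - 1)) / (om x * (lam * x)).
have lx (x : R) : x0 < x < 0 -> lam * x != 0.
  by move=> /andP[_ xx]; rewrite mulf_neq0 ?(gt_eqF (lt_trans ltr01 l1)) ?(lt_eqF xx).
have vcom (x : R) : x0 < x < 0 -> v (om z) @[z --> x] --> v (om x).
  move=> xx; have [_ _ _ vc _] := orb _ (om_in _ xx).
  by apply: (@cvg_comp _ _ _ om v) vc; exact: omc.
have ycom (x : R) : x0 < x < 0 -> y (om z) @[z --> x] --> y (om x).
  move=> xx; have [_ _ _ _ yd] := orb _ (om_in _ xx).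
  apply: (@cvg_comp _ _ _ om y) (is_derive_continuous yd); exact: omc.
have lxc (x : R) : lam * z @[z --> x] --> lam * x by apply: cvgMl_tmp; exact: cvg_id.
have Zd (x : R) : x0 < x < 0 -> is_derive x 1 Z (dZ x).
  move=> xx; have oo := om_in _ xx; have [vp _ _ _ yd] := orb _ oo.
  have H := @is_derive1_comp _ y om x _ _ yd (omd _ xx).
  have := is_derive_mul (omd _ xx) H.
  suff -> : dZ x = om x * (dorbit (om x) (v (om x)) (y (om x)) * (- v (om x) / (lam * x)))
     + y (om x) * (- v (om x) / (lam * x)) by [].
  rewrite /dZ /dorbit; have lx0 := lx _ xx; have /andP[p1 _] := oo.
  move: lx0; rewrite mulf_eq0 negb_or => /andP[ln xn].
  by field; rewrite (gt_eqF vp) xn (gt_eqF p1) ln.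
have Zp (x : R) : x0 < x < 0 -> 0 < Z x.
  by move=> xx; have [_ yp _ _ _] := orb _ (om_in _ xx); have /andP[p1 _] := om_in _ xx; rewrite mulr_gt0.
have Zxp (x : R) : x0 < x < 0 -> 0 < Z x / x ^+ 2.
  move=> xx; have /andP[_ xneg] := xx.
  by rewrite divr_gt0 ?Zp// exprn_even_gt0//= lt_eqF.
have Rp (x : R) : x0 < x < 0 -> 0 < Rf x.
  move=> xx; have /andP[p1 _] := om_in _ xx.
  by rewrite mulr_gt0// powR_gt0// Zxp.
have Rd (x : R) : x0 < x < 0 -> is_derive x 1 Rf (dR x).
  move=> xx; have oo := om_in _ xx; have [vp yp _ _ _] := orb _ oo; have /andP[p1 _] := oo.
  have x2 : x ^+ 2 != 0 by rewrite expf_neq0// lt_eqF//; case/andP: xx.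
  have H1 := @is_derive1_comp _ (fun t => t `^ a) om x _ _ (is_derive1_powR a p1) (omd _ xx).
  have H2 := @is_derive_quotient Z (fun t => t ^+ 2) x _ _ x2 (Zd _ xx) (is_derive_sqr (is_derive_id x 1)).
  have H3 := @is_derive1_comp _ (fun t => t `^ b) (fun t => Z t / t ^+ 2) x _ _ (is_derive1_powR b (Zxp _ xx)) H2.
  have := is_derive_mul H1 H3.
  have Pm (t c : R) : 0 < t -> t `^ (c - 1) = t `^ c / t.
    by move=> t0; rewrite powRB ?(gt_eqF t0) ?implybT// powRr1// ltW.
  rewrite (Pm _ _ p1) (Pm _ _ (Zxp _ xx)).
  suff -> : dR x = om x `^ a * (b * ((Z x / x ^+ 2) `^ b / (Z x / x ^+ 2)) *
      ((dZ x * x ^+ 2 - Z x * (2 * x * 1)) / (x ^+ 2) ^+ 2)) +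
      (Z x / x ^+ 2) `^ b * (a * (om x `^ a / om x) * (- v (om x) / (lam * x))) by [].
  rewrite /dR /Rf /dZ.
  move: (om x `^ a) ((Z x / x ^+ 2) `^ b) => A B.
  rewrite /Z /a /b.
  have -> : mm = 2 * lam + d by rewrite /mm /lam /eps; field.
  have lx0 := lx _ xx; move: lx0; rewrite mulf_eq0 negb_or => /andP[ln xn].
  by field; rewrite xn (gt_eqF yp) (gt_eqF p1) ln (gt_eqF dd).
exists x0, (fun x => om x - 1), Z, Rf, dV, dZ, dR; split => //.
- move=> x xx; have oo := om_in _ xx; have /andP[p1 p2] := oo.
  have [vp yp vy _ _] := orb _ oo.
  have lx0 := lx _ xx; move: (lx0); rewrite mulf_eq0 negb_or => /andP[ln xn].
  have Rn := Rp _ xx.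
  split.
  + by split; [rewrite ltrBrDl subrr p1 subr_lt0 p2|exact: Zp|exact: Rp].
  + split; [|exact: Zd|exact: Rd].
    by have := is_deriveB (omd _ xx) (is_derive_cst (1 : R) x 1); rewrite subr0.
  + have Rc : {for x, continuous Rf} by exact: is_derive_continuous (Rd _ xx).
    split.
    * apply: cvgM; first by apply: cvgN; exact: vcom.
      by apply: cvgV => //; exact: lxc.
    * apply: cvgM; last by apply: cvgV => //; exact: lxc.
      apply: cvgM; first exact: ycom.
      apply: cvgD; last by apply: cvgMl_tmp; exact: omc.
      by apply: cvgB; [apply: cvgMl_tmp; exact: vcom|exact: cvg_cst].
    * apply: cvgM; last first.
        apply: cvgV; first by rewrite mulf_neq0// gt_eqF.
        by apply: cvgM; [exact: omc|exact: lxc].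
      apply: cvgM; first exact: Rc.
      apply: cvgD; first exact: vcom.
      by apply: cvgMl_tmp; apply: cvgB; [exact: omc|exact: cvg_cst].
  + have mE : mm = 2 * lam + d by rewrite /mm /lam /eps; field.
    have DV : - lam * x * dV x = v (om x) by rewrite /dV; field; rewrite ln xn.
    have DZ : - lam * x * dZ x = - (y (om x) * (d * v (om x) - d + mm * om x)).
      by rewrite /dZ; field; rewrite ln xn.
    have DR : - lam * x * dR x = - (Rf x * (v (om x) + N0 * (om x - 1)) / om x).
      by rewrite /dR; field; rewrite (gt_eqF p1) ln xn.
    rewrite DV DZ DR /kappa subrK.
    split.
    * by field; rewrite gt_eqF.
    * by rewrite mE /Z; ring.
    * have -> : Z x = om x * y (om x) by [].
      have Hv : Hf (om x) = v (om x) * (om x - y (om x)) + y (om x) * Sf (om x).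
        by rewrite vy; ring.
      have -> : (om x - 1) * (lam + (om x - 1)) = - Hf (om x).
        by rewrite /Hf /lam; ring.
      rewrite Hv mE /N0 /Sf.
      have d1 : 1 + d != 0 by rewrite gt_eqF// ltr_wpDl.
      have lE : 2 * lam = 2 + N * d - d by rewrite /lam /eps; field.
      rewrite lE.
      by field; rewrite d1 (gt_eqF p1) (gt_eqF Rn).
- have Z0 : Z x @[x --> x0^'+] --> 0.
    rewrite -[X in _ --> X](mul0r y0); apply: cvgM => //.
    exact: (@cvg_comp _ _ _ om y) om0' y_0.
  have near_in : \forall x \near x0^'+, x0 < x < 0.
    by near=> x; apply/andP; split; near: x; [exact: nbhs_right_gt|exact: nbhs_right_lt].
  split => //.
    rewrite -[X in _ --> X](sub0r (1 : R)); apply: cvgB => //; exact: cvg_cst.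
  rewrite -[X in _ --> X](mul0r ((0 : R) `^ b)); apply: cvgM.
    rewrite -[X in _ --> X](@powR0 R a); last by rewrite gt_eqF.
    by apply: powR_cvg => //; apply: filterS near_in => x /om_in /andP[].
  apply: powR_cvg => //; first by apply: filterS near_in => x; exact: Zxp.
  rewrite -[X in _ --> X](mul0r (x0 ^+ 2)^-1); apply: cvgM => //.
  apply: cvgV; first by rewrite expf_neq0// lt_eqF.
  by have := cvgM (right_id x0) (right_id x0); rewrite -expr2; apply.
- have near_in : \forall x \near (0 : R)^'-, x0 < x < 0.
    by near=> x; apply/andP; split; near: x; [exact: nbhs_left_gt|exact: nbhs_left_lt].
  have zeta1 : zeta (om x) @[x --> 0^'-] --> zeta 1.
    apply: (@cvg_comp _ _ _ om zeta) om1 _; apply: zc.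
    by rewrite (lt_trans _ ltr01)// ltrN10.
  have ez (c : R) : expR (c * zeta (om x)) @[x --> 0^'-] --> expR (c * zeta 1).
    apply: (@cvg_comp _ _ _ _ expR); last exact: continuous_expR.
    exact: cvgMl_tmp.
  have Zx : Z x / x ^+ 2 @[x --> 0^'-] --> 1 * y2 * expR (- 2 * zeta 1).
    apply: (@cvg_trans _ (om x * (y (om x) / (1 - om x) ^+ 2) * expR (- 2 * zeta (om x)) @[x --> 0^'-])).
      apply: near_eq_cvg; apply: filterS near_in => x xx.
      have /andP[p1 p2] := om_in _ xx.
      rewrite /Z mulNr expRN expRM_natl.
      have := expR_gt0 (zeta (om x)); have := xE _ xx; move: p2.
      move: (om x) (expR (zeta (om x))) (y (om x)) => ww ee yy p2 hx E0; rewrite hx.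
      by field; rewrite (gt_eqF E0) subr_eq0 gt_eqF.
    apply: cvgM => //; apply: cvgM => //.
    exact: (@cvg_comp _ _ _ om (fun W => y W / (1 - W) ^+ 2)) om1' y_1.
  exists (expR (- 1 * zeta 1)), (1 * y2 * expR (- 2 * zeta 1)),
    (1 `^ a * (1 * y2 * expR (- 2 * zeta 1)) `^ b).
  split => //.
    apply: (@cvg_trans _ (expR (- 1 * zeta (om x)) @[x --> 0^'-])); last exact: (ez (-1)).
    apply: near_eq_cvg; apply: filterS near_in => x xx.
    have /andP[p1 p2] := om_in _ xx.
    rewrite mulN1r expRN.
    have := expR_gt0 (zeta (om x)); have := xE _ xx; move: p2.
    move: (om x) (expR (zeta (om x))) => ww ee p2 hx E0; rewrite hx.
    by field; rewrite (gt_eqF E0) subr_eq0 gt_eqF.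
  have H1 : om x `^ a @[x --> 0^'-] --> 1 `^ a.
    by apply: powR_cvg => //; apply: filterS near_in => x /om_in /andP[].
  apply: (cvgM H1).
  apply: powR_cvg => //; last by apply: filterS near_in => x; exact: Zxp.
  by apply: (cvgr_to_ge Zx); apply: filterS near_in => x xx; exact: ltW (Zxp _ xx).
Unshelve. all: by end_near. Qed.
End PhasePlane.

(** * Radial calculus in space-time *)

(** Differentiability is local, which the calculus of differentials below needs for
    fields that are known on an open set. *)
Lemma is_diff_near (R : realType) (V W : normedModType R) (g h : V -> W) (z : V)
    (D : V -> W) :
  (\forall y \near z, h y = g y) -> is_diff z g D -> is_diff z h D.
Proof.
move=> gh [gd gD].
have E0 : h z = g z by exact: (nbhs_singleton gh).
have dc : continuous ('d g z) by exact: diff_continuous.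
have ho : h \o shift z = cst (h z) + 'd g z +o_ 0 id.
  have /(@eqaddoP R) go := diff_locally gd.
  apply/(@eqaddoP R) => e e0; have := go e e0.
  have nsh : \forall y \near (0 : V), h (y + z) = g (y + z).
    have sc : (fun y : V => y + z) y @[y --> (0 : V)] --> z.
      rewrite -{2}(add0r z); apply: cvgD; [exact: cvg_id|exact: cvg_cst].
    exact: (sc _ gh).
  apply: filterS2 nsh => y hy; rewrite !fctE /= in hy *.
  by rewrite hy E0.
have dE : 'd h z = 'd g z :> (V -> W) by exact: diff_unique.
apply: DiffDef; last by rewrite dE.
by apply/diff_locallyP; rewrite dE.
Qed.

Section RadialCalculus.
Variables (R : realType) (n : nat).
Notation E := (R * 'rV[R]_n)%type.
Variable Omega : set E.

Definition sqnorm (z : E) : R := \sum_(j < n) z.2 0 j ^+ 2.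
Definition inner (x y : 'rV[R]_n) : R := \sum_(j < n) x 0 j * y 0 j.
(** The differentials, at the point [z] of space-time, of the logarithms of [|x|]
    and of [|t|]. *)
Definition ell (z v : E) : R := inner z.2 v.2 / sqnorm z.
Definition tau (z v : E) : R := v.1 / z.1.

(** For a function [g] of [t] and [r = |x|] one has [a = r g_r] and [b = t g_t].
    These derivatives behave well under products and compositions, and avoid
    the square root in [|x|]. *)
Definition radial (g a b : E -> R) := forall z, Omega z ->
  [/\ is_diff z g (fun v => a z * ell z v + b z * tau z v),
      {for z, continuous a} & {for z, continuous b}].

Hypothesis Omega_neq0 : forall z, Omega z -> z.1 != 0 /\ sqnorm z != 0.
Hypothesis Omega_open : forall z, Omega z -> \forall y \near z, Omega y.

Lemma cvg_sum_ord (T : Type) (F : set_system T) (FF : Filter F) (f : 'I_n -> T -> R)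
    (l : 'I_n -> R) : (forall j, f j x @[x --> F] --> l j) ->
  (\sum_(j < n) f j x) @[x --> F] --> \sum_(j < n) l j.
Proof.
move=> fl; have -> : (fun x => \sum_(j < n) f j x) = \sum_(j < n) f j.
  by rewrite fct_sumE.
apply: (big_ind2 (fun (g : T -> R) (m : R) => g @ F --> m)) => //.
- exact: cvg_cst.
- by move=> g m g' m' gm gm'; exact: (cvgD gm gm').
Qed.

Lemma fst_continuous : continuous (fun z : E => z.1).
Proof. by move=> z; exact: cvg_fst. Qed.

Lemma coord2_continuous (j : 'I_n) : continuous (fun z : E => z.2 0 j).
Proof.
move=> z; apply: (@cvg_comp _ _ _ (fun z : E => z.2) (fun M : 'rV[R]_n => M 0 j) _ (nbhs z.2)).
  exact: cvg_snd.
exact: coord_continuous.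
Qed.

Lemma sqnorm_continuous : continuous sqnorm.
Proof.
move=> z; apply: cvg_sum_ord => j.
by have H := @coord2_continuous j z; have := cvgM H H; rewrite -expr2; apply.
Qed.

Lemma ell_continuous (v z : E) : Omega z -> {for z, continuous (ell ^~ v)}.
Proof.
move=> /Omega_neq0[_ q0]; apply: cvgM.
  by apply: cvg_sum_ord => j; apply: cvgMr_tmp; exact: coord2_continuous.
by apply: cvgV => //; exact: sqnorm_continuous.
Qed.

Lemma tau_continuous (v z : E) : Omega z -> {for z, continuous (tau ^~ v)}.
Proof.
move=> /Omega_neq0[t0 _]; apply: cvgMl_tmp.
by apply: cvgV => //; exact: fst_continuous.
Qed.

Lemma radial_derive (g a b : E -> R) (z v : E) : radial g a b -> Omega z ->
  'D_v g z = a z * ell z v + b z * tau z v.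
Proof.
move=> /(_ z) H /H [gd _ _].
by rewrite deriveE ?diff_val//; exact: ex_diff.
Qed.

Lemma radial_C1 (g a b : E -> R) : radial g a b -> C1_on Omega g.
Proof.
move=> H z Oz; have [gd ac bc] := H z Oz; split; first exact: ex_diff.
move=> v; apply: (@cvg_trans _ ((fun y => a y * ell y v + b y * tau y v) @ z)).
  apply: near_eq_cvg; apply: filterS (Omega_open Oz) => y Oy.
  by rewrite (radial_derive _ H Oy).
rewrite (radial_derive _ H Oz).
have H1 := cvgM ac (@ell_continuous v z Oz).
have H2 := cvgM bc (@tau_continuous v z Oz).
exact: (cvgD (H1 _) (H2 _)).
Qed.

Lemma radial_continuous (g a b : E -> R) (z : E) : radial g a b -> Omega z ->
  {for z, continuous g}.
Proof.
move=> /(_ z) H /H [gd _ _]; apply: differentiable_continuous; exact: ex_diff.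
Qed.

Lemma radial_ext (g h a b : E -> R) : (forall z, Omega z -> h z = g z) ->
  radial g a b -> radial h a b.
Proof.
move=> gh H z Oz; have [gd ac bc] := H z Oz; split => //.
apply: is_diff_near gd; apply: filterS (Omega_open Oz); exact: gh.
Qed.

Lemma radial_coef (g a b a' b' : E -> R) : (forall z, Omega z -> a' z = a z) ->
  (forall z, Omega z -> b' z = b z) -> radial g a b -> radial g a' b'.
Proof.
have ext (p p' : E -> R) z : (forall z, Omega z -> p' z = p z) -> Omega z ->
    {for z, continuous p} -> {for z, continuous p'}.
  move=> pp Oz pc; have : p' y @[y --> z] --> p z.
    apply: cvg_trans pc; apply: near_eq_cvg.
    by apply: filterS (Omega_open Oz) => y Oy; rewrite pp.
  by rewrite -(pp z Oz).
move=> aa bb H z Oz; have [gd ac bc] := H z Oz; split.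
- by rewrite (aa z Oz) (bb z Oz).
- exact: ext ac.
- exact: ext bc.
Qed.

Lemma radial_cst (c : R) : radial (fun=> c) (fun=> 0) (fun=> 0).
Proof.
move=> z Oz; split; [|exact: cvg_cst|exact: cvg_cst].
apply: is_diff_eq (is_diff_cst c z) _.
by apply/funext => v; rewrite !mul0r addr0.
Qed.

Lemma radialM (g a b g' a' b' : E -> R) : radial g a b -> radial g' a' b' ->
  radial (fun z => g z * g' z) (fun z => g z * a' z + g' z * a z)
    (fun z => g z * b' z + g' z * b z).
Proof.
move=> H H' z Oz; have [gd ac bc] := H z Oz; have [gd' ac' bc'] := H' z Oz.
have gc := radial_continuous H Oz; have gc' := radial_continuous H' Oz.
split; last 2 first.
- by apply: cvgD; apply: cvgM.
- by apply: cvgD; apply: cvgM.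
apply: is_diff_eq (is_diffM gd gd') _.
apply/funext => v; transitivity (g z * (a' z * ell z v + b' z * tau z v)
  + g' z * (a z * ell z v + b z * tau z v)) => //; ring.
Qed.

Lemma radialD (g a b g' a' b' : E -> R) : radial g a b -> radial g' a' b' ->
  radial (fun z => g z + g' z) (fun z => a z + a' z) (fun z => b z + b' z).
Proof.
move=> H H' z Oz; have [gd ac bc] := H z Oz; have [gd' ac' bc'] := H' z Oz.
split; [|exact: cvgD|exact: cvgD].
apply: is_diff_eq (is_diffD gd gd') _.
apply/funext => v; rewrite /= !fctE; ring.
Qed.

Lemma is_diff_of_derive (phi : R -> R) (x l : R) : is_derive x 1 phi l ->
  is_diff x phi (fun h => h * l).
Proof.
move=> [pd pl]; have pd' : differentiable phi x by exact/derivable1_diffP.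
apply: DiffDef => //; apply/funext => h.
by rewrite diff1E// derive1E pl.
Qed.

Lemma radial_comp (phi dphi : R -> R) (g a b : E -> R) : radial g a b ->
  (forall z, Omega z -> is_derive (g z) 1 phi (dphi (g z)) /\ {for g z, continuous dphi}) ->
  radial (fun z => phi (g z)) (fun z => dphi (g z) * a z) (fun z => dphi (g z) * b z).
Proof.
move=> H Hp z Oz; have [gd ac bc] := H z Oz; have [pd pc] := Hp z Oz.
have gc := radial_continuous H Oz.
have dc : dphi (g y) @[y --> z] --> dphi (g z) by exact: (cvg_comp _ _ gc pc).
split; [|exact: cvgM|exact: cvgM].
apply: is_diff_eq (is_diff_comp gd (is_diff_of_derive pd)) _.
apply/funext => v; rewrite /= ; ring.
Qed.

Lemma is_diff_fst (z : E) : is_diff z (fun y : E => y.1) (fun v => v.1).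
Proof.
have H : continuous (@fst R 'rV[R]_n) by exact: fst_continuous.
apply: DiffDef; first exact: (@linear_differentiable _ _ _ (@fst R 'rV[R]_n)).
by rewrite (@diff_lin _ _ _ (@fst R 'rV[R]_n)).
Qed.

Lemma is_diff_coord2 (j : 'I_n) (z : E) : is_diff z (fun y : E => y.2 0 j) (fun v => v.2 0 j).
Proof.
have Hs : continuous (@snd R 'rV[R]_n) by move=> y; exact: cvg_snd.
have H2 : is_diff z (@snd R 'rV[R]_n) (@snd R 'rV[R]_n).
  apply: DiffDef; first exact: (@linear_differentiable _ _ _ (@snd R 'rV[R]_n)).
  by rewrite (@diff_lin _ _ _ (@snd R 'rV[R]_n)).
have coord_lin : linear (fun M : 'rV[R]_n => M 0 j : R^o) by move=> c u v; rewrite !mxE.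
pose coordM := GRing.isLinear.Build _ _ _ _ _ coord_lin.
pose coordL : {linear 'rV[R]_n -> R^o} := HB.pack (fun M : 'rV[R]_n => M 0 j : R^o) coordM.
have H3 : is_diff (z.2) (fun M : 'rV[R]_n => M 0 j) (fun M : 'rV[R]_n => M 0 j).
  have cc : continuous coordL by exact: coord_continuous.
  apply: DiffDef; first exact: (@linear_differentiable _ _ _ coordL).
  exact: (@diff_lin _ _ _ coordL).
exact: (is_diff_comp H2 H3).
Qed.

Lemma radial_t : radial (fun z => z.1) (fun=> 0) (fun z => z.1).
Proof.
move=> z Oz; have [t0 _] := Omega_neq0 Oz; split; [|exact: cvg_cst|exact: fst_continuous].
apply: is_diff_eq (is_diff_fst z) _.
by apply/funext => v; rewrite mul0r add0r /tau mulrC divfK.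
Qed.

Lemma inner_diff (z v : E) : \sum_(j < n) (z.2 0 j * v.2 0 j + z.2 0 j * v.2 0 j) = 2 * inner z.2 v.2.
Proof. by rewrite /inner mulr_sumr; apply: eq_bigr => j _; ring. Qed.

Lemma radial_sqnorm : radial sqnorm (fun z => 2 * sqnorm z) (fun=> 0).
Proof.
move=> z Oz; have [_ q0] := Omega_neq0 Oz.
split; [|by apply: cvgMl_tmp; exact: sqnorm_continuous|exact: cvg_cst].
have H j : is_diff z (fun y : E => y.2 0 j ^+ 2) (fun v => z.2 0 j * v.2 0 j + z.2 0 j * v.2 0 j).
  exact: (is_diffM (is_diff_coord2 j z) (is_diff_coord2 j z)).
have E1 : sqnorm = \sum_(j < n) (fun y : E => y.2 0 j ^+ 2) by rewrite fct_sumE.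
have E2 : \sum_(j < n) (fun v : E => z.2 0 j * v.2 0 j + z.2 0 j * v.2 0 j) =
  (fun v => 2 * sqnorm z * ell z v + 0 * tau z v).
  rewrite fct_sumE; apply/funext => v.
  by rewrite inner_diff mul0r addr0 /ell; field.
suff : is_diff z (\sum_(j < n) (fun y : E => y.2 0 j ^+ 2))
    (\sum_(j < n) (fun v : E => z.2 0 j * v.2 0 j + z.2 0 j * v.2 0 j)).
  by rewrite E2 -E1.
apply: (big_ind2 (fun f df : E -> R => is_diff z f df)) => //.
- exact: (is_diff_cst (0 : R) z).
- by move=> f df g dg fd gd; exact: is_diffD fd gd.
Qed.
End RadialCalculus.

(** * The Euler system for radial fields *)

Section RadialEuler.
Variables (R : realType) (n : nat).
Notation E := (R * 'rV[R]_n)%type.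
Variable Omega : set E.
Hypothesis Omega_neq0 : forall z : E, Omega z -> z.1 != 0 /\ sqnorm z != 0.
Hypothesis Omega_open : forall z, Omega z -> \forall y \near z, Omega y.
Local Notation radial := (radial Omega).

Lemma ell_t (z : E) : ell z (1, 0) = 0.
Proof. by rewrite /ell /inner big1 ?mul0r// => j _; rewrite mxE mulr0. Qed.
Lemma tau_t (z : E) : tau z (1, 0) = z.1^-1.
Proof. by rewrite /tau mul1r. Qed.
Lemma ell_x (z : E) j : ell z (0, delta_mx 0 j) = z.2 0 j / sqnorm z.
Proof.
rewrite /ell /inner (bigD1 j)//= big1 ?addr0; first by rewrite mxE !eqxx mulr1.
by move=> i ij; rewrite mxE eqxx /= (negbTE ij) mulr0.
Qed.
Lemma tau_x (z : E) j : tau z (0, delta_mx 0 j) = 0.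
Proof. by rewrite /tau mul0r. Qed.

Lemma derive_radial_coord (g a b : E -> R) (j : 'I_n) (z v : E) : radial g a b -> Omega z ->
  is_diff z (fun y : E => g y * y.2 0 j)
    (fun v => g z * v.2 0 j + z.2 0 j * (a z * ell z v + b z * tau z v)).
Proof.
move=> /(_ z) H /H [gd _ _]; exact: (is_diffM gd (is_diff_coord2 j z)).
Qed.

Lemma derive_radial_coord2 (g a b : E -> R) (i j : 'I_n) (z v : E) : radial g a b -> Omega z ->
  is_diff z (fun y : E => g y * y.2 0 i * y.2 0 j)
    (fun v => g z * z.2 0 i * v.2 0 j + z.2 0 j *
      (g z * v.2 0 i + z.2 0 i * (a z * ell z v + b z * tau z v))).
Proof.
move=> H Oz; exact: (is_diffM (derive_radial_coord i z H Oz) (is_diff_coord2 j z)).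
Qed.

Lemma derive_is_diff (g : E -> R) (D : E -> R) (z v : E) : is_diff z g D -> 'D_v g z = D v.
Proof. by move=> gd; rewrite deriveE ?diff_val//; exact: ex_diff. Qed.

Lemma partial_t_radial (g a b : E -> R) (z : E) : radial g a b -> Omega z ->
  partial_t g z = b z / z.1.
Proof. by move=> H Oz; rewrite /partial_t (radial_derive _ H Oz) ell_t tau_t mulr0 add0r. Qed.

Lemma partial_x_radial (g a b : E -> R) (z : E) j : radial g a b -> Omega z ->
  partial_x j g z = z.2 0 j * (a z / sqnorm z).
Proof.
move=> H Oz; rewrite /partial_x (radial_derive _ H Oz) ell_x tau_x mulr0 addr0; ring.
Qed.

Lemma partial_t_coord (g a b : E -> R) (z : E) i : radial g a b -> Omega z ->
  partial_t (fun y => g y * y.2 0 i) z = z.2 0 i * (b z / z.1).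
Proof.
move=> H Oz; rewrite /partial_t (derive_is_diff _ (derive_radial_coord i z H Oz)).
by rewrite /= mxE ell_t tau_t; ring.
Qed.

(** With [a = r g_r], this is [div (g x) = r g_r + n g]. *)
Lemma divergence_radial (g a b : E -> R) (z : E) : radial g a b -> Omega z ->
  \sum_(j < n) partial_x j (fun y => g y * y.2 0 j) z = a z + n%:R * g z.
Proof.
move=> H Oz; have [_ q0] := Omega_neq0 Oz.
under eq_bigr => j _.
  rewrite /partial_x (derive_is_diff _ (derive_radial_coord j z H Oz)) /= mxE !eqxx mulr1.
  rewrite ell_x tau_x mulr0 addr0 (_ : _ * (a z * _) = (a z / sqnorm z) * z.2 0 j ^+ 2); last by ring.
  over.
rewrite big_split /= sumr_const card_ord -mulr_sumr -/(sqnorm z) divfK//.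
by rewrite addrC mulr_natl.
Qed.

Lemma divergence_tensor (g a b : E -> R) (z : E) i : radial g a b -> Omega z ->
  \sum_(j < n) partial_x j (fun y => g y * y.2 0 i * y.2 0 j) z =
  z.2 0 i * (a z + (n%:R + 1) * g z).
Proof.
move=> H Oz; have [_ q0] := Omega_neq0 Oz.
under eq_bigr => j _.
  rewrite /partial_x (derive_is_diff _ (derive_radial_coord2 i j z H Oz)) /= !mxE !eqxx mulr1.
  rewrite ell_x tau_x mulr0 addr0.
  rewrite (_ : _ + _ = g z * z.2 0 i + (g z * (z.2 0 j * ((true && (i == j))%:R)) +
     (z.2 0 i * (a z / sqnorm z)) * z.2 0 j ^+ 2)); last by rewrite /=; ring.
  over.
rewrite big_split /= sumr_const card_ord big_split /= -!mulr_sumr -/(sqnorm z).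
have -> : \sum_(j < n) z.2 0 j * (i == j)%:R = z.2 0 i.
  rewrite (bigD1 i)//= eqxx mulr1 big1 ?addr0// => j ji.
  by rewrite eq_sym (negbTE ji) mulr0.
by rewrite -mulr_natl; field.
Qed.

Lemma eucl_norm_sqr (x : 'rV[R]_n) : eucl_norm x ^+ 2 = \sum_(j < n) x 0 j ^+ 2.
Proof. by rewrite sqr_sqrtr// sumr_ge0// => j _; rewrite sqr_ge0. Qed.

Lemma is_diff_row (g : 'I_n -> E -> R) (z : E) : (forall j, differentiable (g j) z) ->
  is_diff z (fun y => \sum_(j < n) g j y *: (delta_mx 0 j : 'rV[R]_n))
    (fun v => \sum_(j < n) 'd (g j) z v *: (delta_mx 0 j : 'rV[R]_n)).
Proof.
move=> gd.
have -> : (fun y => \sum_(j < n) g j y *: (delta_mx 0 j : 'rV[R]_n)) =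
    \sum_(j < n) (fun y => g j y *: (delta_mx 0 j : 'rV[R]_n)) by rewrite fct_sumE.
have -> : (fun v => \sum_(j < n) 'd (g j) z v *: (delta_mx 0 j : 'rV[R]_n)) =
    \sum_(j < n) (fun v => 'd (g j) z v *: (delta_mx 0 j : 'rV[R]_n)) by rewrite fct_sumE.
apply: (big_ind2 (fun f df : E -> 'rV[R]_n => is_diff z f df)).
- exact: (is_diff_cst (0 : 'rV[R]_n) z).
- by move=> f df h dh fd hd; exact: is_diffD fd hd.
- move=> j _; apply: DiffDef; first exact: differentiableZl.
  exact: diffZl.
Qed.

Lemma C1_on_row (g : 'I_n -> E -> R) (f : E -> 'rV[R]_n) :
  (forall j, C1_on Omega (g j)) ->
  (forall z, Omega z -> f z = \sum_(j < n) g j z *: delta_mx 0 j) -> C1_on Omega f.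
Proof.
move=> gC fE z Oz.
have fd y : Omega y -> is_diff y f (fun v => \sum_(j < n) 'd (g j) y v *: (delta_mx 0 j : 'rV[R]_n)).
  move=> Oy; apply: is_diff_near (is_diff_row (fun j => (gC j y Oy).1)).
  by apply: filterS (Omega_open Oy); exact: fE.
have fD v y : Omega y -> 'D_v f y = \sum_(j < n) 'D_v (g j) y *: (delta_mx 0 j : 'rV[R]_n).
  move=> Oy; have H := fd y Oy; rewrite deriveE; last exact: ex_diff.
  rewrite diff_val; apply: eq_bigr => j _; rewrite deriveE//.
  by have [] := gC j y Oy.
split; first by have := fd z Oz => H; exact: ex_diff.
move=> v; suff : 'D_v f y @[y --> z] --> \sum_(j < n) 'D_v (g j) z *: (delta_mx 0 j : 'rV[R]_n).
  by rewrite -fD.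
apply: (@cvg_trans _ ((fun y => \sum_(j < n) 'D_v (g j) y *: (delta_mx 0 j : 'rV[R]_n)) @ z)).
  by apply: near_eq_cvg; apply: filterS (Omega_open Oz) => y Oy; rewrite fD.
have -> : (fun y => \sum_(j < n) 'D_v (g j) y *: (delta_mx 0 j : 'rV[R]_n)) =
   \sum_(j < n) (fun y => 'D_v (g j) y *: (delta_mx 0 j : 'rV[R]_n)) by rewrite fct_sumE.
apply: (big_ind2 (fun (h : E -> 'rV[R]_n) (m : 'rV[R]_n) => h @ z --> m)).
- exact: cvg_cst.
- by move=> h m h' m' hm hm'; exact: (cvgD hm hm').
- by move=> j _; apply: cvgZr_tmp; have [_] := gC j z Oz; apply.
Qed.

Lemma C1_on_coord (g a b : E -> R) j : radial g a b -> C1_on Omega (fun y => g y * y.2 0 j).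
Proof.
move=> H z Oz; have gd := derive_radial_coord j z H Oz; split; first exact: ex_diff.
have D v y : Omega y -> 'D_v (fun y => g y * y.2 0 j) y =
   g y * v.2 0 j + y.2 0 j * (a y * ell y v + b y * tau y v).
  by move=> Oy; rewrite (derive_is_diff _ (derive_radial_coord j y H Oy)).
move=> v; suff : 'D_v (fun y => g y * y.2 0 j) y @[y --> z] -->
   g z * v.2 0 j + z.2 0 j * (a z * ell z v + b z * tau z v) by rewrite -D.
apply: (@cvg_trans _ ((fun y => g y * v.2 0 j + y.2 0 j * (a y * ell y v + b y * tau y v)) @ z)).
  by apply: near_eq_cvg; apply: filterS (Omega_open Oz) => y Oy; rewrite D.
have [_ ac bc] := H z Oz; have gc := radial_continuous H Oz.
have H1 := cvgM ac (@ell_continuous _ _ _ Omega_neq0 v z Oz).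
have H2 := cvgM bc (@tau_continuous _ _ _ Omega_neq0 v z Oz).
have H3 := cvgM (@coord2_continuous R n j z) (cvgD (H1 _) (H2 _)).
have H4 : g y * v.2 0 j @[y --> z] --> g z * v.2 0 j by apply: cvgMr_tmp; exact: gc.
exact: (cvgD H4 (H3 _ _ _ _)).
Qed.

(** The velocity is [w x].  The three hypotheses are the radial equations for the
    density, the velocity and the sound speed, multiplied by [t] and with the
    derivatives [a = r d/dr] and [b = t d/dt].  Solving them for the time
    derivatives turns each conservation law into an algebraic identity. *)
Lemma euler_of_radial (gamma : R) (rho ar br w aw bw c ac bc : E -> R)
    (rhof : E -> R) (uf : E -> 'rV[R]_n) (cf : E -> R) :
  1 < gamma -> radial rho ar br -> radial w aw bw -> radial c ac bc ->
  (forall z, Omega z -> [/\ 0 < rho z, 0 < c z, rhof z = rho z, uf z = w z *: z.2 & cf z = c z]) ->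
  (forall z, Omega z ->
   [/\ br z + z.1 * (w z * ar z + rho z * (aw z + n%:R * w z)) = 0,
    bw z + z.1 * (w z * aw z + w z ^+ 2
      + (c z ^+ 2 * ar z + 2 * rho z * c z * ac z) / (gamma * rho z * sqnorm z)) = 0 &
    bc z + z.1 * (w z * ac z + (gamma - 1) / 2 * c z * (aw z + n%:R * w z)) = 0]) ->
  euler_classical_solution gamma Omega rhof uf cf.
Proof.
move=> g1 Hr Hw Hc fields eqs.
have nr z : Omega z -> \forall y \near z, Omega y by exact: Omega_open.
have Hrf : radial rhof ar br.
  by apply: radial_ext Hr => // z /fields[].
have Hcf : radial cf ac bc by apply: radial_ext Hc => // z /fields[].
have g0 : gamma != 0 by rewrite gt_eqF// (lt_trans ltr01).
have g10 : gamma - 1 != 0 by rewrite subr_eq0 gt_eqF.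
(* partial derivatives only see the fields near the point *)
have Dext (f h : E -> R) z v : Omega z -> (forall y, Omega y -> f y = h y) -> 'D_v f z = 'D_v h z.
  move=> Oz fh; apply: near_eq_derive; apply: filterS (nr z Oz) => y; exact: fh.
have [k kE] : exists k : R, k = (gamma * (gamma - 1))^-1 by eexists.
have Hrw := radialM Hr Hw.
have Hrww := radialM Hrw Hw.
have Hcc := radialM Hc Hc.
have Hrcc := radialM Hr Hcc.
have Hp := radialM (@radial_cst R n Omega gamma^-1) Hrcc.
have Hww := radialM Hw Hw.
have Hq := radial_sqnorm Omega_neq0.
have HE := radialD (radialM (@radial_cst R n Omega k) Hcc) (radialM (@radial_cst R n Omega 2^-1) (radialM Hww Hq)).
have HrE := radialM Hr HE.
have HF := radialM (radialD HrE Hp) Hw.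
have pE z : Omega z -> pressure gamma (rhof z) (internal_energy gamma (cf z))
    = gamma^-1 * (rho z * (c z * c z)).
  by move=> /fields[_ _ -> _ ->]; rewrite /pressure /internal_energy; field; rewrite g0 g10.
have enE z : Omega z -> internal_energy gamma (cf z) + eucl_norm (uf z) ^+ 2 / 2
    = k * (c z * c z) + 2^-1 * (w z * w z * sqnorm z).
  move=> /fields[_ _ _ -> ->]; rewrite /internal_energy eucl_norm_sqr kE.
  have -> : \sum_(j < n) (w z *: z.2) 0 j ^+ 2 = w z * w z * sqnorm z.
    by rewrite /sqnorm mulr_sumr; apply: eq_bigr => j _; rewrite mxE; ring.
  by field; rewrite g0 g10.
split.
- exact: (radial_C1 Omega_neq0 Omega_open Hrf).
- apply: (@C1_on_row (fun j y => w y * y.2 0 j)); first by move=> j; exact: C1_on_coord Hw.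
  move=> z /fields[_ _ _ -> _]; rewrite {1}(row_sum_delta z.2) scaler_sumr.
  by apply: eq_bigr => j _; rewrite scalerA.
- exact: (radial_C1 Omega_neq0 Omega_open Hcf).
- by move=> z /fields[? ? -> _ ->].
- move=> z Oz; have [t0 q0] := Omega_neq0 Oz.
  have [rp cp _ _ _] := fields z Oz; have [e1 e2 e3] := eqs z Oz.
  have br_E : br z = - (z.1 * (w z * ar z + rho z * (aw z + n%:R * w z))).
    by apply/eqP; rewrite -addr_eq0 e1.
  have bw_E : bw z = - (z.1 * (w z * aw z + w z ^+ 2
      + (c z ^+ 2 * ar z + 2 * rho z * c z * ac z) / (gamma * rho z * sqnorm z))).
    by apply/eqP; rewrite -addr_eq0 e2.
  have bc_E : bc z = - (z.1 * (w z * ac z + (gamma - 1) / 2 * c z * (aw z + n%:R * w z))).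
    by apply/eqP; rewrite -addr_eq0 e3.
  have rn : rho z != 0 by rewrite gt_eqF.
  split.
  + rewrite (partial_t_radial Hrf Oz).
    under eq_bigr => j _.
      rewrite /partial_x (Dext _ (fun y => (rho y * w y) * y.2 0 j))//; last first.
        by move=> y /fields[_ _ -> -> _]; rewrite mxE mulrA.
      rewrite -/(partial_x j _ z); over.
    rewrite (divergence_radial Hrw Oz) br_E; field.
    exact: t0.
  + move=> i.
    rewrite {1}/partial_t (Dext _ (fun y => (rho y * w y) * y.2 0 i))//; last first.
      by move=> y /fields[_ _ -> -> _]; rewrite mxE mulrA.
    rewrite -/(partial_t _ z) (partial_t_coord i Hrw Oz).
    under eq_bigr => j _.
      rewrite /partial_x (Dext _ (fun y => (rho y * w y * w y) * y.2 0 i * y.2 0 j))//; last first.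
        by move=> y /fields[_ _ -> -> _]; rewrite !mxE; ring.
      rewrite -/(partial_x j _ z); over.
    rewrite (divergence_tensor i Hrww Oz).
    rewrite {1}/partial_x (Dext _ (fun y => gamma^-1 * (rho y * (c y * c y))))//.
    rewrite -/(partial_x i _ z) (partial_x_radial i Hp Oz) /= br_E bw_E.
    by field; rewrite g0 q0 rn t0.
  + rewrite {1}/partial_t (Dext _ (fun y => rho y * (k * (c y * c y) + 2^-1 * (w y * w y * sqnorm y))))//; last first.
      by move=> y Oy; rewrite enE//; have [_ _ -> _ _] := fields y Oy.
    rewrite -/(partial_t _ z) (partial_t_radial HrE Oz).
    under eq_bigr => j _.
      rewrite /partial_x (Dext _ (fun y => ((rho y * (k * (c y * c y) + 2^-1 * (w y * w y * sqnorm y))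
         + gamma^-1 * (rho y * (c y * c y))) * w y) * y.2 0 j))//; last first.
        move=> y Oy; rewrite enE// pE//; have [_ _ -> -> _] := fields y Oy.
        by rewrite mxE; ring.
      rewrite -/(partial_x j _ z); over.
    rewrite (divergence_radial HF Oz) br_E bw_E bc_E kE.
    by field; rewrite g0 g10 q0 rn t0.
Qed.
End RadialEuler.

(** * The fields of the flow *)

Section Flow.
Variables (R : realType) (n : nat) (d lam kappa x0 : R) (V Z Rf dV dZ dR : R -> R).
Notation E := (R * 'rV[R]_n)%type.
Hypothesis d0 : 0 < d.
Hypothesis lam1 : 1 < lam.
Hypothesis kappa_gt : 2 * lam - 1 < kappa.
Hypothesis x00 : x0 < 0.
Hypothesis profile : forall x, x0 < x < 0 -> [/\ [/\ -1 < V x < 0, 0 < Z x & 0 < Rf x],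
  [/\ is_derive x 1 V (dV x), is_derive x 1 Z (dZ x) & is_derive x 1 Rf (dR x)],
  [/\ {for x, continuous dV}, {for x, continuous dZ} & {for x, continuous dR}] &
  [/\ (1 + V x) * (- lam * x * dR x)
        + Rf x * (- lam * x * dV x + (kappa + n%:R) * V x) = 0,
      (1 + V x) * (- lam * x * dZ x)
        + Z x * (d * (- lam * x * dV x) + 2 * lam + (2 + n%:R * d) * V x) = 0 &
      (1 + V x) * (- lam * x * dV x) + (- lam * x * dZ x
        + Z x * (- lam * x * dR x) / Rf x) / (1 + d)
        + V x * (lam + V x) + (kappa + 2) * Z x / (1 + d) = 0]].

Local Notation C := (fun x => Num.sqrt (Z x)).
Local Notation r0 := (interface lam x0).
Local Notation rho := (sim_density lam kappa Rf).
Local Notation u := (sim_speed lam V).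
Local Notation c := (sim_speed lam C).
Local Notation Omega := (@fluid_region R n r0).

Lemma lam_gt0 : 0 < lam. Proof. exact: lt_trans ltr01 lam1. Qed.

Lemma ratio_gt0 (t x1 : R) : x1 < 0 -> t < 0 -> 0 < t / x1.
Proof. by move=> x10 t0; rewrite nmulr_rgt0// invr_lt0. Qed.

Lemma interface_gt0 x1 t : x1 < 0 -> t < 0 -> 0 < interface lam x1 t.
Proof. by move=> x10 t0; rewrite /interface powR_gt0// ratio_gt0. Qed.

Lemma interface_powR x1 t : x1 < 0 -> t < 0 -> interface lam x1 t `^ lam = t / x1.
Proof.
move=> x10 t0; rewrite /interface -powRrM mulVf ?gt_eqF ?lam_gt0// powRr1//.
by rewrite ltW// ratio_gt0.
Qed.

Lemma interface_lt t r : t < 0 -> 0 < r -> (r0 t < r) = (x0 < similarity_var lam t r).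
Proof.
move=> t0 rp; have rl : 0 < r `^ lam by rewrite powR_gt0.
transitivity (r0 t `^ lam < r `^ lam).
  apply/idP/idP => [H|].
    by apply: gt0_ltr_powR => //; rewrite ?nnegrE ?ltW// ?interface_gt0// lam_gt0.
  apply: contraTT; rewrite -!leNgt => H.
  by apply: ge0_ler_powR => //; rewrite ?nnegrE ?ltW// ?interface_gt0// lam_gt0.
rewrite interface_powR// /similarity_var ltr_pdivlMr// ltr_ndivrMr//.
by rewrite mulrC.
Qed.

Lemma similarity_lt0 t r : t < 0 -> 0 < r -> similarity_var lam t r < 0.
Proof. by move=> t0 rp; rewrite /similarity_var pmulr_llt0// invr_gt0 powR_gt0. Qed.

(** The self-similar variable, written without the norm so that it falls under the
    radial calculus; likewise for the three fields below. *)
Definition xs (z : E) : R := z.1 * sqnorm z `^ (- (lam / 2)).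

Lemma eucl_norm_powR (z : E) a : eucl_norm z.2 `^ a = sqnorm z `^ (a / 2).
Proof.
have q0 : 0 <= sqnorm z by rewrite sumr_ge0// => j _; rewrite sqr_ge0.
by rewrite /eucl_norm -/(sqnorm z) -powR12_sqrt// -powRrM mulrC.
Qed.

Lemma xsE (z : E) : xs z = similarity_var lam z.1 (eucl_norm z.2).
Proof. by rewrite /xs /similarity_var eucl_norm_powR powRN. Qed.

Lemma eucl_norm_gt0 (z : E) : (0 < eucl_norm z.2) = (0 < sqnorm z).
Proof. by rewrite /eucl_norm sqrtr_gt0. Qed.

Lemma fluidP (z : E) : Omega z <-> [/\ z.1 < 0, 0 < sqnorm z & x0 < xs z].
Proof.
split=> [[t0 rr]|[t0 q0 xx]].
  have rp : 0 < eucl_norm z.2 by apply: lt_trans rr; exact: interface_gt0.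
  by split => //; [rewrite -eucl_norm_gt0|rewrite xsE -interface_lt].
by split => //; rewrite interface_lt ?eucl_norm_gt0// -xsE.
Qed.

Lemma fluid_xs (z : E) : Omega z -> x0 < xs z < 0.
Proof.
move=> /fluidP[t0 q0 ->]; rewrite xsE similarity_lt0// eucl_norm_gt0//.
Qed.

Lemma fluid_neq0 (z : E) : Omega z -> z.1 != 0 /\ sqnorm z != 0.
Proof. by move=> /fluidP[t0 q0 _]; rewrite lt_eqF// gt_eqF. Qed.

Lemma powR_sqnorm_continuous (z : E) a : 0 < sqnorm z ->
  sqnorm y `^ a @[y --> z] --> sqnorm z `^ a.
Proof.
move=> q0; apply: (@cvg_comp _ _ _ (@sqnorm R n) (fun t => t `^ a)).
  exact: sqnorm_continuous.
exact: is_derive_continuous (is_derive1_powR a q0).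
Qed.

Lemma fluid_open (z : E) : Omega z -> \forall y \near z, Omega y.
Proof.
move=> /fluidP[t0 q0 xx].
have xc : xs y @[y --> z] --> xs z.
  by apply: cvgM; [exact: fst_continuous|exact: powR_sqnorm_continuous].
have h1 := @cvgr_lt R E (nbhs z) _ _ z.1 (@fst_continuous R n z) 0 t0.
have h2 := @cvgr_gt R E (nbhs z) _ _ (sqnorm z) (@sqnorm_continuous R n z) 0 q0.
have h3 := @cvgr_gt R E (nbhs z) _ _ (xs z) xc x0 xx.
by apply: filterS3 (h1 _) (h2 _) (h3 _) => y *; apply/fluidP; split.
Qed.

Local Notation radial := (radial Omega).

Lemma radial_powR a : radial (fun z => sqnorm z `^ (a / 2)) (fun z => a * sqnorm z `^ (a / 2)) (fun=> 0).
Proof.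
have H := @radial_comp R n Omega (fun t => t `^ (a / 2)) (fun t => a / 2 * t `^ (a / 2 - 1))
  _ _ _ (radial_sqnorm fluid_neq0).
apply: (radial_coef fluid_open _ _ (H _)) => z Oz /=.
- have /fluidP[_ q0 _] := Oz.
  rewrite powRB ?(gt_eqF q0) ?implybT// powRr1 ?ltW//.
  by field; rewrite gt_eqF.
- by rewrite mulr0.
- have /fluidP[_ q0 _] := Oz; split; first exact: is_derive1_powR.
  by apply: cvgMl_tmp; exact: is_derive_continuous (is_derive1_powR _ q0).
Qed.

Lemma radial_xs : radial xs (fun z => - lam * xs z) xs.
Proof.
have H1 := radial_powR (- lam).
have := radialM (radial_t fluid_neq0) H1; rewrite mulNr => H2.
by apply: (radial_coef fluid_open _ _ H2) => z Oz; rewrite /xs; ring.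
Qed.

Lemma radial_profile (f df : R -> R) :
  (forall x, x0 < x < 0 -> is_derive x 1 f (df x) /\ {for x, continuous df}) ->
  radial (fun z => f (xs z)) (fun z => df (xs z) * (- lam * xs z)) (fun z => df (xs z) * xs z).
Proof. by move=> H; apply: radial_comp radial_xs _ => z /fluid_xs; exact: H. Qed.

Definition frho (z : E) := sqnorm z `^ (kappa / 2) * Rf (xs z).
Definition fw (z : E) := - lam^-1 * (z.1^-1 * V (xs z)).
Definition fc (z : E) := - lam^-1 * (z.1^-1 * (sqnorm z `^ (1 / 2) * C (xs z))).

Lemma radial_inv_t : radial (fun z => z.1^-1) (fun=> 0) (fun z => - z.1^-1).
Proof.
have H := @radial_comp R n Omega (fun t => t^-1) (fun t => - t ^- 2) _ _ _ (radial_t fluid_neq0).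
apply: (radial_coef fluid_open _ _ (H _)) => z Oz /=; have [t0 _] := fluid_neq0 Oz.
- by rewrite mulr0.
- by field.
- split; first by have := is_deriveV t0 (is_derive_id z.1 1); rewrite /GRing.scale /= mulr1.
  apply: cvgN; apply: cvgV; first by rewrite expf_neq0.
  exact: exprn_continuous.
Qed.

Lemma radial_rho : radial frho
  (fun z => frho z * kappa + sqnorm z `^ (kappa / 2) * (dR (xs z) * (- lam * xs z)))
  (fun z => sqnorm z `^ (kappa / 2) * (dR (xs z) * xs z)).
Proof.
have H1 : radial (fun z => Rf (xs z)) (fun z => dR (xs z) * (- lam * xs z)) (fun z => dR (xs z) * xs z).
  by apply: radial_profile => x /profile[_ [_ _ ?] [_ _ ?] _].
by apply: (radial_coef fluid_open _ _ (radialM (radial_powR kappa) H1)) => z Oz;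
  rewrite /frho; ring.
Qed.

Lemma radial_w : radial fw
  (fun z => - lam^-1 * (z.1^-1 * (dV (xs z) * (- lam * xs z))))
  (fun z => - lam^-1 * (z.1^-1 * (dV (xs z) * xs z - V (xs z)))).
Proof.
have H1 : radial (fun z => V (xs z)) (fun z => dV (xs z) * (- lam * xs z)) (fun z => dV (xs z) * xs z).
  by apply: radial_profile => x /profile[_ [? _ _] [? _ _] _].
by apply: (radial_coef fluid_open _ _
   (radialM (@radial_cst R n Omega (- lam^-1)) (radialM radial_inv_t H1))) => z Oz; ring.
Qed.

Lemma radial_c : radial fc
  (fun z => fc z + - lam^-1 * (z.1^-1 * (sqnorm z `^ (1 / 2) *
      (dZ (xs z) / (2 * C (xs z)) * (- lam * xs z)))))
  (fun z => - fc z + - lam^-1 * (z.1^-1 * (sqnorm z `^ (1 / 2) *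
      (dZ (xs z) / (2 * C (xs z)) * xs z)))).
Proof.
have H1 : radial (fun z => C (xs z)) (fun z => dZ (xs z) / (2 * C (xs z)) * (- lam * xs z))
   (fun z => dZ (xs z) / (2 * C (xs z)) * xs z).
  apply: (@radial_profile C (fun x => dZ x / (2 * C x))) => x xx.
  have [[_ Zp _] [_ Zd _] [_ Zc _] _] := profile xx; split.
    by have := @is_derive1_comp _ Num.sqrt Z x _ _ (is_derive1_sqrt Zp) Zd; rewrite mulrC.
  apply: cvgM => //; apply: cvgV; first by rewrite mulf_neq0// gt_eqF// sqrtr_gt0.
  apply: cvgMl_tmp; apply: (@cvg_comp _ _ _ Z Num.sqrt).
    exact: is_derive_continuous Zd.
  exact: sqrt_continuous.
by apply: (radial_coef fluid_open _ _ (radialM (@radial_cst R n Omega (- lam^-1))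
   (radialM radial_inv_t (radialM (radial_powR 1) H1)))) => z Oz; rewrite /fc; ring.
Qed.

Lemma fieldsE (z : E) : Omega z ->
  [/\ 0 < frho z, 0 < fc z, density_field r0 rho z = frho z,
      radial_vector u z = fw z *: z.2 & radial_scalar c z = fc z].
Proof.
move=> Oz; have xx := fluid_xs Oz; have [[Vb Zp Rp] _ _ _] := profile xx.
have /fluidP[t0 q0 _] := Oz; have [_ rr] := Oz.
have rp : 0 < eucl_norm z.2 by rewrite eucl_norm_gt0.
have r1 : eucl_norm z.2 = sqnorm z `^ (1 / 2) by rewrite -eucl_norm_powR powRr1// ltW.
have rl : eucl_norm z.2 `^ (1 - lam) / xs z = eucl_norm z.2 / z.1.
  rewrite xsE /similarity_var powRB ?(gt_eqF rp) ?implybT// powRr1 ?ltW//.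
  by field; rewrite (lt_eqF t0) gt_eqF// powR_gt0.
have ln : lam != 0 by rewrite gt_eqF// lam_gt0.
have xn : xs z != 0 by rewrite lt_eqF//; case/andP: xx.
split.
- by rewrite /frho mulr_gt0// powR_gt0.
- have il : - lam^-1 < 0 by rewrite oppr_lt0 invr_gt0 lam_gt0.
  have it : z.1^-1 < 0 by rewrite invr_lt0.
  have p : 0 < sqnorm z `^ (1 / 2) * C (xs z) by rewrite mulr_gt0 ?powR_gt0 ?sqrtr_gt0.
  by rewrite /fc nmulr_rgt0// pmulr_llt0.
- by rewrite /density_field rr /sim_density -xsE eucl_norm_powR.
- rewrite /radial_vector /sim_speed -xsE /fw; congr (_ *: _).
  transitivity (- lam^-1 * V (xs z) * (eucl_norm z.2 `^ (1 - lam) / xs z) / eucl_norm z.2).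
    by field; rewrite ln xn gt_eqF.
  by rewrite rl; field; rewrite ln (lt_eqF t0) gt_eqF.
- rewrite /radial_scalar /sim_speed -xsE /fc -r1.
  transitivity (- lam^-1 * C (xs z) * (eucl_norm z.2 `^ (1 - lam) / xs z)).
    by field; rewrite ln xn.
  by rewrite rl; field; rewrite ln (lt_eqF t0).
Qed.

(** After division by a monomial the radial equations are the profile equations. *)
Lemma flow_euler : euler_classical_solution (1 + d) Omega (density_field r0 rho)
  (@radial_vector R n u) (@radial_scalar R n c).
Proof.
have g1 : 1 < 1 + d by rewrite ltrDl.
apply: (euler_of_radial fluid_neq0 fluid_open g1 radial_rho radial_w radial_c fieldsE).
move=> z Oz; have xx := fluid_xs Oz; have [[Vb Zp Rp] _ _ [e1 e2 e3]] := profile xx.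
have /fluidP[t0 q0 _] := Oz.
have ln : lam != 0 by rewrite gt_eqF// lam_gt0.
have tn : z.1 != 0 by rewrite lt_eqF.
have dn : 1 + d != 0 by rewrite gt_eqF// (lt_trans ltr01).
have qE : sqnorm z = (sqnorm z `^ (1 / 2)) ^+ 2.
  by rewrite expr2 -powRD ?(gt_eqF q0) ?implybT// -splitr powRr1// ltW.
have rp : 0 < sqnorm z `^ (1 / 2) by rewrite powR_gt0.
have kp : 0 < sqnorm z `^ (kappa / 2) by rewrite powR_gt0.
have ZE : Z (xs z) = Num.sqrt (Z (xs z)) ^+ 2 by rewrite sqr_sqrtr// ltW.
have Cp : 0 < Num.sqrt (Z (xs z)) by rewrite sqrtr_gt0.
move: e1 e2 e3 ZE qE; rewrite /fc /frho /fw /=.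
move: (xs z) (Num.sqrt (Z (xs z)))  (sqnorm z `^ (kappa / 2)) (sqnorm z `^ (1 / 2)) Cp rp kp Rp
  => x S A r Cp rp kp Rp e1 e2 e3 ZE qE; rewrite qE; rewrite ZE in e2 e3.
have Sn : S != 0 by rewrite gt_eqF.
have rn : r != 0 by rewrite gt_eqF.
have An : A != 0 by rewrite gt_eqF.
have Rn : Rf x != 0 by rewrite gt_eqF.
split.
- transitivity (- (A / lam) * ((1 + V x) * (- lam * x * dR x)
        + Rf x * (- lam * x * dV x + (kappa + n%:R) * V x))); last by rewrite e1 mulr0.
  by field; rewrite ln tn.
- transitivity ((lam ^+ 2 * z.1)^-1 * ((1 + V x) * (- lam * x * dV x) + (- lam * x * dZ x
        + S ^+ 2 * (- lam * x * dR x) / Rf x) / (1 + d)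
        + V x * (lam + V x) + (kappa + 2) * S ^+ 2 / (1 + d))); last by rewrite e3 mulr0.
  by field; rewrite ln tn dn Sn rn An Rn.
- transitivity ((r / (lam * z.1)) / (2 * S) / lam * ((1 + V x) * (- lam * x * dZ x)
        + S ^+ 2 * (d * (- lam * x * dV x) + 2 * lam + (2 + n%:R * d) * V x)));
    last by rewrite e2 mulr0.
  by field; rewrite ln tn Sn.
Qed.
(** * Behaviour at the interface and at the time of collapse *)

Section Limits.
Hypothesis V_vacuum : V x @[x --> x0^'+] --> (-1 : R).
Hypothesis Z_vacuum : Z x @[x --> x0^'+] --> (0 : R).
Hypothesis R_vacuum : Rf x @[x --> x0^'+] --> (0 : R).
Variables (lV lZ lR : R).
Hypothesis V_collapse : V x / x @[x --> 0^'-] --> lV.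
Hypothesis Z_collapse : Z x / x ^+ 2 @[x --> 0^'-] --> lZ.
Hypothesis R_collapse : Rf x @[x --> 0^'-] --> lR.

Lemma near_lt0 (a : R) : a < 0 -> \forall t \near (0 : R)^'-, a < t < 0.
Proof.
by move=> a0; near=> t; apply/andP; split; near: t; [exact: nbhs_left_gt|exact: nbhs_left_lt].
Unshelve. all: by end_near. Qed.

Lemma cvg_at_left_id : t @[t --> (0 : R)^'-] --> (0 : R).
Proof. by apply: cvg_at_left_filter; exact: cvg_id. Qed.

Lemma interface_cvg0 x1 : x1 < 0 -> interface lam x1 t @[t --> 0^'-] --> (0 : R).
Proof.
move=> x10; have il : 0 < lam^-1 by rewrite invr_gt0 lam_gt0.
rewrite -[X in _ --> X](@powR0 R lam^-1) ?gt_eqF//.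
apply: powR_cvg => //.
  by apply: filterS (near_lt0 x10) => t /andP[_ t0]; exact: ratio_gt0.
by rewrite -[X in _ --> X](mul0r x1^-1); apply: cvgMr_tmp; exact: cvg_at_left_id.
Qed.

Lemma flow_cavity : vacuum_cavity_collapses r0 (@density_field R n r0 rho).
Proof.
split; last exact: interface_cvg0.
  by move=> z [_ zr]; rewrite /density_field ltNge (ltW zr).
by move=> t; exact: interface_gt0.
Qed.

Lemma sim_speedE F t r : t != 0 -> 0 < r ->
  sim_speed lam F t r = - (r / (lam * t)) * F (similarity_var lam t r).
Proof.
move=> t0 rp; have rl : r `^ lam != 0 by rewrite gt_eqF ?powR_gt0.
have ln : lam != 0 by rewrite gt_eqF// lam_gt0.
rewrite /sim_speed /=; move: (F _) => a; rewrite /similarity_var.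
rewrite powRB ?(gt_eqF rp) ?implybT// powRr1 ?ltW//.
by field; rewrite ln t0 rl.
Qed.

Lemma similarity_interface x1 t : x1 < 0 -> t < 0 ->
  similarity_var lam t (interface lam x1 t) = x1.
Proof.
move=> x10 t0; rewrite /similarity_var interface_powR//.
by field; rewrite !lt_eqF.
Qed.

(** Along the curve [t / r ^ lam = x1], which reaches the centre at the time of
    collapse, the speed is a nonzero multiple of [r ^ (1 - lam)]. *)
Lemma sim_speed_blows_up F x1 : x0 < x1 < 0 -> F x1 != 0 ->
  blows_up_at_collapse r0 (sim_speed lam F).
Proof.
move=> /andP[x01 x10] Fx delta delta0.
have lp := lam_gt0.
apply/cvgeyPge => A; pose r t := interface lam x1 t.
(* the modulus of the speed at radius r is K / r ^ (lam - 1) *)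
pose K := `|F x1 / x1| / lam.
have K0 : 0 < K by rewrite divr_gt0// normr_gt0 mulf_neq0// invr_eq0 lt_eqF.
have l10 : 0 < lam - 1 by rewrite subr_gt0.
have qc : r t `^ (lam - 1) * A @[t --> 0^'-] --> (0 : R).
  rewrite -[X in _ --> X](mul0r A); apply: cvgMr_tmp.
  rewrite -[X in _ --> X](@powR0 R (lam - 1)) ?gt_eqF//.
  apply: powR_cvg => //; last exact: interface_cvg0.
  by apply: filterS (near_lt0 x10) => t /andP[_ t0]; exact: interface_gt0.
have h1 := cvgr_lt _ qc _ K0.
have h2 := cvgr_lt _ (interface_cvg0 x10) _ delta0.
apply: filterS3 (h1 _) (h2 _) (near_lt0 x10) => t qK rd /andP[_ t0].
have rp : 0 < r t by exact: interface_gt0.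
have qp : 0 < r t `^ (lam - 1) by rewrite powR_gt0.
apply: le_ereal_sup_tmp; exists (`|sim_speed lam F t (r t)|)%:E.
  exists (r t) => //=; rewrite in_itv /= rd andbT.
  by rewrite interface_lt// similarity_interface.
rewrite lee_fin /sim_speed similarity_interface//= normrM normrN normrM.
rewrite (ger0_norm (powR_ge0 _ _)) (@gtr0_norm _ lam^-1) ?invr_gt0//.
rewrite -opprB powRN.
have -> : (r t `^ (lam - 1))^-1 / lam * `|F x1 / x1| = K / r t `^ (lam - 1).
  by rewrite /K; ring.
by rewrite ler_pdivlMr// mulrC ltW.
Qed.

Lemma flow_blowup : blows_up_at_collapse r0 u /\ blows_up_at_collapse r0 c.
Proof.
have xx : x0 < x0 / 2 < 0 by have := x00 => h; apply/andP; split; lra.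
have [[/andP[_ V0] Z0 _] _ _ _] := profile xx.
split; apply: (sim_speed_blows_up xx); first by rewrite lt_eqF.
by rewrite gt_eqF// sqrtr_gt0.
Qed.

Lemma similarity_collapse r : 0 < r -> similarity_var lam t r @[t --> 0^'-] --> 0^'-.
Proof.
move=> rp A /=; rewrite {1}/at_left /within /= => H.
have xc : similarity_var lam t r @[t --> 0^'-] --> (0 : R).
  rewrite -[X in _ --> X](mul0r (r `^ lam)^-1).
  by apply: cvgMr_tmp; exact: cvg_at_left_id.
have h := xc _ H.
apply: filterS2 (near_lt0 (ltrN10 R)) h => t /andP[_ t0]; apply.
exact: similarity_lt0.
Qed.

Lemma C_collapse : C x / x @[x --> 0^'-] --> - Num.sqrt lZ.
Proof.
have H : - Num.sqrt (Z x / x ^+ 2) @[x --> 0^'-] --> - Num.sqrt lZ.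
  apply: cvgN; apply: (@cvg_comp _ _ _ (fun x => Z x / x ^+ 2) Num.sqrt) Z_collapse _.
  exact: sqrt_continuous.
apply: cvg_trans H; apply: near_eq_cvg.
apply: filterS (near_lt0 x00) => x xx.
have [[_ Zp _] _ _ _] := profile xx; have /andP[_ x_0] := xx.
rewrite sqrtrM ?ltW// -exprVn sqrtr_sqr ltr0_norm ?invr_lt0//.
by rewrite mulrN opprK.
Qed.

Definition rho1 r := r `^ kappa * lR.
Definition speed1 l r : R := - (r `^ (1 - lam) / lam) * l.

Lemma rho_collapse r : 0 < r -> rho t r @[t --> 0^'-] --> rho1 r.
Proof.
move=> rp; apply: cvgMl_tmp.
exact: cvg_comp (similarity_collapse rp) R_collapse.
Qed.

Lemma speed_collapse F l r : 0 < r -> F x / x @[x --> 0^'-] --> l ->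
  sim_speed lam F t r @[t --> 0^'-] --> speed1 l r.
Proof.
move=> rp Fl; apply: cvgMl_tmp.
exact: (@cvg_comp _ _ _ _ (fun x => F x / x) _ _ _ (similarity_collapse rp) Fl).
Qed.

Lemma flow_collapse_limits : [/\ has_collapse_limit rho, has_collapse_limit u & has_collapse_limit c].
Proof.
split=> r rp; apply/cvg_ex; eexists.
- exact: rho_collapse.
- exact: speed_collapse V_collapse.
- exact: speed_collapse C_collapse.
Qed.

Lemma up_to_collapse0 f r (l : R) : f t r @[t --> 0^'-] --> l -> up_to_collapse f 0 r = l.
Proof. by move=> fl; rewrite /up_to_collapse ltxx; exact: cvg_lim. Qed.

Lemma up_to_collapse_lt0 (f : R -> R -> R) t : t < 0 -> up_to_collapse f t = f t.
Proof. by move=> t0; apply/funext => r; rewrite /up_to_collapse t0. Qed.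
Lemma integrable_continuous_onto (f : R -> R) (a b l r : R) : a < b -> continuous_onto f a b l r ->
  (@lebesgue_measure R).-integrable `]a, b[ (EFin \o f).
Proof.
move=> ab /(extend_continuous ab) ec.
have H : (@lebesgue_measure R).-integrable `[a, b] (EFin \o extend a b l r f).
  by apply: continuous_compact_integrable; [exact: segment_compact|exact: continuous_subspaceT].
have H2 : (@lebesgue_measure R).-integrable `]a, b[ (EFin \o extend a b l r f).
  apply: integrableS H => //; exact: subset_itv_oo_cc.
apply: eq_integrable H2 => // x.
by rewrite inE /= in_itv /= => /andP[ax xb]; rewrite /extend leNgt ax xb.
Qed.

(** The fields have limits at the interface, so their integrability near it needs
    no estimate. *)
Lemma integrable_of_limit (f : R -> R) (a b l : R) : a < b ->
  (forall x, a < x -> {for x, continuous f}) -> f x @[x --> a^'+] --> l ->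
  (@lebesgue_measure R).-integrable `]a, b[ (EFin \o f).
Proof.
move=> ab fc fl; apply: (@integrable_continuous_onto f a b l (f b)) => //; split => //.
  by move=> x /andP[ax _]; exact: fc.
by apply: cvg_at_left_filter; exact: fc.
Qed.

Lemma powR_continuous (r a : R) : 0 < r -> {for r, continuous (fun s => s `^ a)}.
Proof. by move=> rp; exact: is_derive_continuous (is_derive1_powR a rp). Qed.

Lemma similarity_continuous t r : 0 < r -> {for r, continuous (similarity_var lam t)}.
Proof.
move=> rp; apply: cvgMl_tmp; apply: cvgV; last exact: powR_continuous.
by rewrite gt_eqF// powR_gt0.
Qed.

Lemma similarity_itv t r : t < 0 -> r0 t < r -> 0 < r /\ x0 < similarity_var lam t r < 0.
Proof.
move=> t0 rr; have rp : 0 < r by apply: lt_trans rr; exact: interface_gt0.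
by split => //; rewrite similarity_lt0// andbT -interface_lt.
Qed.

Lemma similarity_vacuum t : t < 0 -> similarity_var lam t r @[r --> (r0 t)^'+] --> x0^'+.
Proof.
move=> t0 A /=; rewrite {1}/at_right /within /= => H.
have rp : 0 < r0 t by exact: interface_gt0.
have xc : similarity_var lam t r @[r --> (r0 t)^'+] --> x0.
  apply: cvg_at_right_filter; rewrite -[X in _ --> X](similarity_interface x00 t0).
  exact: similarity_continuous.
have near_gt : \forall r \near (r0 t)^'+, r0 t < r by exact: nbhs_right_gt.
apply: filterS2 near_gt (xc _ H) => r rr; apply.
by have [_ /andP[]] := similarity_itv t0 rr.
Qed.

Definition profile_continuous (F : R -> R) := forall x, x0 < x < 0 -> {for x, continuous F}.

Lemma V_continuous : profile_continuous V.
Proof. by move=> x /profile[_ [H _ _] _ _]; exact: is_derive_continuous H. Qed.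

Lemma R_continuous : profile_continuous Rf.
Proof. by move=> x /profile[_ [_ _ H] _ _]; exact: is_derive_continuous H. Qed.

Lemma C_continuous : profile_continuous C.
Proof.
move=> x /profile[_ [_ H _] _ _]; apply: (@cvg_comp _ _ _ Z Num.sqrt).
  exact: is_derive_continuous H.
exact: sqrt_continuous.
Qed.

Lemma C_vacuum : C x @[x --> x0^'+] --> (0 : R).
Proof.
rewrite -[X in _ --> X](@sqrtr0 R); apply: (@cvg_comp _ _ _ Z Num.sqrt) Z_vacuum _.
exact: sqrt_continuous.
Qed.

Lemma rho_vacuum t : t < 0 -> rho t r @[r --> (r0 t)^'+] --> (0 : R).
Proof.
move=> t0; rewrite -[X in _ --> X](mulr0 (r0 t `^ kappa)); apply: cvgM.
  by apply: cvg_at_right_filter; apply: powR_continuous; exact: interface_gt0.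
exact: (@cvg_comp _ _ _ (similarity_var lam t) Rf) (similarity_vacuum t0) R_vacuum.
Qed.

Lemma speed_vacuum F (l t : R) : t < 0 -> F x @[x --> x0^'+] --> l ->
  sim_speed lam F t r @[r --> (r0 t)^'+] --> - (r0 t / (lam * t)) * l.
Proof.
move=> t0 Fl; have rp : 0 < r0 t by exact: interface_gt0.
have H : - (r / (lam * t)) * F (similarity_var lam t r) @[r --> (r0 t)^'+] -->
    - (r0 t / (lam * t)) * l.
  apply: cvgM.
    by apply: cvgN; apply: cvgMr_tmp; apply: cvg_at_right_filter; exact: cvg_id.
  exact: (@cvg_comp _ _ _ (similarity_var lam t) F) (similarity_vacuum t0) Fl.
apply: cvg_trans H; apply: near_eq_cvg.
have near_gt : \forall r \near (r0 t)^'+, r0 t < r by exact: nbhs_right_gt.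
apply: filterS near_gt => r rr; rewrite sim_speedE ?lt_eqF//.
by have [] := similarity_itv t0 rr.
Qed.

Lemma rho_continuous t r : t < 0 -> r0 t < r -> {for r, continuous (rho t)}.
Proof.
move=> t0 rr; have [rp xx] := similarity_itv t0 rr.
apply: cvgM; first exact: powR_continuous.
apply: (@cvg_comp _ _ _ (similarity_var lam t) Rf); first exact: similarity_continuous.
exact: R_continuous.
Qed.

Lemma speed_continuous F t r : profile_continuous F -> t < 0 -> r0 t < r ->
  {for r, continuous (sim_speed lam F t)}.
Proof.
move=> Fc t0 rr; have [rp xx] := similarity_itv t0 rr; have lp := lam_gt0.
have xc := @similarity_continuous t _ rp.
apply: cvgM.
  by apply: cvgN; apply: cvgMr_tmp; exact: powR_continuous.
apply: cvgM; last by apply: cvgV => //; rewrite lt_eqF//; case/andP: xx.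
by apply: (@cvg_comp _ _ _ (similarity_var lam t) F); [exact: xc|exact: Fc].
Qed.

Lemma flow_pressure : vanishing_interface_pressure (1 + d) r0 rho c.
Proof.
move=> t t0; rewrite /pressure /internal_energy.
set K := (X in _ --> X).
have -> : K = (1 + d - 1) * 0 * ((- (r0 t / (lam * t)) * 0) ^+ 2 / ((1 + d) * (1 + d - 1))) :> R.
  by rewrite /K mulr0 mul0r.
apply: cvgM; first by apply: cvgMl_tmp; exact: rho_vacuum.
apply: cvgMr_tmp; have H := speed_vacuum t0 C_vacuum.
exact: cvgM.
Qed.

Lemma is_derive_interface (a t : R) : t < 0 ->
  is_derive t 1 (fun s => (s / x0) `^ a) (a / x0 * (t / x0) `^ (a - 1)).
Proof.
move=> t0; have tp := ratio_gt0 x00 t0.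
have H := @is_derive1_comp _ (fun s => s `^ a) (fun s => s * x0^-1) t _ _
  (is_derive1_powR a tp) (is_derive_mul (is_derive_id t 1) (is_derive_cst x0^-1 t 1)).
apply: is_derive_eq H _.
by rewrite /GRing.scale /=; ring.
Qed.

(** As [V] tends to [-1] at the interface, the speed there is [r0 / (lam t)], the
    derivative of [r0]. *)
Lemma flow_interface : material_interface r0 u.
Proof.
move=> t t0; have H := is_derive_interface lam^-1 t0; split; first by case: H.
have ln : lam != 0 by rewrite gt_eqF// lam_gt0.
have tp := ratio_gt0 x00 t0.
have tn : t != 0 by rewrite lt_eqF.
have xn : x0 != 0 by rewrite lt_eqF.
have -> : derive1 r0 t = - (r0 t / (lam * t)) * -1.
  rewrite derive1E; case: H => _ ->; rewrite /interface.
  rewrite powRB ?(gt_eqF tp) ?implybT// powRr1 ?ltW//.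
  by field; rewrite ln tn xn.
exact: speed_vacuum.
Qed.

Lemma flow_acceleration : finite_nonzero_acceleration r0.
Proof.
move=> t t0; have lp := lam_gt0.
pose a := lam^-1 / x0; pose b := lam^-1 - 1.
have near_eq : \forall s \near t, a * (s / x0) `^ b = derive1 r0 s.
  apply: filterS (lt_nbhsl t0) => s s0.
  by rewrite derive1E; case: (is_derive_interface lam^-1 s0) => _ ->.
have H : is_derive t 1 (derive1 r0) (a * (b / x0 * (t / x0) `^ (b - 1))).
  apply: near_eq_is_derive near_eq _.
  apply: is_derive_eq (is_derive_mul (is_derive_cst a t 1) (is_derive_interface b t0)) _.
  by rewrite mulr0 addr0.
split; first by case: H.
rewrite derive1E; case: H => _ ->.
have xn : x0^-1 != 0 by rewrite invr_eq0 lt_eqF.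
have bn : b != 0 by rewrite subr_eq0 invr_eq1 gt_eqF.
have pn : (t / x0) `^ (b - 1) != 0 by rewrite gt_eqF// powR_gt0//; exact: ratio_gt0.
by rewrite !mulf_neq0// invr_eq0 gt_eqF.
Qed.

Lemma exprn_at_right (a : R) k : r ^+ k @[r --> a^'+] --> a ^+ k.
Proof. by apply: cvg_at_right_filter; exact: exprn_continuous. Qed.

Lemma finite_before_collapse t b : t < 0 -> r0 t < b ->
  [/\ (@lebesgue_measure R).-integrable `]r0 t, b[ (EFin \o (fun r => rho t r * r ^+ n.-1)),
    (@lebesgue_measure R).-integrable `]r0 t, b[ (EFin \o (fun r => rho t r * `|u t r| * r ^+ n.-1)) &
    (@lebesgue_measure R).-integrable `]r0 t, b[ (EFin \o (fun r =>
      rho t r * (internal_energy (1 + d) (c t r) + u t r ^+ 2 / 2) * r ^+ n.-1))].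
Proof.
move=> t0 rb; have rl := rho_vacuum t0.
have ul := speed_vacuum t0 V_vacuum; have cl := speed_vacuum t0 C_vacuum.
have en := @exprn_at_right (r0 t) n.-1.
have ec (r : R) : {for r, continuous (fun r : R => r ^+ n.-1)} by exact: exprn_continuous.
have rc := fun r => @rho_continuous t r t0; have uc := fun r => @speed_continuous V t r V_continuous t0.
have cc := fun r => @speed_continuous C t r C_continuous t0.
split; (apply: integrable_of_limit; first exact: rb).
- by move=> r rr; apply: cvgM; [exact: rc|exact: ec].
- exact: cvgM rl en.
- move=> r rr; apply: cvgM; last exact: ec.
  apply: cvgM; first exact: rc.
  by apply: cvg_norm; exact: uc.
- by apply: cvgM en; apply: cvgM rl _; exact: cvg_norm ul.
- move=> r rr; apply: cvgM; last exact: ec.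
  apply: cvgM; first exact: rc.
  apply: cvgD; apply: cvgMr_tmp.
    by apply: cvgM; exact: cc.
  by apply: cvgM; exact: uc.
- apply: cvgM en; apply: cvgM rl _; apply: cvgD; apply: cvgMr_tmp.
    by apply: cvgM; exact: cl.
  by apply: cvgM; exact: ul.
Qed.

Lemma integrable_powR (f : R -> R) (a K b : R) k : 0 < a -> 0 < b ->
  (forall r, 0 < r -> f r = K * r `^ a * r ^+ k) ->
  (@lebesgue_measure R).-integrable `]0, b[ (EFin \o f).
Proof.
move=> a0 b0 fE.
have H : (@lebesgue_measure R).-integrable `]0, b[ (EFin \o (fun r => K * r `^ a * r ^+ k)).
  apply: integrable_of_limit => //.
    move=> r rp; apply: cvgM; last exact: exprn_continuous.
    by apply: cvgMl_tmp; exact: powR_continuous.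
  apply: cvgM; last exact: exprn_at_right.
  by apply: cvgMl_tmp; exact: powR_cvg0.
apply: eq_integrable H => // r.
by rewrite inE /= in_itv /= => /andP[rp _]; rewrite fE.
Qed.

(** At the time of collapse the fields are pure powers of [r], and [kappa] exceeds
    [2 (lam - 1)], twice the exponent lost by the speeds. *)
Lemma finite_at_collapse b : 0 < b ->
  [/\ (@lebesgue_measure R).-integrable `]0, b[ (EFin \o (fun r => up_to_collapse rho 0 r * r ^+ n.-1)),
    (@lebesgue_measure R).-integrable `]0, b[ (EFin \o (fun r =>
      up_to_collapse rho 0 r * `|up_to_collapse u 0 r| * r ^+ n.-1)) &
    (@lebesgue_measure R).-integrable `]0, b[ (EFin \o (fun r =>
      up_to_collapse rho 0 r * (internal_energy (1 + d) (up_to_collapse c 0 r)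
        + up_to_collapse u 0 r ^+ 2 / 2) * r ^+ n.-1))].
Proof.
move=> b0; have kg := kappa_gt; have l1 := lam1; have lp := lam_gt0.
have k0 : 0 < kappa by lra.
have rE r : 0 < r -> up_to_collapse rho 0 r = rho1 r.
  by move=> rp; apply: up_to_collapse0; exact: rho_collapse.
have uE r : 0 < r -> up_to_collapse u 0 r = speed1 lV r.
  by move=> rp; apply: up_to_collapse0; exact: speed_collapse V_collapse.
have cE r : 0 < r -> up_to_collapse c 0 r = speed1 (- Num.sqrt lZ) r.
  by move=> rp; apply: up_to_collapse0; exact: speed_collapse C_collapse.
have pE r a : 0 < r -> r `^ (a + (1 - lam)) = r `^ a * r `^ (1 - lam).
  by move=> rp; rewrite powRD// (gt_eqF rp) implybT.
split.
- apply: (@integrable_powR _ kappa lR b n.-1) => // r rp.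
  by rewrite rE// /rho1; ring.
- apply: (@integrable_powR _ (kappa + (1 - lam)) (lR * (`|lV| / lam)) b n.-1) => //; first by lra.
  move=> r rp; rewrite rE// uE// /rho1 /speed1 pE// !normrM normrN normrM.
  by rewrite ger0_norm ?powR_ge0// (@gtr0_norm _ lam^-1) ?invr_gt0//; ring.
- apply: (@integrable_powR _ (kappa + (1 - lam) + (1 - lam))
    (lR * (Num.sqrt lZ ^+ 2 / ((1 + d) * (1 + d - 1)) + lV ^+ 2 / 2) / lam ^+ 2) b n.-1) => //.
    by lra.
  move=> r rp; rewrite rE// uE// cE// /rho1 /speed1 !pE// /internal_energy.
  have dn : d != 0 by rewrite gt_eqF.
  have dn1 : 1 + d != 0 by rewrite gt_eqF// (lt_trans ltr01)// ltrDl.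
  have ln : lam != 0 by rewrite gt_eqF.
  have -> : 1 + d - 1 = d by ring.
  by field; rewrite ln dn dn1.
Qed.

Lemma flow_finite : locally_bounded_mass_momentum_energy n (1 + d) r0 rho u c.
Proof.
move=> t b; rewrite le_eqVlt => /predU1P[->|t0] rb /=.
  have r00 : r0 0 = 0 by rewrite /interface mul0r powR0// invr_eq0 gt_eqF// lam_gt0.
  by rewrite r00 in rb *; exact: finite_at_collapse.
by rewrite !up_to_collapse_lt0//; exact: finite_before_collapse.
Qed.

(** On a curve of constant self-similar variable, parametrized by the radius [s], the
    entropy is affine in [ln s] with the nonzero slope
    [2 (1 - lam) - kappa d], up to the factor [cv]. *)
Lemma flow_non_isentropic cv : (0 < n)%N -> 0 < cv ->
  non_isentropic (1 + d) cv Omega (@density_field R n r0 rho) (@radial_scalar R n c).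
Proof.
move=> n0 cv0 [S HS]; have lp := lam_gt0; have dd := d0.
pose x1 := x0 / 2; have xx : x0 < x1 < 0 by have := x00 => h; apply/andP; split; rewrite /x1; lra.
have [x01 x10] := andP xx; have [[_ Zp Rp] _ _ _] := profile xx.
pose z s : E := (x1 * s `^ lam, s *: delta_mx 0 (Ordinal n0)).
have nz s : 0 < s -> eucl_norm (z s).2 = s.
  move=> sp; rewrite /eucl_norm (bigD1 (Ordinal n0))//= big1 ?addr0.
    by rewrite !mxE !eqxx mulr1 sqrtr_sqr gtr0_norm.
  by move=> j jn; rewrite !mxE (negbTE jn) andbF mulr0 expr0n.
have simz s : 0 < s -> similarity_var lam (z s).1 s = x1.
  by move=> sp; rewrite /similarity_var /= mulfK// gt_eqF// powR_gt0.
have Oz s : 0 < s -> Omega (z s).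
  move=> sp; have t0 : (z s).1 < 0 by rewrite /= nmulr_rlt0// powR_gt0.
  by split => //; rewrite nz// interface_lt// simz.
have rhoz s : 0 < s -> density_field r0 rho (z s) = s `^ kappa * Rf x1.
  move=> sp; have [_ rr] := Oz _ sp.
  by rewrite /density_field rr nz// /sim_density simz.
have cz s : 0 < s -> radial_scalar c (z s) = s `^ (1 - lam) * (- (C x1 / x1) / lam).
  by move=> sp; rewrite /radial_scalar nz// /sim_speed simz//; ring.
pose a := 2 * (1 - lam) - kappa * d.
pose K := internal_energy (1 + d) (- (C x1 / x1) / lam) * Rf x1 `^ (- d).
have K0 : 0 < K.
  have Cp : 0 < C x1 by rewrite sqrtr_gt0.
  have -> : K = (C x1 / x1 / lam) ^+ 2 / ((1 + d) * d) * Rf x1 `^ (- d).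
    by rewrite /K /internal_energy; congr (_ / _ * _); ring.
  have dp : 0 < (1 + d) * d by rewrite mulr_gt0// addr_gt0.
  rewrite mulr_gt0 ?powR_gt0// divr_gt0// exprn_even_gt0//=.
  by rewrite !mulf_neq0 ?invr_eq0 ?(lt_eqF x10) ?(gt_eqF lp) ?(gt_eqF Cp).
have Sz s : 0 < s -> a * ln s + ln K = S / cv.
  move=> sp; rewrite -(HS _ (Oz _ sp)) /entropy [cv * _]mulrC mulfK ?gt_eqF//.
  rewrite rhoz// cz// -ln_powR -lnM ?posrE ?powR_gt0//; congr (ln _).
  have -> : 1 - (1 + d) = - d by ring.
  rewrite powRM ?powR_ge0 ?(ltW Rp)// -powRrM.
  have -> : a = (1 - lam) + (1 - lam) + kappa * (- d) by rewrite /a; ring.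
  rewrite /K /internal_energy !powRD ?(gt_eqF sp) ?implybT//.
  by ring.
have two0 : 0 < 2 :> R by [].
have := Sz 2 two0; rewrite -(Sz 1 ltr01) ln1 mulr0 => /addIr /eqP.
rewrite mulf_eq0 => /orP[/eqP|]; last by rewrite gt_eqF// ln_gt0// ltr1n.
have := kappa_gt; have := lam1 => l1 kg.
have k0 : 0 < kappa by lra.
have := mulr_gt0 k0 d0; rewrite /a; lra.
Qed.

Lemma flow_is_collapsing cv : (0 < n)%N -> 0 < cv ->
  is_collapsing_cavity_flow n (1 + d) cv lam kappa x0 Rf V C.
Proof.
move=> n0 cv0; split; first by split; [exact: flow_euler|exact: flow_cavity].
split; first exact: flow_non_isentropic.
split; first exact: flow_blowup.
split; first by split; [exact: flow_collapse_limits|exact: flow_finite].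
split; first exact: flow_pressure.
by split; [exact: flow_interface|exact: flow_acceleration].
Qed.

End Limits.
End Flow.

(** * Existence of the flow *)

Lemma collapsing_cavity_flow (R : realType) (n : nat) (gamma cv : R) :
  n = 2%N \/ n = 3%N -> 1 < gamma -> 0 < cv -> admits_collapsing_cavity_flow n gamma cv.
Proof.
move=> n23 gamma1 cv0; pose d := gamma - 1.
have d0 : 0 < d by rewrite subr_gt0.
have N23 : n%:R = 2 :> R \/ n%:R = 3 :> R by case: n23 => ->; [left|right].
have n0 : (0 < n)%N by case: n23 => ->.
have -> : gamma = 1 + d by rewrite addrC subrK.
have [x0 [V [Z [Rf [dV [dZ [dR [x00 prof [vacV vacZ vacR] [lV [lZ [lR [colV colZ colR]]]]]]]]]]]]
  := profile_exists N23 d0.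
have l1 := lam_gt1 N23 d0.
have kg : 2 * lam n%:R d - 1 < kappa n%:R d.
  by have := N0_gt N23 d0; rewrite /kappa /lam; lra.
exists (lam n%:R d), (kappa n%:R d), x0, Rf, V, (fun x => Num.sqrt (Z x)).
split; [exact: l1|exact: x00| |exact: (flow_is_collapsing d0 l1 kg x00 prof vacV vacZ vacR colV colZ colR n0 cv0)].
by move=> x /prof[[_ Zp Rp] _ _ _]; rewrite sqrtr_gt0.
Qed.

Theorem theorem2p1 :
  forall R : realType,
  (forall (n : nat) (gamma cv : R),
     n = 2%N \/ n = 3%N -> 1 < gamma -> 0 < cv ->
     admits_collapsing_cavity_flow n gamma cv) /\
  (forall (n : nat) (gamma cv : R),
     n = 2%N \/ n = 3%N ->
     gamma = 5 / 3 \/ gamma = 7 / 5 \/ gamma = 3 -> 0 < cv ->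
     admits_collapsing_cavity_flow n gamma cv).
Proof.
move=> R; split; first exact: collapsing_cavity_flow.
move=> n gamma cv n23 g cv0; apply: collapsing_cavity_flow => //.
by case: g => [->|[->|->]]; lra.
Qed.
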